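(* Let $\alpha>0$, let $G=(V,E)$ be a finite undirected graph which has at most one loop-edge at each vertex and is simple after removing all loop-edges, and let $(U_v)_{v\in V}$, $d^\alpha$, $D^\alpha$, $\Delta^\alpha_\rho$, $D^\alpha_\ell$, their heat kernels, and $\operatorname{ind}(d^\alpha)$ be as defined in the context. Let $G'$ be the graph obtained from $G$ by removing all loop-edges, and $\chi(G')$ its Euler characteristic (number of vertices minus number of edges). (1) If every vertex of $G$ has a loop-edge, then $$\lim_{t\to\infty}\left(\operatorname{tr}(p_{D^\alpha,t})-\operatorname{tr}(p_{\Delta_\rho^\alpha,t})\right)=\chi(G')=\operatorname{ind}(d^\alpha).$$ (2) Otherwise, $$\lim_{\ell\to\infty}\lim_{t\to\infty}\left(\operatorname{tr}(p_{D_\ell^\alpha,t})-\operatorname{tr}(p_{\Delta_\rho^\alpha,t})\right)=\chi(G')=\operatorname{ind}(d^\alpha).$$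
   Context: Setting. $p$ is a prime, $|\cdot|_p$ the $p$-adic absolute value, and $dx$ the Haar measure on $\mathbb{Q}_p$ with $\int_{\mathbb{Z}_p}dx=1$. All functions are complex-valued. $G=(V,E)$ is a finite undirected graph with at most one loop-edge at each vertex and simple after removing all loop-edges. $E_0\subseteq E$ is the set of loop-edges and $E'=E\setminus E_0$. To the vertices $v\in V$ are assigned pairwise disjoint non-empty compact open sets $U_v\subset\mathbb{Q}_p$ such that for all $v\ne w$ in $V$ and all $x\in U_v$, $y\in U_w$: $|x-y|_p=\operatorname{dist}(U_v,U_w)$, where $\operatorname{dist}(A,B)=\inf\{|x-y|_p: x\in A,\,y\in B\}$. Put $\Omega_V=\bigsqcup_{v}U_v\subset\mathbb{Q}_p$, and let $\Omega_E\subset\mathbb{Q}_p^2$ be the union of all $U_v\times U_w$ with $v,w$ joined by an edge of $G$ (both orders; $v=w$ allowed exactly when $v$ has a loop-edge). Operators. $L^2(\Omega_E)_\sigma=\{h\in L^2(\Omega_E): h(x,y)=-h(y,x)\text{ on }\Omega_E\}$. For $\alpha>0$: the gradient $d^\alpha: L^2(\Omega_V)\to L^2(\Omega_E)_\sigma$ is $(d^\alpha f)(x,y)=\dfrac{f(x)-f(y)}{2|x-y|_p^{\alpha}}$ for $(x,y)\in\Omega_E$; the divergence $\delta^\alpha: L^2(\Omega_E)_\sigma\to L^2(\Omega_V)$ is $(\delta^\alpha h)(x)=\displaystyle\int_{\{y\in\Omega_V:(x,y)\in\Omega_E\}}h(x,y)|x-y|_p^{-\alpha}\,dy$. These are possibly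 unbounded if $E_0\neq\emptyset$; they are given by these formulas on locally constant functions and extended by closure. The vertex Laplacian is $D^\alpha=\delta^\alpha d^\alpha$, i.e. the (closed, non-negative self-adjoint) operator on $L^2(\Omega_V)$ determined by its action on locally constant functions. Let $L^2(\Omega_E)_\rho=\{h\in L^2(\Omega_E)_\sigma: h|_{U_v\times U_w}\text{ is constant for every edge }(v,w)\text{ of }G\}$ (finite-dimensional), let $\delta^\alpha_\rho$ be the restriction of $\delta^\alpha$ to $L^2(\Omega_E)_\rho$, and $\Delta^\alpha_\rho=d^\alpha\delta^\alpha_\rho: L^2(\Omega_E)_\rho\to L^2(\Omega_E)_\rho$. The index is $\operatorname{ind}(d^\alpha)=\dim\ker d^\alpha-\dim\ker\delta^\alpha_\rho$. Finite approximations. For $\ell\in\mathbb{N}$ large enough that each $U_v$ is a disjoint union of discs of radius $p^{-\ell}$, let $\Omega_{V,\ell}$ be the finite set of discs of radius $p^{-\ell}$ contained in $\Omega_V$. For distinct $x,y\in\Omega_{V,\ell}$ let $|x-y|_p$ be the (well-defined) distance between any of their points. $D^\alpha_\ell$ acts on functions $f$ on $\Omega_{V,\ell}$ (with the counting measure) by $(D^\alpha_\ell f)(x)=\sum_{y}\dfrac{f(x)-f(y)}{|x-y|_p^{2\alpha}}$, the sum being over all $y\in\Omega_{V,\ell}$, $y\neq x$, with $x\times y\subset\Omega_E$. Heat kernels. For $A$ one of $D^\alpha$ (when every vertex has a loop-edge), $D^\alpha_\ell$, $\Delta^\alpha_\rho$, the heat kernel is $p_{A,t}=\sum_\lambda e^{-\lambda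 t}f_\lambda(x)\overline{f_\lambda(y)}$, the sum being over an orthonormal basis of eigenfunctions $f_\lambda$ of $A$ with eigenvalues $\lambda$ counted with multiplicity, and its trace is $\operatorname{tr}(p_{A,t})=\sum_\lambda e^{-\lambda t}$.
   Formalization: In (1) the limit is stated when tr(p_{D^α,t}) is finite for large t (proved for α ≥ 1/2; for α < 1/2 and V nonempty it is +∞). In (2) ind(d^α) must be defined (both kernels finite-dimensional), proved when every vertex lies on an edge or loop; else ker d^α is infinite-dimensional. *)

(* Defs.v *)
From HB Require Import structures.
From mathcomp Require Import all_boot all_order all_algebra finmap.
From mathcomp Require Import all_classical all_reals all_analysis.
From mathcomp Require Export complex.

Set Implicit Arguments.
Unset Strict Implicit.
Unset Printing Implicit Defensive.

Import Order.TTheory GRing.Theory Num.Theory.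
Import numFieldNormedType.Exports.
Local Open Scope classical_set_scope.
Local Open Scope ring_scope.
Local Open Scope complex_scope.

(* p ^ (- v_p q), and 0 at q = 0 *)
Definition rat_padic_abs (R : realType) (p : nat) (q : rat) : R :=
  if q == 0 then 0
  else p%:R ^ ((logn p `|denq q|)%:Z - (logn p `|numq q|)%:Z).

(* Q_p as the completion of Q for the p-adic absolute value, which determines
   it up to a unique isometric isomorphism; results about Q_p are stated for an
   arbitrary such completion. *)
Record padicField (R : realType) (p : nat) := PadicField {
  padic_sort :> fieldType;
  padic_abs : padic_sort -> R;
  padic_abs_eq0 : forall x, padic_abs x = 0 -> x = 0;
  padic_absM : forall x y, padic_abs (x * y) = padic_abs x * padic_abs y;
  padic_absD : forall x y,
    padic_abs (x + y) <= Num.max (padic_abs x) (padic_abs y);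
  padic_abs_ratr : forall q : rat, padic_abs (ratr q) = rat_padic_abs R p q;
  padic_dense : forall x (e : R), 0 < e ->
    exists q : rat, padic_abs (x - ratr q) < e;
  padic_complete : forall u : nat -> padic_sort,
    (forall e : R, 0 < e -> exists N, forall m n, (N <= m)%N -> (N <= n)%N ->
      padic_abs (u m - u n) < e) ->
    exists x, forall e : R, 0 < e -> exists N, forall n, (N <= n)%N ->
      padic_abs (u n - x) < e }.

Definition Qp (R : realType) (p : nat) (F : padicField R p) : Type :=
  padic_sort F.

Section qp_structures.
Context {R : realType} {p : nat} (F : padicField R p).

HB.instance Definition _ := GRing.Field.on (Qp F).

Definition qabs (x : Qp F) : R := @padic_abs R p F x.

Let qabs0 : qabs 0 = 0.
Proof.
have -> : (0 : Qp F) = ratr 0 by rewrite /ratr mul0r.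
by rewrite /qabs padic_abs_ratr /rat_padic_abs eqxx.
Qed.

Let qabsN1 : qabs (-1) = 1.
Proof.
have -> : (-1 : Qp F) = ratr (-1) by rewrite /ratr divr1.
by rewrite /qabs padic_abs_ratr /rat_padic_abs /= logn1 subrr expr0z.
Qed.

Let qabsN x : qabs (- x) = qabs x.
Proof. by rewrite -mulN1r {1}/qabs padic_absM [padic_abs _]qabsN1 mul1r. Qed.

Let qabs_ge0 x : 0 <= qabs x.
Proof.
have := padic_absD x (- x).
by rewrite subrr -/(qabs _) -/(qabs _) -/(qabs _) qabs0 qabsN maxxx.
Qed.

Let qdist (x y : Qp F) : R := qabs (x - y).

Let qdistxx x : qdist x x = 0.
Proof. by rewrite /qdist subrr qabs0. Qed.

Let qdist_pos x y : qdist x y = 0 -> x = y.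
Proof. by move=> /(@padic_abs_eq0 R p F) /eqP; rewrite subr_eq0 => /eqP. Qed.

Let qdist_sym x y : qdist x y = qdist y x.
Proof. by rewrite /qdist -opprB qabsN. Qed.

Let qdist_triangle y x z : qdist x z <= qdist x y + qdist y z.
Proof.
rewrite /qdist -(subrKA y) (le_trans (padic_absD _ _))//.
by rewrite ge_max lerDl lerDr !qabs_ge0.
Qed.

HB.instance Definition _ := @isMetric.Build R (Qp F) qdist
  qdistxx qdist_pos qdist_sym qdist_triangle.

HB.instance Definition _ := isPointed.Build (Qp F) 0.

HB.instance Definition _ := Measurable.copy (Qp F)
  (g_sigma_algebraType (@open (Qp F))).

End qp_structures.

(* The normalised Haar measure of (Q_p, +). Sigma-finiteness, carried by the
   type of [mu], follows from the two conditions below. *)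
Definition is_haar (R : realType) (p : nat) (F : padicField R p)
    (mu : {sigma_finite_measure set (Qp F) -> \bar R}) : Prop :=
  mu [set x | qabs x <= 1] = 1%E /\
  forall (a : Qp F) (A : set (Qp F)), measurable A ->
    mu [set x + a | x in A] = mu A.

(* Elements of L^2 are represented by functions defined on the whole type, of
   which only the values on D, up to a null set, are relevant. *)
Section complex_L2.
Context {d} {T : measurableType d} {R : realType}.
Variables (mu : {measure set T -> \bar R}) (D : set T).
Implicit Types f g : T -> R[i].

Definition cintegral f : R[i] :=
  (\int[mu]_(x in D) complex.Re (f x))%R +i*
  (\int[mu]_(x in D) complex.Im (f x))%R.

Definition L2norm2 f : \bar R :=
  (\int[mu]_(x in D) (complex.Re (f x) ^+ 2 + complex.Im (f x) ^+ 2)%:E)%E.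

Definition L2 : set (T -> R[i]) :=
  [set f | [/\ measurable_fun D (fun x => complex.Re (f x)),
               measurable_fun D (fun x => complex.Im (f x)) &
               (L2norm2 f < +oo)%E]].

Definition L2ip f g : R[i] := cintegral (fun x => f x * (g x)^*).

Definition L2cvg (u : nat -> T -> R[i]) f : Prop :=
  L2norm2 (fun x => u n x - f x) @[n --> \oo] --> 0%E.

Definition L2null : set (T -> R[i]) :=
  [set f | {ae mu, forall x, D x -> f x = 0}].

End complex_L2.

(* The graph of the closure of the operator [A] with domain [dom], from
   L^2(D1) to L^2(D2). *)
Definition op_closure d1 d2 (T1 : measurableType d1) (T2 : measurableType d2)
    (R : realType) (mu1 : {measure set T1 -> \bar R}) (D1 : set T1)
    (mu2 : {measure set T2 -> \bar R}) (D2 : set T2)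
    (dom : set (T1 -> R[i])) (A : (T1 -> R[i]) -> T2 -> R[i]) :
    set ((T1 -> R[i]) * (T2 -> R[i])) :=
  [set fg | [/\ L2 mu1 D1 fg.1, L2 mu2 D2 fg.2 &
     exists u : nat -> T1 -> R[i],
       [/\ forall n, dom (u n), L2cvg mu1 D1 u fg.1 &
           L2cvg mu2 D2 (fun n => A (u n)) fg.2]]].

Section linear_notions.
Context {T : Type} {R : realType}.

(* [S / N] has dimension [n], where [S] is a subspace and [N] the functions that
   count as zero. *)
Definition has_dim (S N : set (T -> R[i])) (n : nat) : Prop :=
  exists2 b : 'I_n -> T -> R[i], forall i, S (b i) &
    forall f, S f -> exists! c : 'I_n -> R[i],
      N (fun x => f x - \sum_(i < n) c i * b i x).

Definition fin_dim (S N : set (T -> R[i])) : Prop := exists n, has_dim S N n.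

(* 0 when [S / N] is infinite-dimensional *)
Definition dim (S N : set (T -> R[i])) : nat := xget 0%N (has_dim S N).

(* [H] is a Hilbert space of functions with inner product [ip], [A] is the graph
   of an operator on [H]. *)
Variables (H : set (T -> R[i])) (ip : (T -> R[i]) -> (T -> R[i]) -> R[i]).
Variable A : set ((T -> R[i]) * (T -> R[i])).

Definition eigenbasis (I : choiceType) (lam : I -> R) (f : I -> T -> R[i]) :=
  [/\ forall i, H (f i),
      forall i, A (f i, (fun x => (lam i)%:C * f i x)),
      forall i j, ip (f i) (f j) = (i == j)%:R &
      forall g, H g -> forall eps : R, 0 < eps ->
        exists (s : seq I) (c : I -> R[i]),
          let r := fun x => g x - \sum_(i <- s) c i * f i x in
          complex.Re (ip r r) < eps].

(* [tr t] is the trace at time [t] of the heat kernel of [A]. *)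
Definition heat_trace (tr : R -> \bar R) : Prop :=
  exists (I : choiceType) (lam : I -> R) (f : I -> T -> R[i]),
    eigenbasis lam f /\
    forall t, tr t = \esum_(i in [set: I]) (expR (- lam i * t))%:E.

End linear_notions.

(* A finite undirected graph that is simple up to at most one loop at each
   vertex is a symmetric relation; loops are the diagonal pairs. *)
Section graphs.
Context {V : finType}.

Definition loopless (e : rel V) : rel V := fun v w => (v != w) && e v w.

Definition edges (e : rel V) : {set {set V}} :=
  [set A : {set V} | [exists v, exists w, e v w && (A == [set v; w]%SET)]].

Definition euler_char (e : rel V) : int := #|V|%:Z - #|edges e|%:Z.

End graphs.

Section operators.
Context {R : realType} {p : nat} {F : padicField R p}.
Variable mu : {sigma_finite_measure set (Qp F) -> \bar R}.
Context {V : finType}.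
Variables (e : rel V) (U : V -> set (Qp F)) (alpha : R).

Definition set_dist (A B : set (Qp F)) : R :=
  inf [set r | exists x y, [/\ A x, B y & r = qabs (x - y)]].

Definition admissible_sets : Prop :=
  [/\ forall v, [/\ U v !=set0, compact (U v) & open (U v)],
      forall v w, v != w -> U v `&` U w = set0 &
      forall v w, v != w -> forall x y, U v x -> U w y ->
        qabs (x - y) = set_dist (U v) (U w)].

Definition OmV : set (Qp F) := [set x | exists v, U v x].

Definition OmE : set (Qp F * Qp F) :=
  [set z | exists v w, [/\ e v w, U v z.1 & U w z.2]].

Definition mu2 := [the {measure set (Qp F * Qp F) -> \bar R} of (mu \x mu)%E].

Definition locally_constant : set (Qp F -> R[i]) :=
  [set f | forall x, OmV x -> \forall y \near x, OmV y -> f y = f x].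

Definition grad (f : Qp F -> R[i]) (z : Qp F * Qp F) : R[i] :=
  (f z.1 - f z.2) / (2 * qabs (z.1 - z.2) `^ alpha)%:C.

Definition div (h : Qp F * Qp F -> R[i]) (x : Qp F) : R[i] :=
  cintegral mu [set y | OmV y /\ OmE (x, y)]
    (fun y => h (x, y) * (qabs (x - y) `^ (- alpha))%:C).

(* With loops, d^alpha and D^alpha may be unbounded: they are the closures of the
   formulas on locally constant functions. *)
Definition d_op := op_closure mu OmV mu2 OmE locally_constant grad.

Definition D_op :=
  op_closure mu OmV mu OmV locally_constant (fun f => div (grad f)).

(* Block-constant elements of L^2(Omega_E)_sigma; such a class has a
   representative for which the conditions hold everywhere on Omega_E. *)
Definition L2rho : set (Qp F * Qp F -> R[i]) :=
  [set h | [/\ L2 mu2 OmE h,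
     forall x y, OmE (x, y) -> h (x, y) = - h (y, x) &
     forall v w, e v w -> forall z z', (U v `*` U w) z -> (U v `*` U w) z' ->
       h z = h z']].

Definition Delta_op :=
  [set hk | [/\ L2rho hk.1, L2rho hk.2 &
     forall z, OmE z -> hk.2 z = grad (div hk.1) z]].

Definition ker_d : set (Qp F -> R[i]) := [set f | d_op (f, cst 0)].

Definition ker_div_rho : set (Qp F * Qp F -> R[i]) :=
  [set h | L2rho h /\ L2null mu OmV (div h)].

Definition ind : int :=
  (dim ker_d (L2null mu OmV))%:Z - (dim ker_div_rho (L2null mu2 OmE))%:Z.

(* [ind] is meaningful: both kernels are finite-dimensional *)
Definition ind_defined : Prop :=
  fin_dim ker_d (L2null mu OmV) /\ fin_dim ker_div_rho (L2null mu2 OmE).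

(* Functions on the finite set of discs are represented by functions on all
   sets, of which only the values at these discs are relevant. *)
Definition discs (l : nat) : set (set (Qp F)) :=
  [set B | (exists a, B = [set y | qabs (y - a) <= p%:R ^- l]) /\ B `<=` OmV].

Definition discs_ip (l : nat) (f g : set (Qp F) -> R[i]) : R[i] :=
  \sum_(B \in discs l) f B * (g B)^*.

Definition Dl_op (l : nat) : set ((set (Qp F) -> R[i]) * (set (Qp F) -> R[i])) :=
  [set fg | forall x, discs l x -> fg.2 x =
     \sum_(y \in [set y | [/\ discs l y, y <> x & x `*` y `<=` OmE]])
        (fg.1 x - fg.1 y) / (set_dist x y `^ (2 * alpha))%:C].

Definition heat_trace_D := heat_trace (L2 mu OmV) (L2ip mu OmV) D_op.

Definition heat_trace_Delta := heat_trace L2rho (L2ip mu2 OmE) Delta_op.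

Definition heat_trace_Dl (l : nat) := heat_trace setT (discs_ip l) (Dl_op l).

End operators.

(* Main.v *)
Require Import Defs.
From HB Require Import structures.
From mathcomp Require Import all_boot all_order all_algebra finmap.
From mathcomp Require Import all_classical all_reals all_analysis.
From mathcomp Require Import measurable_realfun ring lra.
Import Order.TTheory GRing.Theory Num.Theory.
Import numFieldNormedType.Exports.
Local Open Scope classical_set_scope.
Local Open Scope ring_scope.
Set Implicit Arguments.
Unset Strict Implicit.
Unset Printing Implicit Defensive.
Local Notation "r %:C" := (real_complex _ r) : ring_scope.
Local Notation "R [i]" := (complex R) : type_scope.
Local Notation "M ^t*" := (map_mx Num.conj (M^T)) (at level 30) : ring_scope.

(** The operators involved respect step functions. Fix a radius [p^-l] so small
   that every [U v] is a union of discs of this radius, the cells. On functions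
   constant on cells the vertex Laplacian [D^alpha] is the Laplacian of a finite
   weighted graph whose vertices are the cells, two distinct cells being joined when
   they lie over adjacent vertices of [G]. Such functions, for all [l], are dense
   and form a core of [D^alpha], which is thereby exhausted by finite-dimensional
   invariant subspaces ([D_tower]). Diagonalising level by level yields an
   eigenbasis ([tower_eigen]). The finite approximations [D^alpha_l] are graph
   Laplacians on the same cells, and the edge Laplacian [Delta^alpha_rho] acts on a
   space with one orthonormal basis vector for each edge that is not a loop.

   Since the operators are symmetric, a heat trace does not depend on the eigenbasis
   ([heat_trace_unique]), and if it is finite it converges, as [t] tends to infinity,
   to the multiplicity of the eigenvalue zero ([trace_limit]). So the theorem is about
   kernels. If no vertex is isolated, a harmonic function of a graph of cells depends
   only on the vertex of [G] and is constant along edges ([lap_null_label]). It is a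
   row vector annihilated by the transpose of the incidence matrix [B] of the graph
   without loops, and so are, up to null functions, the elements of the kernel of the
   gradient ([D_zero_modes], [Dl_modes]). Dually the kernel of the divergence on block
   constants is the left kernel of [B] ([Delta_modes]). With [r] the rank of [B] the
   dimensions are [#|V| - r] and [#|E'| - r], and [r] cancels in their difference,
   which is the Euler characteristic ([euler_char_rank]).

   In the presence of an isolated vertex the kernel of the gradient contains the step
   functions on its set and is infinite-dimensional ([fin_dim_no_isolated]), so that
   the index is defined exactly when there is no such vertex.

   When every vertex has a loop and [alpha] is at least 1/2, the heat trace of
   [D^alpha] is finite for large [t]: an eigenfunction that appears at level [k + 1]
   has mean zero on the cells of level [k], and its eigenvalue is at least [k / 4],
   because every scale between the first and the [k]-th contributes a fixed amount
   to the weight of the distant cells ([eigenvalue_lower]). There are only about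
   [p^k] such eigenfunctions ([trace_D_finite]). *)

(** * Complex numbers as pairs of real numbers *)

Section complex_facts.
Context {R : realType}.
Implicit Types z w : R[i].

Definition nsq z : R := complex.Re z ^+ 2 + complex.Im z ^+ 2.

Lemma complex_ext z w : complex.Re z = complex.Re w ->
  complex.Im z = complex.Im w -> z = w.
Proof. by case: z => a b; case: w => c d /= -> ->. Qed.

Lemma mulcJ z : z * z^* = (nsq z)%:C.
Proof.
case: z => a b; apply: complex_ext; rewrite /nsq /=; ring.
Qed.

Lemma ReD z w : complex.Re (z + w) = complex.Re z + complex.Re w.
Proof. by case: z; case: w. Qed.
Lemma ImD z w : complex.Im (z + w) = complex.Im z + complex.Im w.
Proof. by case: z; case: w. Qed.
Lemma ReN z : complex.Re (- z) = - complex.Re z. Proof. by case: z. Qed.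
Lemma ImN z : complex.Im (- z) = - complex.Im z. Proof. by case: z. Qed.
Lemma ReM z w : complex.Re (z * w) =
  complex.Re z * complex.Re w - complex.Im z * complex.Im w.
Proof. by case: z; case: w. Qed.
Lemma ImM z w : complex.Im (z * w) =
  complex.Re z * complex.Im w + complex.Im z * complex.Re w.
Proof. by case: z => a b; case: w => c d /=; rewrite addrC. Qed.
Lemma ReJ z : complex.Re (z^*) = complex.Re z. Proof. by case: z. Qed.
Lemma ImJ z : complex.Im (z^*) = - complex.Im z. Proof. by case: z. Qed.
Lemma conjc_real (r : R) : (r%:C)^* = r%:C.
Proof. by apply: complex_ext => //=; rewrite oppr0. Qed.
Lemma ReC (r : R) : complex.Re r%:C = r. Proof. by []. Qed.
Lemma ImC (r : R) : complex.Im r%:C = 0. Proof. by []. Qed.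
Lemma ReCplx (a b : R) : complex.Re (Complex a b) = a. Proof. by []. Qed.
Lemma ImCplx (a b : R) : complex.Im (Complex a b) = b. Proof. by []. Qed.
Lemma Re_sum I (s : seq I) (F : I -> R[i]) :
  complex.Re (\sum_(i <- s) F i) = \sum_(i <- s) complex.Re (F i).
Proof. by elim/big_rec2: _ => //= i x y _ <-; rewrite ReD. Qed.
Definition ReImE := (ReCplx, ImCplx, ReD, ImD, ReN, ImN, ReM, ImM, ReJ, ImJ, ReC, ImC).

Lemma conjcM z w : (z * w)^* = z^* * w^*. Proof. exact: rmorphM. Qed.
Lemma conjcB z w : (z - w)^* = z^* - w^*. Proof. exact: rmorphB. Qed.
Lemma conjcN z : (- z)^* = - z^*. Proof. exact: rmorphN. Qed.
Lemma conjc_sum I (s : seq I) P (F : I -> R[i]) :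
  (\sum_(i <- s | P i) F i)^* = \sum_(i <- s | P i) (F i)^*.
Proof. exact: rmorph_sum. Qed.

Lemma nsq_ge0 z : 0 <= nsq z.
Proof. by rewrite addr_ge0 ?sqr_ge0. Qed.
Lemma nsq_eq0 z : nsq z = 0 -> z = 0.
Proof.
move=> /eqP; rewrite /nsq paddr_eq0 ?sqr_ge0 // !sqrf_eq0 => /andP[/eqP r /eqP i].
by apply: complex_ext.
Qed.
Lemma nsqM z w : nsq (z * w) = nsq z * nsq w.
Proof. rewrite /nsq !ReImE; ring. Qed.
Lemma nsqN z : nsq (- z) = nsq z.
Proof. by rewrite /nsq; case: z => a b /=; rewrite !sqrrN. Qed.
Lemma nsqJ z : nsq (z^*) = nsq z.
Proof. by rewrite /nsq !ReImE sqrrN. Qed.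
Lemma nsqC (r : R) : nsq r%:C = r ^+ 2.
Proof. by rewrite /nsq /= [0 ^+ 2]expr0n addr0. Qed.
Lemma nsqD_le z w : nsq (z + w) <= 2 * (nsq z + nsq w).
Proof.
rewrite /nsq !ReImE -subr_ge0.
set a := complex.Re z; set b := complex.Re w; set c := complex.Im z; set d := complex.Im w.
have -> : 2 * (a ^+ 2 + c ^+ 2 + (b ^+ 2 + d ^+ 2)) - ((a + b) ^+ 2 + (c + d) ^+ 2) =
  (a - b) ^+ 2 + (c - d) ^+ 2 by ring.
by rewrite addr_ge0 ?sqr_ge0.
Qed.
Lemma nsqB_le z w : nsq (z - w) <= 2 * (nsq z + nsq w).
Proof. by rewrite -(nsqN w) nsqD_le. Qed.
End complex_facts.

Lemma le_eps_eq0 (R : realType) (x k : R) : 0 <= x -> 0 <= k ->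
  (forall eps, 0 < eps -> x <= k * eps) -> x = 0.
Proof.
move=> x0 k0 h; apply/eqP; rewrite eq_le x0 andbT leNgt; apply/negP => xp.
have := h (x / (2 * (k + 1))); rewrite divr_gt0 // ?mulr_gt0 //; last by lra.
move=> /(_ isT); apply/negP; rewrite -ltNge mulrA ltr_pdivrMr ?mulr_gt0 //; last by lra.
rewrite mulrC ltr_pM2l //; lra.
Qed.

(** * Pre-Hilbert spaces of functions and eigenbases *)

Section pre_hilbert_space.
Context {T : Type} {R : realType}.
Local Notation C := R[i].
Local Notation fn := (T -> R[i]).
Implicit Types (f g h : fn).

(** Functions stand for their classes modulo null functions, so [ip] is only
   assumed semidefinite, and its axioms are stated on [H] only. *)
Record pre_hilbert (H : set fn) (ip : fn -> fn -> C) : Prop := {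
  ph_zero : H (fun=> 0);
  ph_lin : forall a f g, H f -> H g -> H (fun x => a * f x + g x);
  ph_ipl : forall a f g h, H f -> H g -> H h ->
    ip (fun x => a * f x + g x) h = a * ip f h + ip g h;
  ph_ipC : forall f g, H f -> H g -> ip g f = (ip f g)^*;
  ph_ge0 : forall f, H f -> 0 <= ip f f }.

Lemma pre_hilbert_sub (H K : set fn) ip : pre_hilbert H ip -> K `<=` H ->
  K (fun=> 0) -> (forall a f g, K f -> K g -> K (fun x => a * f x + g x)) ->
  pre_hilbert K ip.
Proof.
move=> ph KH K0 Kl; split => //.
- by move=> a f g h /KH ? /KH ? /KH ?; exact: (ph_ipl ph).
- by move=> f g /KH ? /KH ?; exact: (ph_ipC ph).
- by move=> f /KH ?; exact: (ph_ge0 ph).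
Qed.

Definition lincomb I (s : seq I) (c : I -> C) (f : I -> fn) : fn :=
  fun x => \sum_(i <- s) c i * f i x.

Variables (H : set fn) (ip : fn -> fn -> C).
Hypothesis ph : pre_hilbert H ip.
Definition sqnorm f : R := complex.Re (ip f f).
Local Notation q := sqnorm.

Lemma ip_self f : H f -> ip f f = (q f)%:C.
Proof.
by move=> Hf; apply: complex_ext => //=; apply: ger0_Im; exact: (ph_ge0 ph).
Qed.
Lemma q_ge0 f : H f -> 0 <= q f.
Proof. by move=> Hf; have := ph_ge0 ph Hf; rewrite ip_self // ler0c. Qed.

Lemma H_scale a f : H f -> H (fun x => a * f x).
Proof.
move=> Hf; have := ph_lin ph a Hf (ph_zero ph).
by congr H; apply/funext => x; rewrite addr0.
Qed.
Lemma H_sub f g : H f -> H g -> H (fun x => f x - g x).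
Proof.
move=> Hf Hg; have := ph_lin ph (-1) Hg Hf.
by congr H; apply/funext => x; rewrite mulN1r addrC.
Qed.
Lemma ip0l h : H h -> ip (fun=> 0) h = 0.
Proof.
move=> Hh; have := ph_ipl ph (-1) (ph_zero ph) (ph_zero ph) Hh.
by rewrite (_ : (fun _ => _) = (fun=> 0)) ?mulN1r ?addNr //; apply/funext => x; rewrite mulr0 addr0.
Qed.
Lemma ip_subl f g h : H f -> H g -> H h ->
  ip (fun x => f x - g x) h = ip f h - ip g h.
Proof.
move=> Hf Hg Hh; have := ph_ipl ph (-1) Hg Hf Hh; rewrite mulN1r addrC => <-.
by congr (ip _ h); apply/funext => x; rewrite mulN1r addrC.
Qed.
Lemma ip_scalel a f h : H f -> H h -> ip (fun x => a * f x) h = a * ip f h.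
Proof.
move=> Hf Hh; have := ph_ipl ph a Hf (ph_zero ph) Hh; rewrite ip0l // addr0 => <-.
by congr (ip _ h); apply/funext => x; rewrite addr0.
Qed.
Lemma ip_scaler a f h : H f -> H h -> ip h (fun x => a * f x) = a^* * ip h f.
Proof.
move=> Hf Hh; rewrite (ph_ipC ph (H_scale a Hf) Hh) ip_scalel // conjcM.
by rewrite -(ph_ipC ph).
Qed.
Lemma ip_subr f g h : H f -> H g -> H h ->
  ip h (fun x => f x - g x) = ip h f - ip h g.
Proof.
move=> Hf Hg Hh; rewrite (ph_ipC ph (H_sub Hf Hg) Hh) ip_subl // conjcB.
by rewrite -!(ph_ipC ph).
Qed.
Lemma q_scale a f : H f -> q (fun x => a * f x) = nsq a * q f.
Proof.
move=> Hf; rewrite /sqnorm ip_scalel ?ip_scaler //; last exact: H_scale.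
by rewrite mulrA mulcJ ReM ReC ImC mul0r subr0.
Qed.

Lemma H_lincomb I (s : seq I) c (f : I -> fn) :
  (forall i, H (f i)) -> H (lincomb s c f).
Proof.
move=> Hf; elim: s => [|i s IH].
  have := ph_zero ph; congr H; apply/funext => x.
  by rewrite /lincomb big_nil.
have := ph_lin ph (c i) (Hf i) IH; congr H; apply/funext => x.
by rewrite /lincomb big_cons.
Qed.

Lemma ip_lincombl I (s : seq I) c (f : I -> fn) g :
  (forall i, H (f i)) -> H g ->
  ip (lincomb s c f) g = \sum_(i <- s) c i * ip (f i) g.
Proof.
move=> Hf Hg; elim: s => [|i s IH].
  rewrite big_nil; apply: etrans (ip0l Hg); congr (ip _ g); apply/funext => x.
  by rewrite /lincomb big_nil.
rewrite big_cons -IH -(ph_ipl ph) //; last exact: H_lincomb.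
by congr (ip _ g); apply/funext => x; rewrite /lincomb big_cons.
Qed.

Lemma ip_lincombr I (s : seq I) c (f : I -> fn) g :
  (forall i, H (f i)) -> H g ->
  ip g (lincomb s c f) = \sum_(i <- s) (c i)^* * ip g (f i).
Proof.
move=> Hf Hg; rewrite (ph_ipC ph (H_lincomb s c Hf) Hg) ip_lincombl // conjc_sum.
by apply: eq_bigr => i _; rewrite conjcM -(ph_ipC ph).
Qed.

Lemma q_sub f g : H f -> H g ->
  q (fun x => f x - g x) = q f + q g - 2 * complex.Re (ip f g).
Proof.
move=> Hf Hg; rewrite /sqnorm ip_subl ?ip_subr //; last exact: H_sub.
rewrite (ph_ipC ph Hf Hg) !ReImE; ring.
Qed.

(** Positivity of the squared norm of [f - t z g] with [z = ip f g], at the optimal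
   real [t]; [q g] may vanish for a nonzero [g], so that case is separate. *)
Lemma cauchy_schwarz f g : H f -> H g -> nsq (ip f g) <= q f * q g.
Proof.
move=> Hf Hg; set z := ip f g.
have key (t : R) : 0 <= q f + t ^+ 2 * nsq z * q g - 2 * t * nsq z.
  have := q_ge0 (H_sub Hf (H_scale (t%:C * z) Hg)).
  rewrite q_sub ?q_scale //; last exact: H_scale.
  rewrite ip_scaler // -/z nsqM nsqC conjcM conjc_real.
  have -> : complex.Re (t%:C * z^* * z) = t * nsq z.
    by rewrite -mulrA (mulrC _ z) mulcJ !ReImE mulr0 subr0.
  by rewrite -!mulrA.
have [g0|gp] := eqVneq (q g) 0.
  suff -> : nsq z = 0 by rewrite g0 mulr0.
  apply/eqP; rewrite eq_le nsq_ge0 andbT leNgt; apply/negP => zp.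
  have := key ((q f + 1) / (2 * nsq z)); rewrite g0 mulr0 addr0.
  have -> : 2 * ((q f + 1) / (2 * nsq z)) * nsq z = q f + 1.
    by field; rewrite gt_eqF.
  by lra.
have gp' : 0 < q g by rewrite lt_neqAle eq_sym gp q_ge0.
have := key (q g)^-1.
have -> : q f + (q g)^-1 ^+ 2 * nsq z * q g - 2 * (q g)^-1 * nsq z =
  (q f * q g - nsq z) / q g by field.
by rewrite pmulr_lge0 ?invr_gt0 // subr_ge0.
Qed.

Lemma q0_ipr f g : H f -> H g -> q g = 0 -> ip f g = 0.
Proof.
move=> Hf Hg g0; apply: nsq_eq0; apply/eqP; rewrite eq_le nsq_ge0 andbT.
by rewrite (le_trans (cauchy_schwarz Hf Hg)) // g0 mulr0.
Qed.
Lemma q0_ipl f g : H f -> H g -> q g = 0 -> ip g f = 0.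
Proof. by move=> Hf Hg g0; rewrite (ph_ipC ph Hf Hg) (q0_ipr Hf Hg g0) conjC0. Qed.

Lemma q_subC f g : H f -> H g -> q (fun x => f x - g x) = q (fun x => g x - f x).
Proof.
move=> Hf Hg; rewrite -[RHS]mul1r -[1](_ : nsq (-1 : C) = 1); last first.
  by rewrite nsqN nsqC expr1n.
rewrite -q_scale; last exact: H_sub.
by congr q; apply/funext => x; rewrite mulN1r opprB.
Qed.

Lemma q_add_le f g : H f -> H g -> q (fun x => f x + g x) <= 2 * (q f + q g).
Proof.
move=> Hf Hg.
have h1 : q (fun x => f x + g x) = q f + q g + 2 * complex.Re (ip f g).
  have Hg' := H_scale (-1) Hg.
  have := q_sub Hf Hg'; rewrite q_scale // nsqN nsqC expr1n mul1r ip_scaler //.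
  rewrite conjcN conjC1 mulN1r => h; rewrite (_ : (fun x => _) = (fun x => f x - -1 * g x)).
    by rewrite h; case: (ip f g) => a b /=; ring.
  by apply/funext => x; rewrite mulN1r opprK.
have := q_ge0 (H_sub Hf Hg); rewrite q_sub // h1; lra.
Qed.

Section orthonormal.
Context {I : choiceType}.
Variable f : I -> fn.
Hypothesis Hf : forall i, H (f i).
Hypothesis onf : forall i j, ip (f i) (f j) = (i == j)%:R.

Lemma ip_lincomb_on (s : seq I) c j : uniq s -> j \in s ->
  ip (lincomb s c f) (f j) = c j.
Proof.
move=> us js; rewrite ip_lincombl // (bigD1_seq j) //= onf eqxx mulr1.
by rewrite big1 ?addr0 // => i ij; rewrite onf (negPf ij) mulr0.
Qed.

Lemma q_lincomb (s : seq I) c : uniq s ->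
  q (lincomb s c f) = \sum_(i <- s) nsq (c i).
Proof.
move=> us; rewrite /sqnorm ip_lincombr //; last exact: H_lincomb.
rewrite Re_sum big_seq [RHS]big_seq; apply: eq_bigr => i is_.
by rewrite ip_lincomb_on // mulrC mulcJ.
Qed.

(** The orthogonal projection is the best approximation: the error of any
   combination exceeds that of the Fourier coefficients by their squared distance. *)
Lemma q_best (s : seq I) c h : uniq s -> H h ->
  q (fun x => h x - lincomb s c f x) =
  q h - \sum_(i <- s) nsq (ip h (f i)) + \sum_(i <- s) nsq (c i - ip h (f i)).
Proof.
move=> us Hh; rewrite q_sub ?q_lincomb ?ip_lincombr ?Re_sum //; last exact: H_lincomb.
rewrite mulr_sumr -!addrA; congr (_ + _).
rewrite -!sumrN -!big_split /=; apply: eq_bigr => i _; rewrite /nsq !ReImE; ring.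
Qed.

Lemma bessel (s : seq I) h : uniq s -> H h ->
  \sum_(i <- s) nsq (ip h (f i)) <= q h.
Proof.
move=> us Hh; have := q_ge0 (H_sub Hh (H_lincomb s (fun i => ip h (f i)) Hf)).
by rewrite q_best // [X in _ + X]big1 ?addr0 ?subr_ge0 // => i _; rewrite subrr nsqC expr0n.
Qed.

(** The approximating sequences of an eigenbasis may repeat indices, whereas
   Bessel's inequality and Parseval's identity are about sets of indices. *)
Lemma lincomb_undup (s : seq I) (c : I -> C) :
  lincomb s c f = lincomb (undup s) (fun i => c i *+ count_mem i s) f.
Proof.
apply/funext => x; rewrite /lincomb -[LHS]big_undup_iterop_count /=.
apply: eq_bigr => i _; rewrite mulrnAl Monoid.iteropE.
by elim: (count_mem i s) => //= n ->; rewrite mulrS.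
Qed.
End orthonormal.

Definition sym_graph (A : set (fn * fn)) := forall f g f' g',
  A (f, g) -> A (f', g') -> ip g f' = ip f g'.

Section eigen.
Variable A : set (fn * fn).
Hypothesis Asym : sym_graph A.
Local Notation eb := (eigenbasis H ip A).

Lemma eb_best (I : choiceType) (lam : I -> R) (f : I -> fn) h (eps : R) : eb lam f -> H h -> 0 < eps ->
  exists2 s : seq I, uniq s & q h - \sum_(i <- s) nsq (ip h (f i)) < eps.
Proof.
case=> Hf _ on dense Hh e0; have [s [c /= hs]] := dense h Hh eps e0.
exists (undup s); first exact: undup_uniq.
rewrite -/(q (fun x => h x - lincomb s c f x)) in hs.
rewrite lincomb_undup q_best ?undup_uniq // in hs.
by apply: le_lt_trans hs; rewrite lerDl sumr_ge0 // => i _; exact: nsq_ge0.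
Qed.

Lemma parseval (I : choiceType) (lam : I -> R) (f : I -> fn) h : eb lam f -> H h ->
  (\esum_(i in [set: I]) (nsq (ip h (f i)))%:E = (q h)%:E)%E.
Proof.
move=> e Hh; have [Hf _ on _] := e; apply/eqP; rewrite eq_le; apply/andP; split.
  apply: ge_ereal_sup => _ [X [finX _] <-].
  rewrite fsbig_finite //= sumEFin lee_fin; apply: bessel => //.
apply/lee_addgt0Pr => eps e0; have [s us hs] := eb_best e Hh e0.
rewrite -leeBlDr //; apply: esum_ge; exists [set` s]; first by split.
rewrite -(fsbig_seq _ (fun i => (nsq (ip h (f i)))%:E)) // sumEFin -EFinB lee_fin.
by rewrite lerBlDl -lerBlDr ltW.
Qed.

(** Symmetry gives [lam i = nu j] as soon as [f i] and [g j] are not orthogonal,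
   whence [phi (lam i) = \sum_j phi (nu j) |ip (f i) (g j)|^2] by Parseval in [g].
   Summing over finitely many [i] and using Bessel in [f] leaves at most
   [\sum_j phi (nu j)]. *)
Lemma esum_spectrum_le (I J : choiceType) (lam : I -> R) (f : I -> fn) (nu : J -> R) (g : J -> fn) (phi : R -> R) :
  eb lam f -> eb nu g -> (forall r, 0 <= phi r) ->
  (\esum_(i in [set: I]) (phi (lam i))%:E <=
   \esum_(j in [set: J]) (phi (nu j))%:E)%E.
Proof.
move=> ef eg phi0; have [Hf Af onf _] := ef; have [Hg Ag ong _] := eg.
apply: ge_ereal_sup => _ [X [finX _] <-].
have tr i j : phi (lam i) * nsq (ip (f i) (g j)) = phi (nu j) * nsq (ip (f i) (g j)).
  have := Asym (Af i) (Ag j); rewrite ip_scalel ?ip_scaler // conjc_real.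
  move/eqP; rewrite -subr_eq0 -mulrBl mulf_eq0 => /orP[|/eqP ->].
    rewrite subr_eq0 => /eqP h; suff -> : lam i = nu j by [].
    by move: h => [].
  by rewrite nsqC expr0n !mulr0.
rewrite fsbig_finite //=.
have -> : (\sum_(i <- fset_set X) (phi (lam i))%:E =
  \sum_(i <- fset_set X) \esum_(j in [set: J]) (phi (nu j) * nsq (ip (f i) (g j)))%:E)%E.
  apply: eq_bigr => i _; rewrite -[phi (lam i)]mulr1.
  have -> : (1 = q (f i))%R by rewrite /sqnorm onf eqxx.
  have e : phi (lam i) = nsq (Num.sqrt (phi (lam i)))%:C by rewrite nsqC sqr_sqrtr.
  rewrite [X in X * q _]e -q_scale // -(parseval eg); last exact: H_scale.
  by apply: eq_esum => j _; rewrite ip_scalel // nsqM -e tr.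
rewrite -esum_sum; last by move=> *; rewrite lee_fin mulr_ge0 ?nsq_ge0.
apply: le_esum => j _; rewrite sumEFin lee_fin -mulr_sumr ler_piMr //.
apply: (le_trans (y := \sum_(i <- fset_set X) nsq (ip (g j) (f i)))).
  by apply: ler_sum => i _; rewrite (ph_ipC ph (Hg j) (Hf i)) nsqJ.
have := bessel Hf onf (s := fset_set X) (fset_uniq _) (Hg j).
by rewrite /sqnorm ong eqxx.
Qed.

(** The definition of a heat trace leaves the eigenbasis open. By symmetry of the
   operator the choice is immaterial, so that it may be computed in a basis of
   one's own making. *)
Lemma heat_trace_unique tr (I : choiceType) (lam : I -> R) (f : I -> fn) t : eb lam f ->
  heat_trace H ip A tr ->
  (tr t = \esum_(i in [set: I]) (expR (- lam i * t))%:E)%E.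
Proof.
move=> ef [J [nu [g [eg ->]]]]; apply/eqP.
pose phi (r : R) := expR (- r * t).
have phi0 r : 0 <= phi r by exact: expR_ge0.
by rewrite eq_le (esum_spectrum_le eg ef phi0) (esum_spectrum_le ef eg phi0).
Qed.
End eigen.
End pre_hilbert_space.

(** * Hermitian matrices and dimensions *)

Section matrix_facts.
Context {C : numClosedFieldType}.

Lemma adj_mul m n p (A : 'M[C]_(m, n)) (B : 'M[C]_(n, p)) :
  (A *m B)^t* = B^t* *m A^t*.
Proof. by rewrite trmx_mul map_mxM. Qed.

(** The rows of [Q] span an invariant subspace of the hermitian matrix [M], so
   their orthogonal complement is invariant as well. In an orthonormal basis [F]
   of the complement, [M] becomes the hermitian matrix [F M F^*], to which the
   spectral theorem applies. *)
Lemma spectral_complement m n (M : 'M[C]_n) (M' : 'M[C]_m) (Q : 'M[C]_(m, n)) :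
  M^t* = M -> Q *m Q^t* = 1%:M -> Q *m M = M' *m Q ->
  exists k (E : 'M[C]_(k, n)) (d : 'rV[C]_k),
    [/\ E *m E^t* = 1%:M, E *m Q^t* = 0, E *m M = diag_mx d *m E,
        E^t* *m E + Q^t* *m Q = 1%:M & forall i, d 0 i \is Num.real].
Proof.
move=> hM QQ QM.
pose O : 'M[C]_n := (orthomx Num.conj 1%:M Q).
have OP p (A : 'M[C]_(p, n)) : (A <= O)%MS <-> A *m Q^t* = 0.
  by split => /orthomx1P.
pose k := \rank O; pose F : 'M[C]_(k, n) := schmidt (row_base O).
have FF : F *m F^t* = 1%:M.
  by apply/unitarymxP/schmidt_unitarymx; rewrite rank_leq_col.
have Feq : (F :=: O)%MS.
  exact: eqmx_trans (eqmx_schmidt_free (row_base_free O)) (eq_row_base O).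
have FQ : F *m Q^t* = 0 by apply/OP; rewrite Feq.
have compl : F^t* *m F + Q^t* *m Q = 1%:M.
  have /submxP[w hw] : (1%:M - Q^t* *m Q <= F)%MS.
    by rewrite Feq; apply/OP; rewrite mulmxBl mul1mx -mulmxA QQ mulmx1 subrr.
  have : (1%:M - Q^t* *m Q) *m F^t* = w by rewrite hw -mulmxA FF mulmx1.
  rewrite mulmxBl mul1mx -mulmxA.
  have -> : Q *m F^t* = 0 by rewrite -[Q]trmxCK -adj_mul FQ trmx0 map_mx0.
  by rewrite mulmx0 subr0 => ->; rewrite -hw subrK.
pose MF := F *m M *m F^t*.
have hMF : MF^t* = MF by rewrite /MF !adj_mul trmxCK hM mulmxA.
have MFh : MF \is hermsymmx by apply/is_hermitianmxP; rewrite expr0 scale1r hMF.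
have FM : F *m M = MF *m F.
  rewrite -[LHS]mulmx1 -compl mulmxDr !mulmxA -[X in _ + X *m Q](_ : 0 = _).
    by rewrite mul0mx addr0.
  rewrite -mulmxA -[M in M *m Q^t*]hM -adj_mul QM adj_mul mulmxA FQ mul0mx //.
set P := spectralmx MF; have PU : P \is unitarymx by exact: spectral_unitarymx.
have PP : P *m P^t* = 1%:M by exact/unitarymxP.
have PP' : P^t* *m P = 1%:M by rewrite -invmx_unitary // mulVmx // unitarymx_unit.
have MFE := orthomx_spectralP (hermitian_normalmx MFh).
exists k, (P *m F), (spectral_diag MF); split.
- by rewrite adj_mul mulmxA -(mulmxA P) FF mulmx1.
- by rewrite -mulmxA FQ mulmx0.
- by rewrite -mulmxA FM {1}MFE !mulmxA mulmxV ?mul1mx // unitarymx_unit.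
- by rewrite adj_mul mulmxA -(mulmxA (F^t*)) PP' mulmx1.
- by move=> i; exact: (mxOverP (hermitian_spectral_diag_real MFh)).
Qed.
End matrix_facts.

Section has_dim_facts.
Context {T : Type} {R : realType}.
Local Notation fn := (T -> R[i]).
Variables (S N : set fn).
Hypothesis N0 : N (fun=> 0).
Hypothesis Nlin : forall a f g, N f -> N g -> N (fun x => a * f x + g x).

Lemma N_lincomb I (s : seq I) c (f : I -> fn) :
  (forall i, N (f i)) -> N (lincomb s c f).
Proof.
move=> Hf; elim: s => [|i s IH].
  by move: N0; congr N; apply/funext => x; rewrite /lincomb big_nil.
have := Nlin (c i) (Hf i) IH; congr N; apply/funext => x.
by rewrite /lincomb big_cons.
Qed.

Lemma coords n m (b : 'I_n -> fn) (f : 'I_m -> fn) :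
  (forall f, S f -> exists! c : 'I_n -> R[i],
     N (fun x => f x - \sum_(i < n) c i * b i x)) -> (forall j, S (f j)) ->
  exists a : 'I_m -> 'I_n -> R[i],
    forall j, N (fun x => f j x - \sum_(i < n) a j i * b i x).
Proof.
move=> hb Sf; have h j : exists c : 'I_n -> R[i],
    N (fun x => f j x - \sum_(i < n) c i * b i x).
  by have [c [hc _]] := hb _ (Sf j); exists c.
by have [a ha] := choice h; exists a.
Qed.

(** Two bases expand in each other; uniqueness of coordinates makes one product of
   the two transition matrices the identity. *)
Lemma has_dim_le n m : has_dim S N n -> has_dim S N m -> (m <= n)%N.
Proof.
move=> [b Sb hb] [b' Sb' hb'].
have [a ha] := coords hb Sb'; have [a' ha'] := coords hb' Sb.
pose X := \matrix_(j, i) a j i; pose X' := \matrix_(j, i) a' j i.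
suff : X *m X' = 1%:M by move/mulmx1_min.
apply/matrixP => j k.
have [c0 [_ uniq]] := hb' _ (Sb' j).
have h1 : N (fun x => b' j x - \sum_(i < m) (j == i)%:R * b' i x).
  move: N0; congr N; apply/funext => x; rewrite (bigD1 j) //= eqxx mul1r big1 ?addr0 ?subrr //.
  by move=> i; rewrite eq_sym => /negPf ->; rewrite mul0r.
have h2 : N (fun x => b' j x - \sum_(i < m) (X *m X') j i * b' i x).
  have := Nlin 1 (ha j) (N_lincomb (index_enum 'I_n) (a j) ha').
  congr N; apply/funext => x; rewrite /lincomb mul1r -addrA; congr (_ + _).
  under [X in _ + X]eq_bigr do rewrite mulrBr.
  rewrite sumrB addKr; congr (- _).
  under [RHS]eq_bigr do rewrite mxE mulr_suml.
  rewrite exchange_big /=; apply: eq_bigr => i _; rewrite mulr_sumr.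
  by apply: eq_bigr => l _; rewrite !mxE mulrA.
have := uniq _ h1; rewrite (uniq _ h2) => /(congr1 (fun f => f k)) ->.
by rewrite mxE.
Qed.

Lemma dimE n : has_dim S N n -> Defs.dim S N = n.
Proof.
move=> h; rewrite /Defs.dim; apply: xget_unique => // m hm.
by apply/eqP; rewrite eqn_leq !has_dim_le.
Qed.
End has_dim_facts.

Section lc_facts.
Context {T : Type} {R : realType}.
Local Notation C := (R[i]).
Local Notation fn := (T -> C).

(** Coefficients form a row vector, so that an operator acts on them by right
   multiplication with its matrix. *)
Definition lc n (c : 'rV[C]_n) (b : 'I_n -> fn) : fn :=
  lincomb (index_enum 'I_n) (fun i => c 0 i) b.

Lemma lcE n (c : 'rV[C]_n) b x : lc c b x = \sum_(i < n) c 0 i * b i x.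
Proof. by []. Qed.
Lemma lc0 n (b : 'I_n -> fn) : lc 0 b = fun=> 0.
Proof. by apply/funext => x; rewrite lcE big1 // => i _; rewrite mxE mul0r. Qed.
Lemma lcB n (c d : 'rV[C]_n) b x : lc (c - d) b x = lc c b x - lc d b x.
Proof. by rewrite !lcE -sumrB; apply: eq_bigr => i _; rewrite !mxE mulrBl. Qed.
Lemma lcD n (c d : 'rV[C]_n) b x : lc (c + d) b x = lc c b x + lc d b x.
Proof. by rewrite !lcE -big_split; apply: eq_bigr => i _; rewrite !mxE mulrDl. Qed.
Lemma lcZ n a (c : 'rV[C]_n) b x : lc (a *: c) b x = a * lc c b x.
Proof. by rewrite !lcE mulr_sumr; apply: eq_bigr => i _; rewrite !mxE mulrA. Qed.
Lemma lc_mul m n (c : 'rV[C]_m) (Q : 'M[C]_(m, n)) b :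
  lc (c *m Q) b = lc c (fun i => lc (row i Q) b).
Proof.
apply/funext => x; rewrite !lcE.
under eq_bigr do rewrite mxE mulr_suml.
rewrite exchange_big /=; apply: eq_bigr => i _; rewrite lcE mulr_sumr.
by apply: eq_bigr => j _; rewrite !mxE mulrA.
Qed.
Lemma lc_delta n (b : 'I_n -> fn) i : lc (delta_mx 0 i) b = b i.
Proof.
apply/funext => x; rewrite lcE (bigD1 i) //= mxE !eqxx mul1r big1 ?addr0 //.
by move=> j ji; rewrite mxE eqxx (negPf ji) mul0r.
Qed.
End lc_facts.

Section pre_hilbert_lc.
Context {T : Type} {R : realType}.
Local Notation C := (R[i]).
Local Notation fn := (T -> C).
Variables (H : set fn) (ip : fn -> fn -> C).
Hypothesis ph : pre_hilbert H ip.
Local Notation q := (sqnorm ip).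

Lemma q0_lin a f g : H f -> H g -> q f = 0 -> q g = 0 ->
  q (fun x => a * f x + g x) = 0.
Proof.
move=> Hf Hg f0 g0; apply/eqP; rewrite eq_le (q_ge0 ph) ?andbT; last exact: (ph_lin ph).
have := q_add_le ph (H_scale ph a Hf) Hg.
by rewrite (q_scale ph) // f0 g0 mulr0 addr0 mulr0.
Qed.
Lemma q_zero : q (fun=> 0) = 0.
Proof. by rewrite /sqnorm (ip0l ph) //; exact: (ph_zero ph). Qed.
Lemma q0_lincomb I (s : seq I) c (f : I -> fn) :
  (forall i, H (f i)) -> (forall i, q (f i) = 0) -> q (lincomb s c f) = 0.
Proof.
move=> Hf f0.
have [] // : H (lincomb s c f) /\ q (lincomb s c f) = 0.
elim: s => [|i s [IH1 IH2]].
  rewrite (_ : lincomb _ _ _ = fun=> 0); first by split; [exact: (ph_zero ph)|exact: q_zero].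
  by apply/funext => x; rewrite /lincomb big_nil.
rewrite (_ : lincomb _ _ _ = fun x => c i * f i x + lincomb s c f x).
  by split; [exact: (ph_lin ph) | exact: q0_lin].
by apply/funext => x; rewrite /lincomb big_cons.
Qed.
Lemma q0_trans f g h : H f -> H g -> H h -> q (fun x => f x - g x) = 0 ->
  q (fun x => g x - h x) = 0 -> q (fun x => f x - h x) = 0.
Proof.
move=> Hf Hg Hh h1 h2; have := q0_lin 1 (H_sub ph Hf Hg) (H_sub ph Hg Hh) h1 h2.
by congr (q _ = 0); apply/funext => x; rewrite mul1r subrKA.
Qed.

Lemma H_lc n (c : 'rV[C]_n) b : (forall i, H (b i)) -> H (lc c b).
Proof. exact: (H_lincomb ph). Qed.

Section on.
Context (n : nat) (b : 'I_n -> fn).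
Hypothesis Hb : forall i, H (b i).
Hypothesis onb : forall i j, ip (b i) (b j) = (i == j)%:R.

Lemma ip_lc (c d : 'rV[C]_n) : ip (lc c b) (lc d b) = (c *m d^t*) 0 0.
Proof.
rewrite /lc (ip_lincombl ph) //; last exact: (H_lincomb ph).
rewrite mxE; apply: eq_bigr => i _; rewrite (ip_lincombr ph) // (bigD1 i) //= onb.
rewrite eqxx mulr1 big1 ?addr0; first by rewrite !mxE.
by move=> j ji; rewrite onb eq_sym (negPf ji) mulr0.
Qed.
Lemma lc_inj (c d : 'rV[C]_n) : lc c b = lc d b -> c = d.
Proof.
move=> cd; apply/rowP => i.
have h (c' : 'rV[C]_n) : ip (lc c' b) (b i) = c' 0 i.
  rewrite -(lc_delta b i) ip_lc mxE (bigD1 i) //= !mxE !eqxx conjC1 mulr1 big1 ?addr0 //.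
  by move=> j ji; rewrite !mxE eqxx (negPf ji) conjC0 mulr0.
by rewrite -h cd h.
Qed.
End on.

(** Orthonormal vectors are independent modulo null functions. *)
Lemma orthonormal_le_dim (S N : set fn) n m (f : 'I_m -> fn) :
  S `<=` H -> (forall g, N g -> H g -> q g = 0) -> has_dim S N n ->
  (forall i, S (f i)) -> (forall i j, ip (f i) (f j) = (i == j)%:R) -> (m <= n)%N.
Proof.
move=> SH Nq [b Sb hb] Sf onf.
have [a ha] := coords hb Sf.
pose X := \matrix_(j, i) a j i.
have Hb i : H (b i) by exact: SH.
have Hf i : H (f i) by exact: SH.
have fX j : q (fun x => f j x - lc (row j X) b x) = 0.
  apply: Nq; last exact: (H_sub ph (Hf j) (H_lc _ Hb)).
  have := ha j; congr N; apply/funext => x; congr (_ - _); rewrite lcE.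
  by apply: eq_bigr => i _; rewrite !mxE.
suff Xf : row_free X by rewrite -(eqP Xf) rank_leq_col.
rewrite -kermx_eq0; apply/eqP/row_matrixP => i; rewrite row0.
set v := row i _; have vX : v *m X = 0 by apply/sub_kermxP; exact: row_sub.
have q0 : q (lc v f) = 0.
  have := q0_lincomb (index_enum 'I_m) (fun i => v 0 i)
    (fun j => H_sub ph (Hf j) (H_lc (row j X) Hb)) fX.
  congr (q _ = 0); apply/funext => x; rewrite /lincomb.
  under eq_bigr do rewrite mulrBr.
  by rewrite sumrB -[Y in _ - Y](lcE v (fun i => lc (row i X) b)) -lc_mul vX lc0 subr0.
have : \sum_i nsq (v 0 i) = 0.
  by rewrite -[RHS]q0 /lc (q_lincomb ph Hf onf) //; exact: index_enum_uniq.
move/eqP; rewrite psumr_eq0; last by move=> j _; exact: nsq_ge0.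
move=> /allP h; apply/rowP => j; rewrite [RHS]mxE.
by have := h j (mem_index_enum _) => /eqP/nsq_eq0.
Qed.
End pre_hilbert_lc.

Lemma lincomb_add T (R : realType) (I : choiceType) (e : I -> T -> R[i]) s d s' d' :
  exists s2 d2, (fun x => lincomb s d e x + lincomb s' d' e x) = lincomb s2 d2 e.
Proof.
have wide (s1 s2 : seq I) c : uniq s1 -> uniq s2 -> {subset s1 <= s2} ->
    lincomb s1 c e = lincomb s2 (fun i => if i \in s1 then c i else 0) e.
  move=> u1 u2 sub; apply/funext => x; rewrite /lincomb.
  rewrite [RHS](eq_bigr (fun i => if i \in s1 then c i * e i x else 0)); last first.
    by move=> i _; case: ifP => //; rewrite mul0r.
  rewrite -big_mkcond -[RHS]big_filter; apply: perm_big; apply: uniq_perm => //.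
    by rewrite filter_uniq.
  by move=> i; rewrite mem_filter; case: (boolP (i \in s1)) => //= /sub ->.
rewrite (lincomb_undup _ s) (lincomb_undup _ s').
move: (fun i => d i *+ count_mem i s) (fun i => d' i *+ count_mem i s') => c c'.
exists (undup (s ++ s')); rewrite (wide (undup s) (undup (s ++ s'))) ?undup_uniq //; last first.
  by move=> i; rewrite !mem_undup mem_cat => ->.
rewrite (wide (undup s') (undup (s ++ s'))) ?undup_uniq //; last first.
  by move=> i; rewrite !mem_undup mem_cat => ->; rewrite orbT.
eexists (fun i => _ + _); apply/funext => x; rewrite /lincomb -big_split /=.
by apply: eq_bigr => i _; rewrite mulrDl.
Qed.

(** * Operators exhausted by invariant subspaces *)

Section tower.
Context {T : Type} {R : realType}.
Local Notation C := (R[i]).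
Local Notation fn := (T -> C).
Variables (H : set fn) (ip : fn -> fn -> C) (A : set (fn * fn)).
Hypothesis ph : pre_hilbert H ip.
Local Notation q := (sqnorm ip).

(** An operator exhausted by finite-dimensional invariant subspaces: [b l] is an
   orthonormal basis of the [l]-th one, [Q l] expresses it in the basis of the
   next one, and [M l] is the matrix of the operator. The last field says that the
   union of the subspaces is a core of [A], as for a closure of the operator
   defined there. *)
Record tower (n : nat -> nat) (b : forall l, 'I_(n l) -> fn)
    (Q : forall l, 'M[C]_(n l, n l.+1)) (M : forall l, 'M[C]_(n l)) : Prop := {
  tw_H : forall l i, H (b l i);
  tw_on : forall l i j, ip (b l i) (b l j) = (i == j)%:R;
  tw_Q : forall l i, b l i = lc (row i (Q l)) (b l.+1);
  tw_herm : forall l, (M l)^t* = M l;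
  tw_psd : forall l (c : 'rV_(n l)), 0 <= (c *m M l *m c^t*) 0 0;
  tw_QM : forall l, Q l *m M l.+1 = M l *m Q l;
  tw_dense : forall g, H g -> forall eps : R, 0 < eps ->
    exists l (c : 'rV_(n l)), q (fun x => g x - lc c (b l) x) < eps;
  tw_A : forall l (c : 'rV_(n l)), A (lc c (b l), lc (c *m M l) (b l));
  tw_approx : forall f g, A (f, g) -> [/\ H f, H g &
    forall eps : R, 0 < eps -> exists l (c : 'rV_(n l)),
      q (fun x => f x - lc c (b l) x) < eps /\
      q (fun x => g x - lc (c *m M l) (b l) x) < eps] }.

Variables (n : nat -> nat) (b : forall l, 'I_(n l) -> fn)
    (Q : forall l, 'M[C]_(n l, n l.+1)) (M : forall l, 'M[C]_(n l)).
Arguments b : clear implicits.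
Hypothesis tw : tower b Q M.

Let Hlc l (c : 'rV_(n l)) : H (lc c (b l)).
Proof. by apply: (H_lc ph); exact: (tw_H tw). Qed.

Lemma tower_step l (c : 'rV_(n l)) :
  lc c (b l) = lc (c *m Q l) (b l.+1) /\
  lc (c *m M l) (b l) = lc (c *m Q l *m M l.+1) (b l.+1).
Proof.
have h (d : 'rV_(n l)) : lc d (b l) = lc (d *m Q l) (b l.+1).
  by rewrite lc_mul; congr (lc _ _); apply/funext => i; exact: (tw_Q tw).
by split; [exact: h|rewrite h -!mulmxA (tw_QM tw)].
Qed.

Lemma tower_lift l k (c : 'rV_(n l)) : (l <= k)%N -> exists d : 'rV_(n k),
  lc c (b l) = lc d (b k) /\ lc (c *m M l) (b l) = lc (d *m M k) (b k).
Proof.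
elim: k => [|k IH]; first by rewrite leqn0 => /eqP l0; subst l; exists c.
rewrite leq_eqVlt => /orP[/eqP lk|]; first by subst l; exists c.
rewrite ltnS => /IH[d [-> ->]]; have [h1 h2] := tower_step d.
by exists (d *m Q k); rewrite h1 h2.
Qed.

Lemma tower_QQ l : Q l *m (Q l)^t* = 1%:M.
Proof.
apply/matrixP => i j.
have := ip_lc ph (tw_H tw (l := l.+1)) (tw_on tw (l := l.+1)) (row i (Q l)) (row j (Q l)).
rewrite -!(tw_Q tw) (tw_on tw) => e; rewrite [RHS]mxE e !mxE.
by apply: eq_bigr => k _; rewrite !mxE.
Qed.

Lemma tower_core_sym l (c : 'rV_(n l)) k (d : 'rV_(n k)) :
  ip (lc (c *m M l) (b l)) (lc d (b k)) = ip (lc c (b l)) (lc (d *m M k) (b k)).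
Proof.
have [c' [-> ->]] := tower_lift c (leq_maxl l k).
have [d' [-> ->]] := tower_lift d (leq_maxr l k).
rewrite !(ip_lc ph (tw_H tw (l := _)) (tw_on tw (l := _))).
by rewrite adj_mul (tw_herm tw) mulmxA.
Qed.

(** Symmetry on the core passes to the closure one argument at a time, by the
   Cauchy-Schwarz inequality. *)
Lemma tower_sym : sym_graph ip A.
Proof.
pose core (fg : fn * fn) := exists l (c : 'rV_(n l)),
  fg = (lc c (b l), lc (c *m M l) (b l)).
(* approximating the first pair in the graph norm preserves both inner products *)
have clos f g f' g' : A (f, g) -> H f' -> H g' ->
    (forall u v, core (u, v) -> ip v f' = ip u g') -> ip g f' = ip f g'.
  move=> /(tw_approx tw)[Hf Hg appr] Hf' Hg' hc.
  apply/eqP; rewrite -subr_eq0; apply/eqP/nsq_eq0.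
  apply: (@le_eps_eq0 _ _ (2 * (q f' + q g'))); first exact: nsq_ge0.
    by rewrite mulr_ge0 ?addr_ge0 ?(q_ge0 ph).
  move=> eps e0; have [l [c [h1 h2]]] := appr _ e0.
  have -> : ip g f' - ip f g' = ip (fun x => g x - lc (c *m M l) (b l) x) f' -
      ip (fun x => f x - lc c (b l) x) g'.
    have e := hc _ _ (ex_intro _ l (ex_intro _ c erefl)).
    by rewrite !(ip_subl ph) // e; ring.
  apply: (le_trans (nsqB_le _ _)); rewrite -mulrA ler_pM2l // mulrDl lerD //.
    apply: le_trans (cauchy_schwarz ph (H_sub ph Hg (Hlc (c *m M l))) Hf') _.
    by rewrite mulrC ler_wpM2l ?(q_ge0 ph) // ltW.
  apply: le_trans (cauchy_schwarz ph (H_sub ph Hf (Hlc c)) Hg') _.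
  by rewrite mulrC ler_wpM2l ?(q_ge0 ph) // ltW.
move=> f g f' g' Af Af'; have [Hf' Hg' _] := tw_approx tw Af'.
have [Hf Hg _] := tw_approx tw Af.
apply: (clos _ _ _ _ Af) => // u v [l [c [-> ->]]].
rewrite (ph_ipC ph Hf' (Hlc _)) (ph_ipC ph Hg' (Hlc _)); congr (_ ^*).
apply/esym; apply: (clos _ _ _ _ Af' (Hlc _) (Hlc _)) => u' v' [k [d [-> ->]]].
exact: tower_core_sym.
Qed.

(** Each subspace splits as the previous one plus its orthogonal complement, and
   both are invariant. Diagonalising each complement separately gives orthonormal
   eigenvectors which together span all the subspaces. Their position, orthogonal
   to the previous level, is what later forces the eigenvalues to grow. *)
Lemma tower_eigen : exists (k : nat -> nat) (E : forall l, 'M[C]_(k l, n l))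
    (lam : forall l, 'I_(k l) -> R),
  [/\ forall l i, 0 <= lam l i,
      forall l, E l *m (E l)^t* = 1%:M,
      forall l i, row i (E l) *m M l = (lam l i)%:C *: row i (E l),
      forall l, E l.+1 *m (Q l)^t* = 0 &
      eigenbasis H ip A
        (fun x : {l & 'I_(k l)} => lam (tag x) (tagged x))
        (fun x : {l & 'I_(k l)} => lc (row (tagged x) (E (tag x))) (b (tag x)))].
Proof.
pose sol l := {k & ('M[C]_(k, n l) * 'rV[C]_k)%type}.
pose m l := if l is l'.+1 then n l' else 0%N.
(* the previous level, which is empty before the first one *)
pose P l : 'M[C]_(m l, n l) := if l is l'.+1 then Q l' else 0.
pose good l (s : sol l) := let: existT k (E, d) := s in
  [/\ E *m E^t* = 1%:M, E *m (P l)^t* = 0, E *m M l = diag_mx d *m E,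
     E^t* *m E + (P l)^t* *m P l = 1%:M & forall i, d 0 i \is Num.real].
have ex l : exists s : sol l, good l s.
  suff [k [E [d h]]] : exists k (E : 'M[C]_(k, n l)) (d : 'rV[C]_k),
    [/\ E *m E^t* = 1%:M, E *m (P l)^t* = 0, E *m M l = diag_mx d *m E,
      E^t* *m E + (P l)^t* *m P l = 1%:M & forall i, d 0 i \is Num.real].
    by exists (existT _ k (E, d)).
  case: l => [|l]; last first.
    apply: (spectral_complement (M' := M l)); [exact: (tw_herm tw)|exact: tower_QQ|].
    exact: (tw_QM tw).
  apply: (spectral_complement (M' := 0)); first exact: (tw_herm tw).
    by apply/matrixP => - [].
  by apply/matrixP => - [].
pose X l := projT1 (cid (ex l)).
have Xg l : good l (X l) := projT2 (cid (ex l)).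
pose k l := tag (X l).
pose E l : 'M[C]_(k l, n l) := (tagged (X l)).1.
pose d l : 'rV[C]_(k l) := (tagged (X l)).2.
have {}Xg l : [/\ E l *m (E l)^t* = 1%:M, E l *m (P l)^t* = 0,
    E l *m M l = diag_mx (d l) *m E l,
    (E l)^t* *m E l + (P l)^t* *m P l = 1%:M & forall i, d l 0 i \is Num.real].
  by have := Xg l; rewrite /good /E /d /k; case: (X l) => k' [].
pose lam l i : R := complex.Re (d l 0 i).
have lamE l i : d l 0 i = (lam l i)%:C.
  have [_ _ _ _ dr] := Xg l; have /complex_realP[r hr] := dr i.
  by rewrite /lam hr.
have EM l i : row i (E l) *m M l = (lam l i)%:C *: row i (E l).
  have [_ _ h _ _] := Xg l; rewrite -row_mul h -lamE.
  by apply/rowP => j; rewrite mul_diag_mx !mxE.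
have EE l i j : (row i (E l) *m (row j (E l))^t*) 0 0 = (i == j)%:R.
  have [h _ _ _ _] := Xg l; have /matrixP/(_ i j) := h.
  rewrite [RHS]mxE => <-; rewrite !mxE.
  by apply: eq_bigr => r _; rewrite !mxE.
have EQ l : E l.+1 *m (Q l)^t* = 0 by have [_ h _ _ _] := Xg l.+1.
exists k, E, lam; split => //.
- move=> l i; have := tw_psd tw (row i (E l)).
  by rewrite EM -scalemxAl mxE EE eqxx mulr1 ler0c.
- by move=> l; have [] := Xg l.
pose J := {l & 'I_(k l)}.
pose e (x : J) := lc (row (tagged x) (E (tag x))) (b (tag x)).
have He x : H (e x) by exact: Hlc.
(* vectors of a level are combinations at any later one, to which the new
   eigenvectors of still later levels are orthogonal *)
have on_ne l i l' j : (l < l')%N ->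
    ip (lc (row j (E l')) (b l')) (lc (row i (E l)) (b l)) = 0.
  case: l' j => // l' j; rewrite ltnS => /(tower_lift (row i (E l)))[c [-> _]].
  have [-> _] := tower_step c.
  rewrite (ip_lc ph (tw_H tw (l := _)) (tw_on tw (l := _))) adj_mul mulmxA.
  by rewrite -row_mul EQ row0 mul0mx mxE.
split => //.
- move=> [l i] /=; have := tw_A tw (row i (E l)); rewrite EM.
  by congr A; congr pair; apply/funext => x; rewrite lcZ.
- move=> [l i] [l' j] /=; case: (ltngtP l l') => ll'.
  + rewrite (ph_ipC ph) // on_ne // conjC0; case: eqP => // h.
    by have /= hl := congr1 tag h; move: ll'; rewrite hl ltnn.
  + rewrite on_ne //; case: eqP => // h.
    by have /= hl := congr1 tag h; move: ll'; rewrite hl ltnn.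
  + subst l'; rewrite (ip_lc ph (tw_H tw (l := _)) (tw_on tw (l := _))) EE.
    by congr (_%:R); congr nat_of_bool; rewrite -tag_eqE /tag_eq /= eqxx tagged_asE.
have span l (c : 'rV_(n l)) : exists s dd, lc c (b l) = lincomb s dd e.
  elim: l c => [|l IH] c.
    have [_ _ _ h _] := Xg 0%N; rewrite -[c]mulmx1 -h.
    rewrite (_ : (P 0%N)^t* *m P 0%N = 0) ?addr0; last first.
      by apply/matrixP => i j; rewrite !mxE big_ord0.
    rewrite mulmxA lc_mul; set v := c *m _.
    exists [seq Tagged (fun l => 'I_(k l)) i | i <- index_enum 'I_(k 0%N)].
    exists (fun x => if tag x =P 0%N is ReflectT h
      then v 0 (ecast l ('I_(k l)) h (tagged x)) else 0).
    apply/funext => x; rewrite /lincomb big_map; apply: eq_bigr => i _ /=.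
    by case: eqP => // h'; rewrite (eq_irrelevance h' erefl).
  have [_ _ _ h _] := Xg l.+1; rewrite -[c]mulmx1 -h mulmxDr !mulmxA.
  rewrite (_ : lc _ _ = fun x => lc (c *m (E l.+1)^t* *m E l.+1) (b l.+1) x +
    lc (c *m (Q l)^t* *m Q l) (b l.+1) x); last by apply/funext => x; rewrite lcD.
  have [<- _] := tower_step (c *m (Q l)^t*).
  have [s [dd ->]] := IH (c *m (Q l)^t*).
  rewrite (lc_mul _ (E l.+1)); set v := c *m _.
  have [s' [d' ->]] : exists s' d', lc v (fun i => lc (row i (E l.+1)) (b l.+1)) =
      lincomb s' d' e.
    exists [seq Tagged (fun l => 'I_(k l)) i | i <- index_enum 'I_(k l.+1)].
    exists (fun x => if tag x =P l.+1 is ReflectT h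
      then v 0 (ecast l ('I_(k l)) h (tagged x)) else 0).
    apply/funext => x; rewrite /lincomb big_map; apply: eq_bigr => i _ /=.
    by case: eqP => // h'; rewrite (eq_irrelevance h' erefl).
  exact: lincomb_add.
move=> g Hg eps e0; have [l [c hc]] := tw_dense tw Hg e0.
have [s [dd hs]] := span l c; exists s, dd => /=.
by rewrite -[X in X < _]/(q (fun x => g x - lincomb s dd e x)) -hs.
Qed.
End tower.

(** * Zero modes *)

Section zero_modes.
Context {T : Type} {R : realType}.
Local Notation C := (R[i]).
Local Notation fn := (T -> C).
Variables (H : set fn) (ip : fn -> fn -> C) (A : set (fn * fn)).
Hypothesis ph : pre_hilbert H ip.
Local Notation q := (sqnorm ip).
Variables (J : choiceType) (nu : J -> R) (e : J -> fn).
Hypothesis eb : eigenbasis H ip A nu e.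
Variables (m r : nat) (g : 'I_m -> fn) (B : 'M[C]_(m, r)) (S : set fn).
Hypothesis Hg : forall i, H (g i).
Hypothesis indep : forall x : 'rV_m, q (lc x g) = 0 -> x = 0.
Hypothesis S_ker : forall x : 'rV_m, x *m B = 0 -> S (lc x g).
Hypothesis S_perp : forall f, S f -> H f /\ forall j, nu j != 0 -> ip f (e j) = 0.
Hypothesis zero_ker : forall j, nu j = 0 ->
  exists x : 'rV_m, x *m B = 0 /\ q (fun y => e j y - lc x g y) = 0.

Let He j : H (e j). Proof. by case: eb. Qed.
Let one i j : ip (e i) (e j) = (i == j)%:R. Proof. by case: eb. Qed.

(** Bessel's best approximation leaves no error, because no other basis vector can
   improve it. *)
Lemma finite_expansion (z : seq J) f : uniq z -> H f ->
  (forall j, j \notin z -> ip f (e j) = 0) ->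
  q (fun x => f x - lincomb z (fun j => ip f (e j)) e x) = 0.
Proof.
move=> uz Hf fz; apply/eqP; rewrite eq_le (q_ge0 ph) ?andbT; last first.
  by apply: (H_sub ph) => //; exact: (H_lincomb ph).
rewrite (q_best ph) // [X in _ + X]big1 ?addr0; last first.
  by move=> i _; rewrite subrr nsqC expr0n.
apply/ler_addgt0Pr => eps e0; rewrite add0r.
have [s us hs] := eb_best ph eb Hf e0.
apply: le_trans (ltW hs); rewrite lerD2l lerN2.
rewrite (bigID (fun j => j \in z)) /= [X in _ + X]big1 ?addr0; last first.
  by move=> j jz; rewrite fz // nsqC expr0n.
rewrite -big_filter [leRHS](bigID (fun j => j \in s)) /=.
rewrite -[X in _ <= X + _]big_filter.
rewrite (perm_big [seq i <- z | i \in s]) /= ?lerDl ?sumr_ge0 // => [i _|].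
  exact: nsq_ge0.
apply: uniq_perm; rewrite ?filter_uniq // => j.
by rewrite !mem_filter andbC.
Qed.

(** Elements of [S] are finite combinations of basis vectors with eigenvalue zero,
   and these in turn are combinations of the [g i] with coefficients in the left
   kernel of [B]. Comparing independent families in both directions identifies the
   number of zero eigenvalues, the dimension of [S] modulo null functions and the
   dimension of the kernel of [B]. *)
Lemma zero_modes : exists z : seq J,
  [/\ uniq z, size z = (m - \rank B)%N, (forall j, (j \in z) = (nu j == 0)) &
   forall N : set fn, N (fun=> 0) ->
     (forall f, N f -> H f -> q f = 0) -> (forall f, H f -> q f = 0 -> N f) ->
     has_dim S N (m - \rank B)].
Proof.
have [x hx] : exists x : J -> 'rV[C]_m, forall j, nu j = 0 ->
    x j *m B = 0 /\ q (fun y => e j y - lc (x j) g y) = 0.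
  have h j : exists xj : 'rV[C]_m, nu j = 0 ->
      xj *m B = 0 /\ q (fun y => e j y - lc xj g y) = 0.
    have [/zero_ker[xj ?]|n0] := eqVneq (nu j) 0; first by exists xj.
    by exists 0 => h; rewrite h eqxx in n0.
  by have [x hx] := choice h; exists x.
have Hlcg y : H (lc y g) by exact: (H_lc ph).
pose X (z : seq J) := \matrix_(i < size z) x (tnth (in_tuple z) i).
have tz (z : seq J) (i : 'I_(size z)) : tnth (in_tuple z) i \in z.
  exact: mem_tnth.
have lcz (z : seq J) (d : 'rV_(size z)) : {in z, forall j, nu j = 0} ->
    q (fun y => lc d (fun i => e (tnth (in_tuple z) i)) y - lc (d *m X z) g y) = 0.
  move=> z0; rewrite lc_mul.
  have := q0_lincomb ph (index_enum 'I_(size z)) (fun i => d 0 i)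
   (fun i => H_sub ph (He (tnth (in_tuple z) i)) (Hlcg (row i (X z)))) _.
  rewrite -[X in _ -> X]/(q _ = 0).
  have h i : q (fun y => e (tnth (in_tuple z) i) y - lc (row i (X z)) g y) = 0.
    by rewrite rowK; have [] := hx _ (z0 _ (tz _ i)).
  move=> /(_ h); congr (q _ = 0); apply/funext => y; rewrite /lincomb !lcE -sumrB.
  by apply: eq_bigr => i _; rewrite mulrBr.
have Xfree (z : seq J) : uniq z -> {in z, forall j, nu j = 0} -> row_free (X z).
  move=> uz z0; rewrite -kermx_eq0; apply/eqP/row_matrixP => i; rewrite row0.
  set v := row i _; have vX : v *m X z = 0 by apply/sub_kermxP; exact: row_sub.
  have onz k l : ip (e (tnth (in_tuple z) k)) (e (tnth (in_tuple z) l)) = (k == l)%:R.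
    rewrite one; congr (_%:R); congr nat_of_bool.
    by apply/eqP/eqP => [|->//]; exact: (elimT (tuple_uniqP (in_tuple z)) uz).
  have := lcz z v z0; rewrite vX lc0.
  rewrite (_ : (fun y => _) = lc v (fun i => e (tnth (in_tuple z) i))); last first.
    by apply/funext => y; rewrite subr0.
  rewrite {1}/lc (q_lincomb ph) //; last exact: index_enum_uniq.
  move/eqP; rewrite psumr_eq0; last by move=> j _; exact: nsq_ge0.
  move=> /allP h; apply/rowP => j; rewrite [RHS]mxE.
  by have := h j (mem_index_enum _) => /eqP/nsq_eq0.
have XB (z : seq J) : {in z, forall j, nu j = 0} -> (X z <= kermx B)%MS.
  move=> z0; apply/sub_kermxP/row_matrixP => i.
  by rewrite row_mul rowK row0; have [] := hx _ (z0 _ (tz _ i)).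
(* coordinates of distinct zero modes are independent elements of the kernel *)
have small (z : seq J) : uniq z -> {in z, forall j, nu j = 0} ->
    (size z <= m - \rank B)%N.
  move=> uz z0; rewrite -mxrank_ker -(eqP (Xfree z uz z0)).
  exact/mxrankS/XB.
have fin : finite_set [set j | nu j = 0].
  apply: contrapT => /infinite_set_fset -/(_ (m - \rank B).+1)[Z Z0 Zs].
  have /= := small Z (fset_uniq Z) (fun j jZ => Z0 j jZ).
  by rewrite leqNgt => /negP; apply.
pose z : seq J := fset_set [set j | nu j = 0].
have uz : uniq z by exact: fset_uniq.
have zE j : (j \in z) = (nu j == 0).
  by rewrite /z in_fset_set //; apply/idP/eqP; rewrite inE.
have z0 : {in z, forall j, nu j = 0} by move=> j; rewrite zE => /eqP.
have expand f : S f -> q (fun y => f y -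
    lc ((\row_i ip f (e (tnth (in_tuple z) i))) *m X z) g y) = 0.
  move=> Sf; have [Hf fp] := S_perp Sf.
  set d := \row_i _.
  have h1 : q (fun y => f y - lc d (fun i => e (tnth (in_tuple z) i)) y) = 0.
    have fz j : j \notin z -> ip f (e j) = 0 by rewrite zE; exact: fp.
    have := finite_expansion uz Hf fz; rewrite (_ : lincomb z _ e = lc d (fun i => e (tnth (in_tuple z) i))); last first.
      apply/funext => y; rewrite /lincomb big_tnth lcE.
      by apply: eq_bigr => i _; rewrite mxE.
    by [].
  apply: (q0_trans ph Hf _ (Hlcg _) h1 (lcz z d z0)).
  by apply: (H_lc ph) => i.
have sz : size z = (m - \rank B)%N.
  apply/eqP; rewrite eqn_leq small //= -mxrank_ker.
  rewrite -(eqP (Xfree z uz z0)); apply/mxrankS/row_subP => i.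
  have Bi : row i (kermx B) *m B = 0 by apply/sub_kermxP; exact: row_sub.
  have := expand _ (S_ker Bi); set d := (X in X *m _).
  rewrite (_ : (fun y => _) = lc (row i (kermx B) - d *m X z) g); last first.
    by apply/funext => y; rewrite lcB.
  by move=> /indep/eqP; rewrite subr_eq0 => /eqP ->; exact: submxMl.
exists z; split => // N N0 Nq qN; rewrite -sz.
exists (fun i => lc (row i (X z)) g).
  move=> i; apply: S_ker; rewrite rowK.
  by have [] := hx _ (z0 _ (tz _ i)).
move=> f Sf; have [Hf _] := S_perp Sf.
have lcX (c : 'I_(size z) -> C) y :
   \sum_(i < size z) c i * lc (row i (X z)) g y = lc ((\row_i c i) *m X z) g y.
  by rewrite lc_mul lcE; apply: eq_bigr => i _; rewrite mxE.
exists (fun i => ip f (e (tnth (in_tuple z) i))); split.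
  apply: qN; under eq_fun do rewrite lcX; first exact: (H_sub ph).
  exact: expand.
move=> c hc; apply/funext => i.
have : q (lc (((\row_i ip f (e (tnth (in_tuple z) i))) - \row_i c i) *m X z) g) = 0.
  have h1 := expand f Sf.
  have h2 : q (fun y => f y - lc ((\row_i c i) *m X z) g y) = 0.
    apply: Nq; last exact: (H_sub ph).
    by move: hc; congr N; apply/funext => y; rewrite lcX.
  rewrite (q_subC ph) // in h1.
  have := q0_trans ph (Hlcg _) Hf (Hlcg _) h1 h2.
  congr (q _ = 0); apply/funext => y; by rewrite mulmxBl lcB.
move=> /indep h; have {h} : (\row_i ip f (e (tnth (in_tuple z) i))) - \row_i c i = 0.
  by apply: (row_free_inj (Xfree z uz z0)); rewrite h mul0mx.
by move/eqP; rewrite subr_eq0 => /eqP/rowP/(_ i); rewrite !mxE.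
Qed.
End zero_modes.

(** * Heat traces at large times *)

Section trace_limits.
Context {R : realType}.

Lemma expR_decay (l : R) : 0 < l -> expR (- l * t) @[t --> +oo] --> (0 : R).
Proof.
move=> l0; under eq_fun do rewrite mulNr.
apply: (cvg_comp (fun t => l * t) (fun x => expR (- x)) _ (@cvgr_expR R)).
by apply: gt0_cvgMry => //; exact: cvg_id.
Qed.

(** Finiteness at one time makes all but finitely many terms small in total, at
   that time and hence at all later ones. What remains is a finite sum of
   exponentials, which converges to the multiplicity of the eigenvalue zero. *)
Lemma trace_limit (J : choiceType) (nu : J -> R) (z : seq J) (tr : R -> \bar R) :
  (forall j, 0 <= nu j) -> uniq z -> (forall j, (j \in z) = (nu j == 0)) ->
  (forall t, tr t = \esum_(j in [set: J]) (expR (- nu j * t))%:E)%E ->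
  (\forall t \near +oo, (tr t < +oo)%E) ->
  tr t @[t --> +oo] --> ((size z)%:R : R)%:E.
Proof.
move=> nu0 uz zE trE trfin.
have sub_le (s s' : seq J) (a : J -> R) : uniq s -> {subset s <= s'} -> uniq s' ->
    (forall j, 0 <= a j) -> \sum_(j <- s) a j <= \sum_(j <- s') a j.
  move=> us ss us' a0; rewrite [leRHS](bigID (fun j => j \in s)) /=.
  have -> : \sum_(j <- s' | j \in s) a j = \sum_(j <- s) a j.
    rewrite -big_filter; apply: perm_big; apply: uniq_perm => [||j] //.
      by rewrite filter_uniq.
    by rewrite mem_filter; case: (boolP (j \in s)) => //= /ss ->.
  by rewrite lerDl sumr_ge0.
have lez t : ((size z)%:R%:E <= tr t)%E.
  rewrite trE; apply: esum_ge; exists [set` z]; first by split.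
  rewrite -(fsbig_seq _ (fun j => (expR (- nu j * t))%:E)) // sumEFin lee_fin.
  rewrite big_seq (eq_bigr (fun=> 1)); last first.
    by move=> j; rewrite zE => /eqP ->; rewrite oppr0 mul0r expR0.
  by rewrite -big_seq big_const_seq count_predT iter_addr addr0.
have trf : \forall t \near +oo, tr t \is a fin_num.
  near=> t; rewrite ge0_fin_numE; first by near: t.
  by apply: le_trans (lez t); rewrite lee_fin.
apply/fine_cvgP; split => //; apply/cvgrPdist_le => eps e0.
have e2 : 0 < eps / 2 by rewrite divr_gt0.
have [t0 [t00 t0f]] : exists t0 : R, 0 < t0 /\ tr t0 \is a fin_num.
  near (pinfty_nbhs R) => t; exists t; split; first by near: t; exact: nbhs_pinfty_gt.
  by near: t.
have [X [finX hX]] : exists X : set J, finite_set X /\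
    (tr t0 - (eps / 2)%:E < (\sum_(j <- fset_set X) expR (- nu j * t0))%:E)%E.
  have : (tr t0 - (eps / 2)%:E < \esum_(j in [set: J]) (expR (- nu j * t0))%:E)%E.
    by rewrite -trE lteBlDr // lteDl.
  move=> /ereal_sup_gt[_ [X [finX _] <-] hX]; exists X; split => //.
  by rewrite fsbig_finite // sumEFin in hX.
pose s : seq J := [seq j <- fset_set X | j \notin z].
have us : uniq s by rewrite filter_uniq.
have tail t : t0 <= t -> (tr t <=
    ((size z)%:R + \sum_(j <- s) expR (- nu j * t) + eps / 2)%:E)%E.
  move=> t0t; rewrite [leLHS]trE; apply: ge_ereal_sup => _ [Y [finY _] <-].
  rewrite fsbig_finite // sumEFin lee_fin.
  set y : seq J := fset_set Y.
  have uy : uniq y by exact: fset_uniq.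
  rewrite (bigID (fun j => j \in z)) /= -addrA lerD //.
    apply: (@le_trans _ _ (\sum_(j <- z) expR (- nu j * t))).
      rewrite -big_filter; apply: sub_le => [||//|j].
      + by rewrite filter_uniq.
      + by move=> j; rewrite mem_filter => /andP[].
      + exact: expR_ge0.
    rewrite big_seq (eq_bigr (fun=> 1)); last first.
      by move=> j; rewrite zE => /eqP ->; rewrite oppr0 mul0r expR0.
    by rewrite -big_seq big_const_seq count_predT iter_addr addr0.
  rewrite (bigID (fun j => j \in fset_set X)) /= lerD //.
    rewrite -big_filter; apply: sub_le => [||//|j].
    + by rewrite filter_uniq.
    + by move=> j; rewrite !mem_filter => /andP[/andP[-> ->]].
    + exact: expR_ge0.
  apply: (@le_trans _ _ (\sum_(j <- y | (j \notin z) && (j \notin fset_set X))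
      expR (- nu j * t0))).
    apply: ler_sum => j _; rewrite ler_expR !mulNr lerN2.
    by rewrite ler_wpM2l.
  rewrite -big_filter; set w := [seq _ <- _ | _].
  rewrite -(lerD2l (\sum_(j <- fset_set X) expR (- nu j * t0))) -big_cat /=.
  apply: (@le_trans _ _ (fine (tr t0))).
    rewrite -lee_fin fineK // trE; apply: esum_ge.
    exists [set` fset_set X ++ w]; first by split.
    rewrite -(fsbig_seq _ (fun j => (expR (- nu j * t0))%:E)) ?sumEFin //.
    rewrite cat_uniq fset_uniq filter_uniq // andbT; apply/hasPn => j.
    by rewrite mem_filter => /andP[/andP[]].
  by rewrite -lerBlDr -lee_fin EFinB fineK // ltW.
have conv : \sum_(j <- s) expR (- nu j * t) @[t --> +oo] --> (0 : R).
  have : {in s, forall j, 0 < nu j}.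
    move=> j; rewrite mem_filter zE => /andP[n0 _].
    by rewrite lt_neqAle eq_sym n0 nu0.
  elim: (s) => [_|j s' IH h].
    by under eq_fun do rewrite big_nil; exact: cvg_cst.
  under eq_fun do rewrite big_cons.
  have h' : {in s', forall j, 0 < nu j} by move=> i is'; apply: h; rewrite in_cons is' orbT.
  have hh := cvgD (expR_decay (h j (mem_head _ _))) (IH h').
  rewrite addr0 in hh; exact: hh.
have /cvgrPdist_le/(_ _ e2) conv' := conv.
near=> t; rewrite distrC ger0_norm; last first.
  rewrite subr_ge0 -lee_fin fineK; first exact: lez.
  by near: t.
rewrite lerBlDl -lee_fin fineK; last by near: t.
have t0t : t0 <= t by near: t; apply: nbhs_pinfty_ge; rewrite num_real.
apply: le_trans (tail t t0t) _.
rewrite lee_fin -addrA lerD2l [leRHS](splitr eps) lerD2r.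
have : `|0 - \sum_(j <- s) expR (- nu j * t)| <= eps / 2 by near: t.
by rewrite sub0r normrN; exact: le_trans (ler_norm _).
Unshelve. all: by end_near. Qed.

Lemma esum_levels (k : nat -> nat) (a : forall l, 'I_(k l) -> R) (c : R) :
  (forall l i, 0 <= a l i) -> (forall l, \sum_(i < k l) a l i <= c * 2^-1 ^+ l) ->
  (\esum_(x in [set: {l & 'I_(k l)}]) (a (tag x) (tagged x))%:E <= (2 * c)%:E)%E.
Proof.
move=> a0 ac; apply: ge_ereal_sup => _ [X [finX _] <-].
rewrite fsbig_finite // sumEFin lee_fin.
set s : seq {l & 'I_(k l)} := fset_set X.
have [L hL] : exists L, {in s, forall x, (tag x < L)%N}.
  exists (\max_(x <- s) tag x).+1 => x xs; rewrite ltnS.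
  by rewrite (big_rem x) //= leq_maxl.
pose lev l := [seq Tagged (fun l => 'I_(k l)) i | i <- index_enum 'I_(k l)].
have us : uniq s by exact: fset_uniq.
have sub : {subset s <= flatten [seq lev l | l <- iota 0 L]}.
  move=> [l i] xs; apply/flattenP; exists (lev l).
    by apply: map_f; rewrite mem_iota /=; have := hL _ xs.
  by apply: map_f; rewrite mem_index_enum.
have le_sub (s' t : seq {l & 'I_(k l)}) : uniq s' -> {subset s' <= t} ->
    \sum_(x <- s') a (tag x) (tagged x) <= \sum_(x <- t) a (tag x) (tagged x).
  elim: s' t => [t _ _|x s' IH t /= /andP[xs' us'] st].
    by rewrite big_nil sumr_ge0.
  have xt : x \in t by apply: st; rewrite mem_head.
  rewrite big_cons (perm_big _ (perm_to_rem xt)) big_cons lerD2l; apply: IH => //.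
  move=> y ys'; have := st y; rewrite in_cons ys' orbT => /(_ isT).
  rewrite (perm_mem (perm_to_rem xt)) in_cons => /orP[/eqP yx|//].
  by rewrite -yx ys' in xs'.
apply: le_trans (le_sub _ _ us sub) _; rewrite big_flatten /= big_map.
apply: (@le_trans _ _ (\sum_(l <- iota 0 L) c * 2^-1 ^+ l)).
  by apply: ler_sum => l _; rewrite big_map; exact: ac.
rewrite -mulr_sumr mulrC; have c0 : 0 <= c.
  by have := ac 0%N; rewrite expr0 mulr1; apply: le_trans; exact: sumr_ge0.
rewrite ler_wpM2r //.
have e : \sum_(l <- iota 0 L) (2^-1 : R) ^+ l = 2 - 2 * 2^-1 ^+ L.
  elim: L {hL sub} => [|L IH]; first by rewrite big_nil expr0; ring.
  rewrite -addn1 iotaD big_cat /= IH big_seq1 add0n addn1 exprS.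
  move: (2^-1 ^+ L : R) => y; lra.
by rewrite e gerBl mulr_ge0 // exprn_ge0 // invr_ge0.
Qed.
End trace_limits.

(** * The p-adic absolute value *)

Section padic_abs_facts.
Context {R : realType} {p : nat} {F : padicField R p}.
Hypothesis p_prime : prime p.
Implicit Types x y z : Qp F.

Lemma qabs0 : qabs (0 : Qp F) = 0.
Proof.
have -> : (0 : Qp F) = ratr 0 by rewrite /ratr mul0r.
by rewrite /qabs padic_abs_ratr /rat_padic_abs eqxx.
Qed.

Lemma qabs_eq0 x : (qabs x == 0) = (x == 0).
Proof.
by apply/eqP/eqP => [/(@padic_abs_eq0 R p F)//|->]; exact: qabs0.
Qed.

Lemma qabsM x y : qabs (x * y) = qabs x * qabs y.
Proof. exact: padic_absM. Qed.

Lemma qabs1 : qabs (1 : Qp F) = 1.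
Proof.
have h : qabs (1 : Qp F) != 0 by rewrite qabs_eq0 oner_eq0.
by apply: (mulfI h); rewrite -qabsM !mulr1.
Qed.

Lemma qabsD x y : qabs (x + y) <= Num.max (qabs x) (qabs y).
Proof. exact: padic_absD. Qed.

Lemma qabsN x : qabs (- x) = qabs x.
Proof.
suff h : qabs (-1 : Qp F) = 1 by rewrite -mulN1r qabsM h mul1r.
have -> : (-1 : Qp F) = ratr (-1) by rewrite /ratr divr1.
by rewrite /qabs padic_abs_ratr /rat_padic_abs /= logn1 subrr expr0z.
Qed.

Lemma qabs_ge0 x : 0 <= qabs x.
Proof. by have := qabsD x (- x); rewrite subrr qabs0 qabsN maxxx. Qed.

Lemma qabs_gt0 x : (0 < qabs x) = (x != 0).
Proof. by rewrite lt_neqAle eq_sym qabs_eq0 qabs_ge0 andbT. Qed.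

Lemma qabsBC x y : qabs (x - y) = qabs (y - x).
Proof. by rewrite -qabsN opprB. Qed.

Lemma qabsB_le x y z (r : R) : qabs (x - y) <= r -> qabs (y - z) <= r ->
  qabs (x - z) <= r.
Proof.
move=> xy yz; rewrite -(subrKA y); apply: le_trans (qabsD _ _) _.
by rewrite ge_max xy yz.
Qed.

Lemma qabsB_lt x y z (r : R) : qabs (x - y) < r -> qabs (y - z) < r ->
  qabs (x - z) < r.
Proof.
move=> xy yz; rewrite -(subrKA y); apply: le_lt_trans (qabsD _ _) _.
by rewrite gt_max xy yz.
Qed.

(** Of the three sides of an ultrametric triangle the two longest are equal. *)
Lemma qabs_isosceles x x' y : qabs (x - x') < qabs (x - y) ->
  qabs (x' - y) = qabs (x - y).
Proof.
move=> h; apply/eqP; rewrite eq_le; apply/andP; split.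
  by apply: (@qabsB_le _ x); [rewrite qabsBC ltW|].
rewrite leNgt; apply/negP => h'; have := qabsB_lt (z := y) h h'.
by rewrite ltxx.
Qed.

Lemma qabsX x n : qabs (x ^+ n) = qabs x ^+ n.
Proof.
elim: n => [|n IH]; first by rewrite !expr0 qabs1.
by rewrite !exprS qabsM IH.
Qed.

Lemma qabsV x : qabs x^-1 = (qabs x)^-1.
Proof.
have [->|x0] := eqVneq x 0; first by rewrite invr0 qabs0 invr0.
have h : qabs x != 0 by rewrite qabs_eq0.
by apply: (mulfI h); rewrite -qabsM !mulfV // qabs1.
Qed.

Lemma qabs_nat_logn n : (0 < n)%N -> qabs (n%:R : Qp F) = p%:R ^- logn p n.
Proof.
move=> n0; rewrite -(ratr_nat (Qp F)) /qabs padic_abs_ratr /rat_padic_abs.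
rewrite pnatr_eq0 eqn0Ngt n0 /= -[n%:R]/((n%:Z)%:~R : rat).
by rewrite numq_int denq_int logn1 sub0r /= -exprnN.
Qed.

Lemma qabs_nat_le1 n : qabs (n%:R : Qp F) <= 1.
Proof.
elim: n => [|n IH]; first by rewrite qabs0.
by rewrite -addn1 natrD (le_trans (qabsD _ _)) // ge_max IH qabs1 lexx.
Qed.

Lemma qabs_int_le1 (n : int) : qabs (n%:~R : Qp F) <= 1.
Proof.
by case: n => n; rewrite ?NegzE ?mulrNz ?qabsN -?pmulrn qabs_nat_le1.
Qed.

Lemma p_gt0 : (0 : R) < p%:R. Proof. by rewrite ltr0n prime_gt0. Qed.
Lemma p_gt1 : (1 : R) < p%:R. Proof. by rewrite ltr1n prime_gt1. Qed.

Lemma qabs_p : qabs (p%:R : Qp F) = p%:R^-1.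
Proof. by rewrite qabs_nat_logn ?prime_gt0 // logn_prime // eqxx expr1. Qed.

Lemma qabs_coprime n : ~~ (p %| n)%N -> qabs (n%:R : Qp F) = 1.
Proof.
case: n => [|n] h; first by rewrite dvdn0 in h.
by rewrite qabs_nat_logn // (_ : logn p n.+1 = 0)%N ?expr0 ?invr1 //; apply/eqP; rewrite lognE p_prime /= (negPf h).
Qed.

Lemma qabs_dvd (z : int) : (p %| z)%Z -> qabs (z%:~R : Qp F) <= p%:R^-1.
Proof.
move=> /dvdzP[w ->]; rewrite intrM qabsM -pmulrn qabs_p.
by rewrite ger_pMl ?invr_gt0 ?p_gt0 // qabs_int_le1.
Qed.

(** By density [x] is close to a rational number of absolute value at most one. Its
   denominator is prime to [p], so it is an integer modulo [p] by Bezout. This is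
   how the residue field is seen to have just [p] elements for an abstract
   completion. *)
Lemma digit x : qabs x <= 1 -> exists2 k : nat, (k < p)%N &
  qabs (x - k%:R) <= p%:R^-1.
Proof.
move=> x1.
have pV : (0 : R) < p%:R^-1 by rewrite invr_gt0 p_gt0.
have pV1 : (p%:R^-1 : R) < 1 by rewrite invf_lt1 ?p_gt1 ?p_gt0.
have [r hr] := padic_dense (x : padic_sort F) pV.
have {}hr : qabs (x - ratr r) < p%:R^-1 := hr.
have r1 : qabs (ratr r : Qp F) <= 1.
  rewrite -[ratr r]subr0; apply: (@qabsB_le _ x); last by rewrite subr0.
  by rewrite qabsBC; apply: ltW; apply: lt_trans hr pV1.
pose d : nat := `|denq r|%N; have dE : denq r = d%:Z by rewrite /d absz_denq.
have pd : ~~ (p %| d)%N.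
  apply/negP => pd; have pn : ~~ (p %| `|numq r|)%N.
    apply/negP => pn; have := coprime_num_den r; rewrite -/d => /eqP g1.
    have := dvdn_gcd p `|numq r| d; rewrite pd pn g1 dvdn1.
    by move=> /eqP p1; move: p_prime; rewrite p1.
  have dn : (0 < d)%N by rewrite /d absz_gt0 denq_neq0.
  have rE : (ratr r : Qp F) * d%:R = (numq r)%:~R.
    rewrite /ratr dE -pmulrn mulfVK //.
    by rewrite -qabs_eq0 qabs_nat_logn // invr_eq0 expf_neq0 // gt_eqF // p_gt0.
  have := congr1 (@qabs R p F) rE; rewrite qabsM.
  have -> : qabs ((numq r)%:~R : Qp F) = 1.
    case: (numq r) pn => n pn; last by rewrite NegzE mulrNz qabsN -pmulrn qabs_coprime.
    by rewrite -pmulrn qabs_coprime.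
  have : qabs (d%:R : Qp F) <= p%:R^-1.
    by have := @qabs_dvd d%:Z; rewrite -pmulrn; apply; exact: pd.
  move=> hd e; have : qabs (ratr r : Qp F) * qabs (d%:R : Qp F) <= p%:R^-1.
    by rewrite (le_trans _ hd) // ler_piMl // qabs_ge0.
  by rewrite e leNgt pV1.
have cop : coprimez d p by rewrite coprimezE coprime_sym prime_coprime.
have [u [v uv]] : exists u v : int, u * d + v * p = 1.
  have [[u v] /= h] := coprimezP _ _ cop; by exists u, v.
(* [u] inverts the denominator modulo [p] *)
pose k : int := (numq r * u %% p)%Z.
have p0 : (p%:Z != 0) by rewrite eqz_nat -lt0n prime_gt0.
have k0 : 0 <= k by exact: modz_ge0.
have kp : k < p by have := ltz_pmod (numq r * u) (_ : 0 < p%:Z); apply; rewrite ltz_nat prime_gt0.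
exists `|k|%N; first by rewrite -ltz_nat gez0_abs.
have -> : ((`|k|%N)%:R : Qp F) = k%:~R by rewrite pmulrn gez0_abs.
apply: (@qabsB_le _ (ratr r)); first exact: ltW.
have d0 : (d%:R : Qp F) != 0 by rewrite -qabs_eq0 qabs_coprime // oner_eq0.
have -> : (ratr r : Qp F) - k%:~R = (numq r - k * d)%:~R / d%:R.
  rewrite /ratr dE intrB intrM -!pmulrn mulrBl mulfK //.
rewrite qabsM qabsV qabs_coprime // invr1 mulr1; apply: qabs_dvd.
apply/dvdzP; exists (numq r * v + (numq r * u %/ p)%Z * d).
have := divz_eq (numq r * u) p; rewrite -/k => e.
have -> : k = numq r * u - (numq r * u %/ p)%Z * p by rewrite {1}e addrAC subrr add0r.
rewrite -[X in X - _]mulr1 -uv; ring.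
Qed.

End padic_abs_facts.

(** * Discs and Haar measure *)

Section padic_discs.
Context {R : realType} {p : nat} {F : padicField R p}.
Hypothesis p_prime : prime p.
Implicit Types x y z a : Qp F.

Definition disc l a : set (Qp F) := [set y | qabs (y - a) <= p%:R ^- l].

Let p0 : (0 : R) < p%:R := p_gt0 p_prime.

Lemma pXV_gt0 l : (0 : R) < p%:R ^- l. Proof. by rewrite invr_gt0 exprn_gt0. Qed.

Lemma pXV_le l k : (l <= k)%N -> (p%:R ^- k : R) <= p%:R ^- l.
Proof.
move=> lk; rewrite lef_pV2 ?posrE ?exprn_gt0 //.
by rewrite ler_eXn2l // p_gt1.
Qed.

Lemma pXV_small (e : R) : 0 < e -> exists l, (p%:R ^- l : R) < e.
Proof.
move=> e0; exists (Num.truncn e^-1).+1.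
rewrite invf_plt ?posrE ?exprn_gt0 //.
apply: (@lt_le_trans _ _ (Num.truncn e^-1).+1%:R).
  by apply: truncnS_gt.
by rewrite -natrX ler_nat ltnW // ltn_expl // prime_gt1.
Qed.

Lemma disc_center l a : disc l a a.
Proof. by rewrite /disc /= subrr qabs0 ltW // pXV_gt0. Qed.

Lemma disc_le l k a : (l <= k)%N -> disc k a `<=` disc l a.
Proof. by move=> lk y; rewrite /disc /= => /le_trans; apply; exact: pXV_le. Qed.

Lemma disc_eq l a y : disc l a y -> disc l y = disc l a.
Proof.
move=> ya; apply/seteqP; split => z; rewrite /disc /= => h.
  exact: (qabsB_le h ya).
by apply: (qabsB_le h); rewrite qabsBC.
Qed.

Lemma disc_out l a x y : ~ disc l a y -> disc l a x -> qabs (x - y) = qabs (a - y).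
Proof.
move=> ya xa; apply: qabs_isosceles; rewrite qabsBC.
by apply: le_lt_trans xa _; rewrite ltNge qabsBC; apply/negP.
Qed.

Lemma nbhs_disc x (A : set (Qp F)) : nbhs x A <-> exists l, disc l x `<=` A.
Proof.
split => [/nbhs_ballP[e /= e0 eA]|[l lA]].
  have [l le] := pXV_small e0; exists l => y yl; apply: eA.
  by rewrite ballEmdist /=; rewrite /disc /= qabsBC in yl; exact: le_lt_trans yl le.
apply/nbhs_ballP; exists (p%:R ^- l); first exact: pXV_gt0.
by move=> y; rewrite ballEmdist /= => h; apply: lA; rewrite /disc /= qabsBC ltW.
Qed.

Lemma disc_open l a : open (disc l a).
Proof.
rewrite openE => y ya; apply/nbhs_disc; exists l.
by rewrite (disc_eq ya).
Qed.

Lemma open_measurable_Qp (A : set (Qp F)) : open A -> measurable A.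
Proof. exact: sub_sigma_algebra. Qed.

Lemma disc_measurable l a : measurable (disc l a).
Proof. by apply: open_measurable_Qp; exact: disc_open. Qed.

(** The sets [P l] are open and increasing. This turns pointwise choices of a radius
   into a uniform one, for the sets of the vertices as well as for locally constant
   functions. *)
Lemma compact_uniform (K : set (Qp F)) (P : nat -> set (Qp F)) : compact K ->
  (forall l k x, (l <= k)%N -> P l x -> P k x) ->
  (forall l x y, P l x -> disc l x y -> P l y) ->
  (forall x, K x -> exists l, P l x) -> exists l, K `<=` P l.
Proof.
rewrite compact_cover => cK mono inv ex.
have Pop l : open (P l).
  rewrite openE => x Px; apply/nbhs_disc; exists l => y; exact: inv.
have cov : K `<=` \bigcup_(l in setT) P l.
  by move=> x /ex[l Px]; exists l.
have [D _ hD] := cK _ _ _ (fun l _ => Pop l) cov.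
exists (\max_(l <- D) l)%N => x /hD[l /= lD Px]; apply: mono Px.
by rewrite (big_rem l) //= leq_maxl.
Qed.

Lemma compact_disc_cover (K : set (Qp F)) l : compact K ->
  exists s : seq (Qp F), {subset s <= K} /\
    forall x, K x -> exists2 a, a \in s & disc l a x.
Proof.
rewrite compact_cover => cK.
have cov : K `<=` \bigcup_(a in K) disc l a.
  by move=> x Kx; exists x => //; exact: disc_center.
have [D DK hD] := cK _ _ _ (fun a _ => @disc_open l a) cov.
exists (D : seq _); split; first by move=> a /DK; rewrite inE.
by move=> x /hD[a aD ax]; exists a.
Qed.

Section haar.
Variable mu : {sigma_finite_measure set (Qp F) -> \bar R}.
Hypothesis mu_haar : is_haar mu.

Lemma disc_translate l a : mu (disc l a) = mu (disc l 0).
Proof.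
have [_ tr] := mu_haar; rewrite -(tr a (disc l 0)); last exact: disc_measurable.
congr (mu _); apply/seteqP; split => [y ya|_ [x x0 <-]].
  exists (y - a); last by rewrite subrK.
  by rewrite /disc /= subr0.
by move: x0; rewrite /disc /= subr0 addrK.
Qed.

Lemma disc_split l : disc l 0 =
  \big[setU/set0]_(k < p) disc l.+1 ((k : nat)%:R * p%:R ^+ l).
Proof.
have pl : qabs ((p%:R : Qp F) ^+ l) = p%:R ^- l by rewrite qabsX qabs_p // exprVn.
rewrite -(bigcup_mkord p (fun k => disc l.+1 (k%:R * p%:R ^+ l))).
apply/seteqP; split => [x x0|x [k /= kp]].
  have pl0 : (p%:R : Qp F) ^+ l != 0.
    by rewrite -qabs_eq0 pl gt_eqF // pXV_gt0.
  have [|k kp hk] := @digit R p F p_prime (x / p%:R ^+ l).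
    rewrite qabsM qabsV pl invrK -ler_pdivlMr ?exprn_gt0 // mul1r.
    by move: x0; rewrite /disc /= subr0.
  exists k => //; rewrite /disc /=.
  have -> : x - k%:R * p%:R ^+ l = (x / p%:R ^+ l - k%:R) * p%:R ^+ l.
    by rewrite mulrBl divfK.
  by rewrite qabsM pl exprS invfM ler_wpM2r // ltW // pXV_gt0.
rewrite /disc /= subr0 => h; rewrite -[x]subr0.
apply: (@qabsB_le _ _ _ _ (k%:R * p%:R ^+ l)).
  by apply: le_trans h _; exact: pXV_le.
by rewrite subr0 qabsM pl ler_piMl ?qabs_nat_le1 // ltW // pXV_gt0.
Qed.

(** A disc is the disjoint union of [p] translates of the disc of the next level, and
   the unit disc has measure one. *)
Lemma mu_disc l a : mu (disc l a) = (p%:R ^- l)%:E.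
Proof.
rewrite disc_translate; elim: l => [|l IH].
  have [m1 _] := mu_haar; rewrite expr0 invr1 -m1; congr (mu _).
  by apply/seteqP; split => x; rewrite /disc /= subr0 expr0 invr1.
have mD (k : 'I_p) : measurable (disc l.+1 ((k : nat)%:R * p%:R ^+ l)).
  exact: disc_measurable.
have tD : trivIset setT (fun k : 'I_p => disc l.+1 ((k : nat)%:R * p%:R ^+ l)).
  apply/trivIsetP => i j _ _ ij; rewrite -subset0 => x [].
  rewrite /disc /= => hi hj; rewrite qabsBC in hi.
  have := qabsB_le hi hj; rewrite -mulrBl qabsM qabsX qabs_p // exprVn.
  have -> : qabs ((i : nat)%:R - (j : nat)%:R : Qp F) = 1.
    wlog ji : i j ij {hi hj x} / (j < i)%N.
      move=> w; have [ji|ij'|h] := ltngtP j i; first exact: w.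
        by rewrite qabsBC; apply: w; rewrite // eq_sym.
      by move: ij; rewrite -val_eqE /= h eqxx.
    rewrite -natrB 1?ltnW // qabs_coprime //.
    apply/negP => /dvdn_leq; rewrite subn_gt0 ji => /(_ isT).
    by rewrite leqNgt; apply/negP; rewrite negbK; apply: leq_ltn_trans (ltn_ord i); exact: leq_subr.
  rewrite mul1r leNgt => /negP; apply.
  by rewrite exprS invfM gtr_pMl ?pXV_gt0 // invf_lt1 ?p_gt1.
have := IH; rewrite disc_split (measure_bigsetU_ord _ _ mD tD).
rewrite (eq_bigr (fun=> mu (disc l.+1 0))); last by move=> k _; exact: disc_translate.
have h0 : (0 <= mu (disc l.+1 0%R))%E by exact: measure_ge0.
move: h0; case: (mu (disc l.+1 0)) => [r _||] //.
  rewrite sumEFin sumr_const card_ord => -[h]; congr EFin.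
  have -> : r = r *+ p / p%:R by rewrite -[r *+ p]mulr_natr mulfK // gt_eqF.
  by rewrite h exprS invfM mulrC.
(* an infinite measure is excluded, since the disc of level [l] has finite measure *)
move=> _; rewrite -(prednK (prime_gt0 p_prime)) big_ord_recl /=.
rewrite addye // gt_eqF //; apply: (@lt_le_trans _ _ 0%E) => //.
exact: sume_ge0.
Qed.
End haar.
End padic_discs.

(** * Complex-valued square integrable functions *)

Section L2_space.
Context {d} {T : measurableType d} {R : realType}.
Variables (mu : {measure set T -> \bar R}) (D : set T).
Hypothesis mD : measurable D.
Implicit Types (f g h : T -> R[i]) (u v : T -> R).

Definition rint u := mu.-integrable D (EFin \o u).

Lemma rint_lin a b u v : rint u -> rint v -> rint (fun x => a * u x + b * v x).
Proof.
move=> hu hv.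
have := integrableD mD (integrableZl mD a hu) (integrableZl mD b hv).
by apply: eq_integrable.
Qed.

Lemma Rint_lin a b u v : rint u -> rint v ->
  \int[mu]_(x in D) (a * u x + b * v x) =
  a * \int[mu]_(x in D) u x + b * \int[mu]_(x in D) v x.
Proof.
move=> hu hv; rewrite RintegralD //; first by rewrite !RintegralZl.
  by have := integrableZl mD a hu; apply: eq_integrable.
by have := integrableZl mD b hv; apply: eq_integrable.
Qed.

Definition cint f := rint (fun x => complex.Re (f x)) /\ rint (fun x => complex.Im (f x)).

Lemma cint_lin a f g : cint f -> cint g -> cint (fun x => a * f x + g x).
Proof.
move=> [f1 f2] [g1 g2]; split.
  have := rint_lin 1 1 (rint_lin (complex.Re a) (- complex.Im a) f1 f2) g1.
  congr rint; apply/funext => x; rewrite !ReImE; ring.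
have := rint_lin 1 1 (rint_lin (complex.Im a) (complex.Re a) f1 f2) g2.
congr rint; apply/funext => x; rewrite !ReImE; ring.
Qed.

Lemma cintegral_lin a f g : cint f -> cint g ->
  cintegral mu D (fun x => a * f x + g x) = a * cintegral mu D f + cintegral mu D g.
Proof.
move=> [f1 f2] [g1 g2]; rewrite /cintegral; apply: complex_ext.
  transitivity (\int[mu]_(x in D) (1 * (complex.Re a * complex.Re (f x) +
     (- complex.Im a) * complex.Im (f x)) + 1 * complex.Re (g x))).
    by congr Rintegral; apply/funext => x; rewrite !ReImE; ring.
  rewrite Rint_lin //; last exact: rint_lin.
  by rewrite Rint_lin // !ReImE; ring.
transitivity (\int[mu]_(x in D) (1 * (complex.Im a * complex.Re (f x) +
     complex.Re a * complex.Im (f x)) + 1 * complex.Im (g x))).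
  by congr Rintegral; apply/funext => x; rewrite !ReImE; ring.
rewrite Rint_lin //; last exact: rint_lin.
by rewrite Rint_lin // !ReImE; ring.
Qed.

Lemma cint0 : cint (fun=> 0).
Proof. by split; apply: integrable0. Qed.

Lemma cintegral0 : cintegral mu D (fun=> 0) = 0.
Proof.
have := cintegral_lin (-1) cint0 cint0.
by rewrite (_ : (fun _ => _) = (fun=> 0)) ?mulN1r ?addNr //; apply/funext => x; rewrite mulr0 addr0.
Qed.

Lemma cint_lincomb I (s : seq I) c (F : I -> T -> R[i]) :
  (forall i, cint (F i)) -> cint (lincomb s c F).
Proof.
move=> hF; elim: s => [|i s IH].
  by have := cint0; congr cint; apply/funext => x; rewrite /lincomb big_nil.
have := cint_lin (c i) (hF i) IH; congr cint; apply/funext => x.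
by rewrite /lincomb big_cons.
Qed.

Lemma cintegral_lincomb I (s : seq I) c (F : I -> T -> R[i]) :
  (forall i, cint (F i)) -> cintegral mu D (lincomb s c F) =
  \sum_(i <- s) c i * cintegral mu D (F i).
Proof.
move=> hF; elim: s => [|i s IH].
  rewrite big_nil -[RHS]cintegral0; congr cintegral.
  by apply/funext => x; rewrite /lincomb big_nil.
rewrite big_cons -IH -cintegral_lin //; last exact: cint_lincomb.
by congr cintegral; apply/funext => x; rewrite /lincomb big_cons.
Qed.

Lemma eq_cintegral f g : (forall x, D x -> f x = g x) ->
  cintegral mu D f = cintegral mu D g.
Proof.
move=> fg; rewrite /cintegral; congr Complex; apply: eq_Rintegral => x;
by rewrite inE => /fg ->.
Qed.

Definition sq_rint u := measurable_fun D u /\ rint (fun x => u x ^+ 2).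

Lemma sq_rint_mul u v : sq_rint u -> sq_rint v -> rint (fun x => u x * v x).
Proof.
move=> [mu_ hu] [mv hv]; have := rint_lin 1 1 hu hv; apply: le_integrable => //.
  by apply/measurable_EFinP; exact: measurable_funM.
move=> x _ /=; rewrite lee_fin !mul1r [leRHS]ger0_norm ?addr_ge0 ?sqr_ge0 //.
rewrite normrM -(real_normK (num_real (u x))) -(real_normK (num_real (v x))).
have := sqr_ge0 (`|u x| - `|v x|); have := normr_ge0 (u x); have := normr_ge0 (v x).
by nra.
Qed.

Lemma sq_rint_lin a b u v : sq_rint u -> sq_rint v ->
  sq_rint (fun x => a * u x + b * v x).
Proof.
move=> hu hv; split.
  by apply: measurable_funD; apply: measurable_funM; [exact: measurable_cst|by case: hu|exact: measurable_cst|by case: hv].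
have := rint_lin 1 (2 * a * b)
  (rint_lin (a ^+ 2) (b ^+ 2) (proj2 hu) (proj2 hv)) (sq_rint_mul hu hv).
by congr rint; apply/funext => x; ring.
Qed.

Lemma sum_sq_ge0 f x : 0 <= complex.Re (f x) ^+ 2 + complex.Im (f x) ^+ 2.
Proof. by rewrite addr_ge0 // sqr_ge0. Qed.

Lemma L2P f : L2 mu D f <->
  sq_rint (fun x => complex.Re (f x)) /\ sq_rint (fun x => complex.Im (f x)).
Proof.
split=> [[m1 m2 fin]|[[m1 i1] [m2 i2]]].
  have i : rint (fun x => complex.Re (f x) ^+ 2 + complex.Im (f x) ^+ 2).
    apply/integrableP; split.
      by apply/measurable_EFinP; apply: measurable_funD; exact: measurable_funX.
    apply: le_lt_trans fin; rewrite le_eqVlt; apply/orP; left; apply/eqP.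
    by apply: eq_integral => x _ /=; rewrite ger0_norm // sum_sq_ge0.
  by split; (split; first by []);
   apply: (le_integrable mD _ _ i); rewrite //;
    try (by apply/measurable_EFinP; exact: measurable_funX);
    move=> x _ /=; rewrite lee_fin !ger0_norm ?sqr_ge0 ?sum_sq_ge0 // ?lerDl ?lerDr sqr_ge0.
split => //.
have := rint_lin 1 1 i1 i2 => /integrableP[_]; apply: le_lt_trans.
rewrite le_eqVlt; apply/orP; left; apply/eqP.
by apply: eq_integral => x _ /=; rewrite !mul1r ger0_norm // sum_sq_ge0.
Qed.

Lemma cint_mul f g : L2 mu D f -> L2 mu D g -> cint (fun x => f x * (g x)^*).
Proof.
move=> /L2P[f1 f2] /L2P[g1 g2]; split.
  have := rint_lin 1 1 (sq_rint_mul f1 g1) (sq_rint_mul f2 g2).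
  by congr rint; apply/funext => x; rewrite !ReImE; ring.
have := rint_lin (-1) 1 (sq_rint_mul f1 g2) (sq_rint_mul f2 g1).
by congr rint; apply/funext => x; rewrite !ReImE; ring.
Qed.

Lemma L2_pre_hilbert : pre_hilbert (L2 mu D) (L2ip mu D).
Proof.
split.
- have h : sq_rint (fun=> 0).
    split; first exact: measurable_cst.
    by have := integrable0 mu D; congr (integrable _ _ _); apply/funext => x /=; rewrite expr0n.
  by apply/L2P; split.
- move=> a f g /L2P[f1 f2] /L2P[g1 g2]; apply/L2P; split.
    have := sq_rint_lin 1 1 (sq_rint_lin (complex.Re a) (- complex.Im a) f1 f2) g1.
    by congr sq_rint; apply/funext => x; rewrite !ReImE; ring.
  have := sq_rint_lin 1 1 (sq_rint_lin (complex.Im a) (complex.Re a) f1 f2) g2.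
  by congr sq_rint; apply/funext => x; rewrite !ReImE; ring.
- move=> a f g h Lf Lg Lh; rewrite /L2ip -cintegral_lin; [|exact: cint_mul|exact: cint_mul].
  by congr cintegral; apply/funext => x; rewrite mulrDl mulrA.
- move=> f g Lf Lg; have [i1 i2] := cint_mul Lf Lg.
  rewrite /L2ip /cintegral; apply: complex_ext; rewrite ?ReJ ?ImJ /=.
    by congr Rintegral; apply/funext => x; rewrite !ReImE; ring.
  rewrite -mulN1r -RintegralZl //; congr Rintegral.
  by apply/funext => x; rewrite !ReImE; ring.
- move=> f Lf; rewrite /L2ip /cintegral lecE /=; apply/andP; split.
    rewrite (_ : (fun x => _) = fun=> 0) ?Rintegral_cst ?mul0r //.
    by apply/funext => x; rewrite mulcJ.
  by apply: Rintegral_ge0 => x _; rewrite mulcJ /= addr_ge0 // sqr_ge0.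
Qed.

Lemma L2norm2E f : L2 mu D f -> L2norm2 mu D f = (sqnorm (L2ip mu D) f)%:E.
Proof.
move=> Lf; have [i1 _] := cint_mul Lf Lf.
rewrite /sqnorm /L2ip /cintegral /= fineK; last exact: integrable_fin_num.
by apply: eq_integral => x _; rewrite mulcJ.
Qed.

(** Ties the null functions, in terms of which dimensions are defined, to the
   seminorm of the Hilbert space. *)
Lemma L2nullP f : L2 mu D f -> L2null mu D f <-> sqnorm (L2ip mu D) f = 0.
Proof.
move=> Lf; have [m1 m2 _] := Lf.
have mf : measurable_fun D
    (fun x => (complex.Re (f x) ^+ 2 + complex.Im (f x) ^+ 2)%:E).
  by apply/measurable_EFinP; apply: measurable_funD; exact: measurable_funX.
have e := ae_eq_integral_abs mu mD mf.
have e2 : (\int[mu]_(x in D) `|(complex.Re (f x) ^+ 2 + complex.Im (f x) ^+ 2)%:E|)%E =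
    L2norm2 mu D f.
  by apply: eq_integral => x _; rewrite gee0_abs // lee_fin sum_sq_ge0.
rewrite e2 L2norm2E // in e.
split=> [N|q0].
  suff : (sqnorm (L2ip mu D) f)%:E = 0%E by case.
  apply/e; apply: filterS N => x h /h ->.
  by rewrite /= expr0n addr0.
have /e : (sqnorm (L2ip mu D) f)%:E = 0%E by rewrite q0.
apply: filterS => x h /h [h0]; exact: nsq_eq0.
Qed.

Lemma eq_L2 f g : (forall x, D x -> f x = g x) -> L2 mu D f -> L2 mu D g.
Proof.
move=> fg [m1 m2 fin]; split.
- by apply: eq_measurable_fun m1 => x; rewrite inE => /fg ->.
- by apply: eq_measurable_fun m2 => x; rewrite inE => /fg ->.
- rewrite (_ : L2norm2 mu D g = L2norm2 mu D f) //.
  by apply: eq_integral => x; rewrite inE => /fg ->.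
Qed.

Lemma eq_q f g : (forall x, D x -> f x = g x) -> sqnorm (L2ip mu D) f = sqnorm (L2ip mu D) g.
Proof.
by move=> fg; rewrite /sqnorm; congr complex.Re; apply: eq_cintegral => x /fg ->.
Qed.

Lemma eq_L2ip f g h k : (forall x, D x -> f x = g x) ->
  (forall x, D x -> h x = k x) -> L2ip mu D f h = L2ip mu D g k.
Proof. by move=> fg hk; apply: eq_cintegral => x Dx; rewrite fg // hk. Qed.

Lemma L2cvg_near (w : nat -> T -> R[i]) f : (forall n, L2 mu D (w n)) ->
  L2 mu D f -> L2cvg mu D w f -> forall eps : R, 0 < eps ->
  \forall n \near \oo, sqnorm (L2ip mu D) (fun x => w n x - f x) < eps.
Proof.
move=> Lw Lf cv eps e0.
have : \forall n \near \oo, (L2norm2 mu D (fun x => (w n x - f x)%R) < eps%:E)%E.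
  have nb : nbhs (0%E : \bar R) [set y | (y < eps%:E)%E].
    by apply: open_nbhs_nbhs; split; [exact: open_ereal_lt_ereal|rewrite /= lte_fin].
  exact: cv nb.
by apply: filterS => n; rewrite L2norm2E // ?lte_fin //; exact: (H_sub L2_pre_hilbert).
Qed.

Definition cind (A : set T) : T -> R[i] := fun x => (\1_A x)%:C.

Lemma cind_cint A : measurable A -> (mu (A `&` D) < +oo)%E -> cint (cind A).
Proof.
move=> mA fA; split; last by have := cint0 => -[_]; congr rint.
apply/integrableP; split; first by apply/measurable_EFinP; exact: measurable_indic.
rewrite (_ : (\int[mu]_(x in D) _)%E = mu (A `&` D)) //.
rewrite -integral_indic //; apply: eq_integral => x _ /=.
by rewrite ger0_norm.
Qed.

Lemma cintegral_cind A : measurable A -> (mu (A `&` D) < +oo)%E ->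
  cintegral mu D (cind A) = (fine (mu (A `&` D)))%:C.
Proof.
move=> mA fA; rewrite /cintegral; apply: complex_ext => /=.
  by rewrite /Rintegral integral_indic.
by rewrite Rintegral_cst // mul0r.
Qed.

Lemma cind_L2 A : measurable A -> (mu (A `&` D) < +oo)%E -> L2 mu D (cind A).
Proof.
move=> mA fA; have [i1 i2] := cind_cint mA fA; apply/L2P; split; split => //=.
- exact: measurable_indic.
- move: i1; congr rint; apply/funext => x /=; rewrite indicE.
  by case: (x \in A); rewrite /= ?expr1n ?expr0n.
- by move: i2; congr rint; apply/funext => x /=; rewrite expr0n.
Qed.

Lemma cindM A B x : cind A x * (cind B x)^* = cind (A `&` B) x.
Proof. by rewrite /cind conjc_real indicI -rmorphM. Qed.

Lemma ip_cind A B : measurable A -> measurable B -> (mu (A `&` D) < +oo)%E ->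
  L2ip mu D (cind A) (cind B) = (fine (mu (A `&` B `&` D)))%:C.
Proof.
move=> mA mB fA; rewrite /L2ip; under eq_fun do rewrite cindM.
apply: cintegral_cind; first exact: measurableI.
apply: le_lt_trans fA; apply: le_measure; rewrite ?inE; [| |].
- by apply: measurableI => //; exact: measurableI.
- exact: measurableI.
- by rewrite -setIA setICA; apply: subIsetr.
Qed.
End L2_space.

(** * Graph Laplacians and the incidence matrix *)

Section graph_laplacian.
Context {R : realType}.
Local Notation C := (R[i]).

(** The weighted graph Laplacian on the index set; the diagonal weights cancel. *)
Definition lap n (w : 'I_n -> 'I_n -> R) : 'M[C]_n :=
  \matrix_(i, j) ((i == j)%:R * (\sum_k (w i k)%:C) - (w i j)%:C).

Section weights.
Variables (n : nat) (w : 'I_n -> 'I_n -> R).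
Hypothesis w_sym : forall i j, w i j = w j i.
Hypothesis w_ge0 : forall i j, 0 <= w i j.

Lemma lapE (c : 'rV[C]_n) j :
  (c *m lap w) 0 j = \sum_k (w j k)%:C * (c 0 j - c 0 k).
Proof.
rewrite mxE; under eq_bigr do rewrite mxE mulrBr.
rewrite sumrB (bigD1 j) //= eqxx mul1r [X in _ + X - _]big1 ?addr0; last first.
  by move=> i ij; rewrite (negPf ij) mul0r mulr0.
rewrite mulr_sumr -sumrB; apply: eq_bigr => k _.
by rewrite (w_sym k) mulrBr ![c 0 _ * _]mulrC.
Qed.

Lemma lap_green (c d : 'rV[C]_n) : (c *m lap w *m d^t*) 0 0 =
  2^-1 * \sum_i \sum_j (w i j)%:C * ((c 0 i - c 0 j) * (d 0 i - d 0 j)^*).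
Proof.
have e : (c *m lap w *m d^t*) 0 0 =
    \sum_i \sum_j (w i j)%:C * ((c 0 i - c 0 j) * (d 0 i)^*).
  rewrite mxE; apply: eq_bigr => i _; rewrite lapE mulr_suml !mxE.
  by apply: eq_bigr => j _; rewrite mulrA.
have e' : (c *m lap w *m d^t*) 0 0 =
    \sum_i \sum_j (w i j)%:C * ((c 0 i - c 0 j) * - (d 0 j)^*).
  rewrite e exchange_big /=; apply: eq_bigr => i _; apply: eq_bigr => j _.
  by rewrite w_sym mulrN -mulNr opprB.
have two : (2 : C) != 0 by rewrite pnatr_eq0.
apply: (mulfI two); rewrite mulVKf // mulrDl mul1r {1}e e' -big_split /=.
apply: eq_bigr => i _; rewrite -big_split; apply: eq_bigr => j _ /=.
by rewrite -!mulrDr conjcB.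
Qed.

Lemma lap_herm : (lap w)^t* = lap w.
Proof.
apply/matrixP => i j; rewrite !mxE conjcB conjcM rmorph_nat conjc_sum conjc_real.
rewrite (w_sym j) eq_sym; congr (_ - _).
case: (eqVneq i j) => [->|ij]; last by rewrite !mul0r.
by congr (_ * _); apply: eq_bigr => k _; rewrite conjc_real.
Qed.

Lemma lap_quad (c : 'rV[C]_n) : (c *m lap w *m c^t*) 0 0 =
  (2^-1 * \sum_i \sum_j w i j * nsq (c 0 i - c 0 j))%:C.
Proof.
rewrite lap_green rmorphM /= fmorphV rmorph_nat; congr (_ * _).
rewrite rmorph_sum; apply: eq_bigr => i _; rewrite rmorph_sum; apply: eq_bigr => j _.
by rewrite mulcJ rmorphM.
Qed.

Lemma lap_psd (c : 'rV[C]_n) : 0 <= (c *m lap w *m c^t*) 0 0.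
Proof.
rewrite lap_quad ler0c mulr_ge0 ?invr_ge0 // sumr_ge0 // => i _.
by rewrite sumr_ge0 // => j _; rewrite mulr_ge0 ?nsq_ge0.
Qed.

(** The quadratic form is a sum of nonnegative terms, which all vanish on the
   kernel. *)
Lemma lap_null (c : 'rV[C]_n) i j : c *m lap w = 0 -> 0 < w i j -> c 0 i = c 0 j.
Proof.
move=> c0 wij; have := lap_quad c; rewrite c0 mul0mx mxE => /(congr1 (@complex.Re R)) /= /esym/eqP.
rewrite mulf_eq0 invr_eq0 pnatr_eq0 /= psumr_eq0 => [/allP h|k _]; last first.
  by rewrite sumr_ge0 // => l _; rewrite mulr_ge0 ?nsq_ge0.
have := h i (mem_index_enum _); rewrite /= psumr_eq0 => [/allP h'|k _]; last first.
  by rewrite mulr_ge0 ?nsq_ge0.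
have := h' j (mem_index_enum _); rewrite /= mulf_eq0 gt_eqF //= => /eqP/nsq_eq0/eqP.
by rewrite subr_eq0 => /eqP.
Qed.

(** Distinct cells over adjacent vertices are coupled. Two distinct cells of one
   vertex are compared through a cell of a neighbour, which exists since no vertex
   is isolated, whether or not the vertex carries a loop. The kernel thus depends
   on the graph alone and not on the number of cells. *)
Lemma lap_null_label (V : finType) (e : rel V) (lab : 'I_n -> V) (c : 'rV[C]_n) :
  symmetric e -> (forall v, exists u, e v u) -> (forall v, exists i, lab i = v) ->
  (forall i j, i != j -> e (lab i) (lab j) -> 0 < w i j) ->
  c *m lap w = 0 -> exists x : V -> C,
    (forall u v, e u v -> x u = x v) /\ forall i, c 0 i = x (lab i).
Proof.
move=> e_sym nb surj wpos c0.
have adj i j : e (lab i) (lab j) -> c 0 i = c 0 j.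
  have [->//|ij eij] := eqVneq i j.
  by apply: lap_null c0 _; exact: wpos.
have same i j : lab i = lab j -> c 0 i = c 0 j.
  move=> ij; have [u eu] := nb (lab i); have [k ku] := surj u; subst u.
  by rewrite (adj i k eu) (adj j k) // -ij.
have [r hr] := choice surj.
exists (fun v => c 0 (r v)); split=> [u v uv|i].
  by apply: adj; rewrite !hr.
by apply: same; rewrite hr.
Qed.
End weights.
End graph_laplacian.

Section incidence.
Context {V : finType} (e : rel V).
Hypothesis e_sym : symmetric e.

Local Notation m := #|edges (loopless e)|.

Lemma orientation : exists o : 'I_m -> V * V,
  [/\ forall i, (o i).1 != (o i).2, forall i, e (o i).1 (o i).2,
      forall i, enum_val i = [set (o i).1; (o i).2]%SET &
      forall u v, u != v -> e u v -> exists i, o i = (u, v) \/ o i = (v, u)].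
Proof.
have h (i : 'I_m) : exists o : V * V, [/\ o.1 != o.2, e o.1 o.2 &
    enum_val i = [set o.1; o.2]%SET].
  have := enum_valP i; rewrite inE => /existsP[u /existsP[v /andP[/andP[uv euv] /eqP ->]]].
  by exists (u, v).
have [ori ho] := choice h; exists ori; split; try by move=> i; have [] := ho i.
move=> u v uv euv.
have uvA : [set u; v]%SET \in edges (loopless e).
  by rewrite inE; apply/existsP; exists u; apply/existsP; exists v; rewrite /loopless uv euv eqxx.
exists (enum_rank_in uvA [set u; v]%SET).
have [] := ho (enum_rank_in uvA [set u; v]%SET).
rewrite enum_rankK_in //; case: (ori _) => a b /= ab _ /setP hs.
have := hs a; rewrite !inE eqxx /= => /orP[] /eqP au; subst a.
  have := hs b; rewrite !inE eqxx orbT => /orP[] /eqP bv; last by subst b; left.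
  by rewrite bv eqxx in ab.
have := hs b; rewrite !inE eqxx orbT => /orP[] /eqP bv; first by subst b; right.
by rewrite bv eqxx in ab.
Qed.

Context {R : realType}.
Local Notation C := (R[i]).
Variable o : 'I_m -> V * V.

Definition incidence : 'M[C]_(m, #|V|) :=
  \matrix_(i, k) ((enum_val k == (o i).1)%:R - (enum_val k == (o i).2)%:R).

Lemma incidence_sum (x : V -> C) i :
  \sum_k x (enum_val k) * incidence i k = x (o i).1 - x (o i).2.
Proof.
have h v : \sum_(k < #|V|) x (enum_val k) * (enum_val k == v)%:R = x v.
  rewrite (bigD1 (enum_rank v)) //= enum_rankK eqxx mulr1 big1 ?addr0 //.
  move=> k kv; case: eqP => [kv'|]; rewrite ?mulr0 //.
  by rewrite -kv' enum_valK eqxx in kv.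
by under eq_bigr do rewrite mxE mulrBr; rewrite sumrB !h.
Qed.

Hypothesis ho1 : forall i, e (o i).1 (o i).2.
Hypothesis ho2 : forall u v, u != v -> e u v -> exists i, o i = (u, v) \/ o i = (v, u).

Lemma incidence_ker (x : V -> C) :
  (\row_k x (enum_val k)) *m incidence^T = 0 <-> forall u v, e u v -> x u = x v.
Proof.
have h i : ((\row_k x (enum_val k)) *m incidence^T) 0 i = x (o i).1 - x (o i).2.
  by rewrite mxE -incidence_sum; apply: eq_bigr => k _; rewrite !mxE.
split=> [/rowP x0 u v uv|hx]; last first.
  by apply/rowP => i; rewrite h mxE (hx _ _ (ho1 i)) subrr.
have [->//|ne] := eqVneq u v; have [i hi] := ho2 ne uv.
have := x0 i; rewrite h mxE => /eqP; rewrite subr_eq0 => /eqP.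
by case: hi => ->.
Qed.
End incidence.

(** * Decomposition of the vertex sets into cells *)

Section cells.
Context {R : realType} {p : nat} {F : padicField R p}.
Hypothesis p_prime : prime p.
Context {V : finType}.
Variables (e : rel V) (U : V -> set (Qp F)).
Hypothesis U_adm : admissible_sets U.

Lemma U_disj v w x : U v x -> U w x -> v = w.
Proof.
move=> vx wx; have [//|ne] := eqVneq v w; have [_ disj _] := U_adm.
by have : (U v `&` U w) x by []; rewrite (disj _ _ ne).
Qed.

Lemma U_dist v w x y : v != w -> U v x -> U w y ->
  qabs (x - y) = set_dist (U v) (U w).
Proof. by have [_ _ h] := U_adm; move=> ne; exact: h. Qed.

Lemma U_neq v w x y : v != w -> U v x -> U w y -> x != y.
Proof.
move=> ne vx wy; apply/eqP => xy; move: ne; rewrite (U_disj vx (_ : U w x)) ?eqxx //.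
by rewrite xy.
Qed.

Lemma U_pt v : exists x, U v x.
Proof. by have [/(_ v)[[x ?] _ _] _ _] := U_adm; exists x. Qed.

Lemma set_dist_gt0 v w : v != w -> 0 < set_dist (U v) (U w).
Proof.
move=> ne; have [x vx] := U_pt v; have [y wy] := U_pt w.
by rewrite -(U_dist ne vx wy) qabs_gt0 subr_eq0 (U_neq ne vx wy).
Qed.

Lemma U_open v : open (U v). Proof. by have [/(_ v)[]] := U_adm. Qed.
Lemma U_measurable v : measurable (U v).
Proof. by apply: open_measurable_Qp; exact: U_open. Qed.

Lemma OmVE : OmV U = \big[setU/set0]_v U v.
Proof.
rewrite -bigcup_seq; apply/seteqP; split => x; last by move=> [v _ h]; exists v.
by move=> [v h]; exists v => //=; rewrite mem_index_enum.
Qed.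

Lemma OmV_compact : compact (OmV U).
Proof. by rewrite OmVE; apply: bigsetU_compact => v _; have [/(_ v)[]] := U_adm. Qed.

Lemma OmV_measurable : measurable (OmV U).
Proof. by rewrite OmVE; apply: bigsetU_measurable => v _; exact: U_measurable. Qed.

Lemma OmEE : OmE e U = \big[setU/set0]_(vw : V * V | e vw.1 vw.2) (U vw.1 `*` U vw.2).
Proof.
rewrite -bigcup_seq_cond; apply/seteqP; split => z.
  by move=> [v [w [vw h1 h2]]]; exists (v, w) => //=; rewrite mem_index_enum vw.
by move=> [[v w] /= /andP[_ vw] [h1 h2]]; exists v, w.
Qed.

Lemma OmE_measurable : measurable (OmE e U).
Proof.
rewrite OmEE; apply: bigsetU_measurable => -[v w] _ /=.
by apply: measurableX; exact: U_measurable.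
Qed.

Record level_data (l n : nat) (c : 'I_n -> Qp F) (lab : 'I_n -> V) : Prop := {
  ld_U : forall i, disc l (c i) `<=` U (lab i);
  ld_cov : forall x, OmV U x -> exists i, disc l (c i) x;
  ld_inj : forall i j, disc l (c i) (c j) -> i = j }.

Lemma uniform_disc : exists l0, forall l v x, (l0 <= l)%N -> U v x -> disc l x `<=` U v.
Proof.
pose P l : set (Qp F) := [set x | exists v, disc l x `<=` U v].
have [l0 h0] : exists l0, OmV U `<=` P l0.
  apply: (compact_uniform p_prime OmV_compact).
  - move=> l k x lk [v hv]; exists v; apply: subset_trans hv; exact: disc_le.
  - by move=> l x y [v hv] xy; exists v; rewrite (disc_eq xy).
  - move=> x [v vx]; have := @U_open v; rewrite openE => /(_ x vx)/(nbhs_disc p_prime)[l hl].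
    by exists l, v.
exists l0 => l v x l0l vx; have [w hw] := h0 x (ex_intro _ v vx).
rewrite (U_disj vx (hw _ (disc_center p_prime l0 x))).
by apply: subset_trans hw; exact: disc_le.
Qed.

(** Compactness gives a finite cover by discs; one of minimal size is a
   decomposition, since two discs of one radius are equal or disjoint. *)
Lemma level_exists : exists l0, forall l, (l0 <= l)%N ->
  exists n (c : 'I_n -> Qp F) (lab : 'I_n -> V), level_data l c lab.
Proof.
have [l0 h0] := uniform_disc; exists l0 => l l0l.
have [s [sO cov]] := compact_disc_cover p_prime l OmV_compact.
pose fine_cover (t : seq (Qp F)) := {subset t <= OmV U} /\
  forall x, OmV U x -> exists2 a, a \in t & disc l a x.
(* a covering family of least cardinal has no repeated disc *)
have exm : exists m, `[< exists t : seq (Qp F), fine_cover t /\ size t = m >].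
  by exists (size s); apply/asboolP; exists s.
case: (ex_minnP exm) => m /asboolP[t [[tO tcov] tm]] mmin.
have tP i : OmV U (tnth (in_tuple t) i) by apply/set_mem/tO/mem_tnth.
have lab_ex i : exists v, U v (tnth (in_tuple t) i) by have [v] := tP i; exists v.
have [lab hlab] := choice lab_ex.
exists (size t), (tnth (in_tuple t)), lab; split.
- by move=> i; apply: h0.
- by move=> x /tcov[a /(tnthP (in_tuple t))[i ->] ax]; exists i.
move=> i j ij; have [//|ne] := eqVneq i j; exfalso.
pose t' := [seq tnth (in_tuple t) k | k <- enum 'I_(size t) & k != j].
have : (m <= size t')%N.
  apply: mmin; apply/asboolP; exists t'; split=> //; split.
    by move=> a /mapP[k _ ->]; apply: tO; exact: mem_tnth.
  move=> x /tcov[a /(tnthP (in_tuple t))[k ->] ax].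
  have [kj|kj] := eqVneq k j.
    exists (tnth (in_tuple t) i); first by apply: map_f; rewrite mem_filter ne mem_enum.
    by rewrite -(disc_eq ij) -kj.
  by exists (tnth (in_tuple t) k) => //; apply: map_f; rewrite mem_filter kj mem_enum.
apply/negP; rewrite -ltnNge -tm size_map size_filter.
rewrite -[X in (_ < X)%N](size_enum_ord (size t)) ltn_neqAle count_size andbT -all_count.
by apply/allPn; exists j; rewrite ?mem_enum // negbK eqxx.
Qed.

Section level.
Variables (l n : nat) (c : 'I_n -> Qp F) (lab : 'I_n -> V).
Hypothesis ld : level_data l c lab.

Lemma cell_uniq i j x : disc l (c i) x -> disc l (c j) x -> i = j.
Proof.
move=> ix jx; apply: (ld_inj ld); rewrite -(disc_eq ix) (disc_eq jx).
exact: disc_center.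
Qed.

Lemma cell_OmV i : disc l (c i) `<=` OmV U.
Proof. by move=> x /(ld_U ld) h; exists (lab i). Qed.

Lemma c_OmV i : OmV U (c i).
Proof. by apply: cell_OmV; exact: disc_center. Qed.

Lemma cell_lab i x v : disc l (c i) x -> U v x -> v = lab i.
Proof. by move=> /(ld_U ld) h vx; exact: U_disj vx h. Qed.

Lemma lab_surj v : exists i, lab i = v.
Proof.
have [x vx] := U_pt v; have [i ix] := ld_cov ld (ex_intro _ v vx).
by exists i; rewrite (cell_lab ix vx).
Qed.

Lemma cell_dist i j x y : i != j -> disc l (c i) x -> disc l (c j) y ->
  qabs (x - y) = qabs (c i - c j).
Proof.
move=> ij ix jy.
have nj a : disc l (c i) a -> ~ disc l (c j) a.
  by move=> ia ja; move: ij; rewrite (cell_uniq ia ja) eqxx.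
have -> : qabs (x - y) = qabs (c i - y).
  by apply: (disc_out (l := l)) => // iy; move: (nj _ iy).
rewrite qabsBC [RHS]qabsBC; apply: (disc_out (l := l)) => // .
by apply: nj; exact: disc_center.
Qed.

Lemma cell_dist_gt0 i j : i != j -> 0 < qabs (c i - c j).
Proof.
move=> ij; rewrite qabs_gt0 subr_eq0; apply/eqP => cij.
move: ij; rewrite (ld_inj ld (i := i) (j := j)) ?eqxx // cij; exact: disc_center.
Qed.

Lemma cell_set_dist i j : i != j ->
  set_dist (disc l (c i)) (disc l (c j)) = qabs (c i - c j).
Proof.
move=> ij; rewrite /set_dist (_ : [set r | _] = [set qabs (c i - c j)]) ?inf1 //.
apply/seteqP; split => r /=.
  by move=> [x [y [ix jy ->]]]; exact: cell_dist.
by move=> ->; exists (c i), (c j); split; try exact: disc_center.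
Qed.

Lemma discsP B : discs U l B <-> exists i, B = disc l (c i).
Proof.
split=> [[[a ->] aO]|[i ->]]; last first.
  by split; [exists (c i)|exact: cell_OmV].
have [i ia] := ld_cov ld (aO _ (disc_center p_prime l a)).
by exists i; rewrite -(disc_eq ia).
Qed.

Lemma cell_inj i j : disc l (c i) = disc l (c j) -> i = j.
Proof.
by move=> h; apply: (ld_inj ld); rewrite h; exact: disc_center.
Qed.

Lemma cell_OmE i j : disc l (c i) `*` disc l (c j) `<=` OmE e U <-> e (lab i) (lab j).
Proof.
split=> [h|eij [x y] /= [ix jy]]; last first.
  by exists (lab i), (lab j); split => //=; exact: (ld_U ld).
have /h[v [w [vw /= vi wj]]] : (disc l (c i) `*` disc l (c j)) (c i, c j).
  by split; exact: disc_center.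
by rewrite -(cell_lab (disc_center p_prime l (c i)) vi)
  -(cell_lab (disc_center p_prime l (c j)) wj).
Qed.

Lemma sum_cells (a : 'I_n -> R[i]) i x : disc l (c i) x ->
  \sum_j a j * cind (disc l (c j)) x = a i.
Proof.
move=> ix; rewrite (bigD1 i) //= /cind indicE mem_set // mulr1 big1 ?addr0 //.
move=> j ji; rewrite indicE memNset ?mulr0 // => jx.
by move: ji; rewrite (cell_uniq jx ix) eqxx.
Qed.

Lemma sum_cells_out (a : 'I_n -> R[i]) x : ~ OmV U x ->
  \sum_j a j * cind (disc l (c j)) x = 0.
Proof.
move=> xO; rewrite big1 // => j _; rewrite /cind indicE memNset ?mulr0 // => jx.
by apply: xO; exact: cell_OmV jx.
Qed.

(** [u] is a step function, with the values [a] on the cells. *)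
Definition rep (a : 'I_n -> R[i]) (u : Qp F -> R[i]) :=
  forall i x, disc l (c i) x -> u x = a i.

Lemma rep_sum a u : rep a u ->
  forall x, OmV U x -> u x = \sum_j a j * cind (disc l (c j)) x.
Proof. by move=> h x /(ld_cov ld)[i ix]; rewrite (h _ _ ix) (sum_cells _ ix). Qed.

Lemma rep_locally_constant a u : rep a u -> locally_constant U u.
Proof.
move=> h x /(ld_cov ld)[i ix]; apply/(nbhs_disc p_prime); exists l => y xy _.
by rewrite (h i x ix); apply: h; rewrite -(disc_eq ix).
Qed.
End level.

Lemma locally_constant_uniform u : locally_constant U u ->
  exists l1, forall l x y, (l1 <= l)%N -> OmV U x -> OmV U y -> disc l x y -> u y = u x.
Proof.
move=> lcu; pose P l : set (Qp F) := [set x | forall y z, OmV U y -> OmV U z ->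
  disc l x y -> disc l x z -> u y = u z].
have [l1 h1] : exists l1, OmV U `<=` P l1.
  apply: (compact_uniform p_prime OmV_compact).
  - by move=> l k x lk h y z yO zO /(disc_le p_prime lk) xy /(disc_le p_prime lk); exact: h.
  - by move=> l x y h xy z t; rewrite (disc_eq xy); exact: h.
  - move=> x xO; have /(nbhs_disc p_prime)[l hl] := lcu x xO.
    by exists l => y z yO zO /hl/(_ yO) -> /hl/(_ zO) ->.
exists l1 => l x y l1l xO yO /(disc_le p_prime l1l) xy.
by apply: (h1 x xO) => //; exact: disc_center.
Qed.

End cells.

(** * Gradient and divergence on step functions *)

Section step_integral.
Context {d} {T : measurableType d} {R : realType}.
Variables (mu : {measure set T -> \bar R}) (D : set T).
Hypothesis mD : measurable D.

Lemma cintegral_step (I : finType) (P : I -> set T) (a : I -> R[i]) (f : T -> R[i]) :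
  (forall j, measurable (P j)) -> (forall j, (mu (P j) < +oo)%E) ->
  (forall j, a j != 0 -> P j `<=` D) ->
  (forall x, D x -> f x = \sum_j a j * cind (P j) x) ->
  cintegral mu D f = \sum_j a j * (fine (mu (P j)))%:C.
Proof.
move=> mP fP PD fE.
have fin j : (mu (P j `&` D) < +oo)%E.
  by apply: le_lt_trans (fP j); apply: le_measure; rewrite ?inE //; try exact: measurableI.
rewrite (eq_cintegral mu (g := lincomb (index_enum I) a (fun j => cind (P j)))) //.
rewrite (cintegral_lincomb mD) => [|j]; last exact: cind_cint.
apply: eq_bigr => j _; have [->|aj] := eqVneq (a j) 0; first by rewrite !mul0r.
by rewrite cintegral_cind // (setIidl (PD _ aj)).
Qed.

Lemma L2_step (I : finType) (P : I -> set T) (a : I -> R[i]) (f : T -> R[i]) :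
  (forall j, measurable (P j)) -> (forall j, (mu (P j) < +oo)%E) ->
  (forall x, D x -> f x = \sum_j a j * cind (P j) x) -> L2 mu D f.
Proof.
move=> mP fP fE.
have h j : L2 mu D (cind (P j)).
  apply: cind_L2 => //.
  by apply: le_lt_trans (fP j); apply: le_measure; rewrite ?inE //; try exact: measurableI.
have := H_lincomb (L2_pre_hilbert mu mD) (index_enum I) a h.
by apply: eq_L2 => x /fE ->.
Qed.
End step_integral.

Section operators_on_cells.
Context {R : realType} {p : nat} {F : padicField R p}.
Hypothesis p_prime : prime p.
Variable mu : {sigma_finite_measure set (Qp F) -> \bar R}.
Hypothesis mu_haar : is_haar mu.
Context {V : finType}.
Variables (e : rel V) (U : V -> set (Qp F)) (alpha : R).
Hypothesis e_sym : symmetric e.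
Hypothesis U_adm : admissible_sets U.
Hypothesis alpha_gt0 : 0 < alpha.

Lemma mu2_prod (A B : set (Qp F)) : measurable A -> measurable B ->
  mu2 mu (A `*` B) = (mu A * mu B)%E.
Proof. by move=> mA mB; exact: product_measure1E. Qed.

Lemma nbr_measurable v : measurable [set y | exists2 w, e v w & U w y].
Proof.
rewrite (_ : mkset _ = \big[setU/set0]_(w | e v w) U w).
  by apply: bigsetU_measurable => w _; exact: U_measurable.
rewrite -bigcup_seq_cond; apply/seteqP; split => y.
  by move=> [w vw wy]; exists w => //=; rewrite mem_index_enum.
by move=> [w /= /andP[_ vw] wy]; exists w.
Qed.

Lemma nbrE v x : U v x ->
  [set y | OmV U y /\ OmE e U (x, y)] = [set y | exists2 w, e v w & U w y].
Proof.
move=> vx; apply/seteqP; split => y /=.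
  by move=> [_ [v' [w [vw /= vx' wy]]]]; exists w; rewrite // (U_disj U_adm vx vx').
by move=> [w vw wy]; split; [exists w|exists v, w].
Qed.

Section level.
Variables (l n : nat) (c : 'I_n -> Qp F) (lab : 'I_n -> V).
Hypothesis ld : level_data U l c lab.

(** Zero for a cell paired with itself: inside a cell the distance is not constant,
   but there a step function has zero differences. *)
Definition cell_kernel i j : R :=
  if (i != j) && e (lab i) (lab j) then qabs (c i - c j) `^ (- alpha) else 0.

Lemma cell_kernel_sym i j : cell_kernel i j = cell_kernel j i.
Proof. by rewrite /cell_kernel eq_sym e_sym qabsBC. Qed.

Lemma cell_kernel_gt0 i j : i != j -> e (lab i) (lab j) -> 0 < cell_kernel i j.
Proof.
move=> ij eij; rewrite /cell_kernel ij eij /= powR_gt0 //.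
exact: (cell_dist_gt0 p_prime ld).
Qed.

(** The factor 1/2 comes from the gradient, and the power of [p] is the measure of
   the cell over which the divergence integrates. *)
Definition cell_wt i j : R := 2^-1 * cell_kernel i j ^+ 2 * p%:R ^- l.

Lemma cell_wt_sym i j : cell_wt i j = cell_wt j i. Proof. by rewrite /cell_wt cell_kernel_sym. Qed.
Lemma cell_wt_ge0 i j : 0 <= cell_wt i j.
Proof.
apply: mulr_ge0; last exact: ltW (pXV_gt0 p_prime l).
by apply: mulr_ge0; [rewrite invr_ge0|exact: sqr_ge0].
Qed.
Lemma cell_wt_gt0 i j : i != j -> e (lab i) (lab j) -> 0 < cell_wt i j.
Proof.
move=> ij eij; apply: mulr_gt0; last exact: pXV_gt0.
by apply: mulr_gt0; [rewrite invr_gt0|rewrite exprn_gt0 // cell_kernel_gt0].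
Qed.

Lemma cell_measurable j : measurable (disc l (c j)).
Proof. exact: disc_measurable. Qed.
Lemma cell_fin j : (mu (disc l (c j)) < +oo)%E.
Proof. by rewrite mu_disc // ltry. Qed.
Lemma cell_mu j : fine (mu (disc l (c j))) = p%:R ^- l.
Proof. by rewrite mu_disc. Qed.

Lemma grad_cell a u i j x y : rep l c a u -> disc l (c i) x -> disc l (c j) y ->
  e (lab i) (lab j) -> grad alpha u (x, y) = (a i - a j) * (2^-1 * cell_kernel i j)%:C.
Proof.
move=> ru ix jy eij; rewrite /grad /= (ru i x ix) (ru j y jy).
have [->|ij] := eqVneq i j; first by rewrite subrr !mul0r.
rewrite (cell_dist p_prime ld ij ix jy) /cell_kernel ij eij /=.
by rewrite powRN -invfM fmorphV.
Qed.

Lemma div_cell a u i x : rep l c a u -> disc l (c i) x ->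
  div mu e U alpha (grad alpha u) x = \sum_j (cell_wt i j)%:C * (a i - a j).
Proof.
move=> ru ix; have vx : U (lab i) x by exact: (ld_U ld).
rewrite /div (nbrE vx).
rewrite (cintegral_step (nbr_measurable (lab i)) (P := fun j => disc l (c j))
  (a := fun j => (2^-1 * cell_kernel i j ^+ 2)%:C * (a i - a j))).
- by apply: eq_bigr => j _; rewrite cell_mu /cell_wt mulrAC -rmorphM.
- exact: cell_measurable.
- exact: cell_fin.
- move=> j h y jy; exists (lab j); last exact: (ld_U ld).
  apply: contraNT h => nij; rewrite /cell_kernel (negPf nij) andbF expr0n mulr0.
  by rewrite [_%:C]rmorph0 mul0r.
move=> y [w vw wy]; have [j jy] := ld_cov ld (ex_intro _ w wy).
have eij : e (lab i) (lab j) by rewrite -(cell_lab U_adm ld jy wy).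
rewrite (sum_cells p_prime ld _ jy) (grad_cell ru ix jy eij).
have [->|ij] := eqVneq i j; first by rewrite subrr !mul0r mulr0.
rewrite (cell_dist p_prime ld ij ix jy) /cell_kernel ij eij /= -mulrA -rmorphM /=.
by rewrite mulrC -mulrA expr2.
Qed.

Lemma cell2_measurable (ij : 'I_n * 'I_n) :
  measurable (disc l (c ij.1) `*` disc l (c ij.2)).
Proof. by apply: measurableX; exact: cell_measurable. Qed.

Lemma cell2_mu (ij : 'I_n * 'I_n) :
  mu2 mu (disc l (c ij.1) `*` disc l (c ij.2)) = (p%:R ^- l * p%:R ^- l)%:E.
Proof.
by rewrite mu2_prod; [rewrite !mu_disc|exact: cell_measurable|exact: cell_measurable].
Qed.

Lemma cind_prod (A B : set (Qp F)) x y : cind (R := R) (A `*` B) (x, y) = cind A x * cind B y.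
Proof.
rewrite /cind -rmorphM /= !indicE; congr (_%:C); rewrite -natrM mulnb.
by congr (_%:R); congr nat_of_bool; rewrite in_setX.
Qed.

Lemma cell2_sum (g : 'I_n -> 'I_n -> R[i]) i j x y : disc l (c i) x -> disc l (c j) y ->
  \sum_ij g ij.1 ij.2 * cind (disc l (c ij.1) `*` disc l (c ij.2)) (x, y) = g i j.
Proof.
move=> ix jy; under eq_bigr do rewrite cind_prod mulrA.
rewrite -(pair_bigA _ (fun i j => g i j * cind (disc l (c i)) x * cind (disc l (c j)) y)) /=.
under eq_bigr do rewrite (sum_cells p_prime ld (fun j => g _ j * cind (disc l (c _)) x) jy).
exact: (sum_cells p_prime ld (fun i => g i j) ix).
Qed.

Lemma grad_sum a u x y : rep l c a u -> OmE e U (x, y) -> grad alpha u (x, y) =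
  \sum_ij ((a ij.1 - a ij.2) * (2^-1 * cell_kernel ij.1 ij.2)%:C) *
     cind (disc l (c ij.1) `*` disc l (c ij.2)) (x, y).
Proof.
move=> ru [v [w [vw /= vx wy]]].
have [i ix] := ld_cov ld (ex_intro _ v vx); have [j jy] := ld_cov ld (ex_intro _ w wy).
rewrite (cell2_sum (fun i j => (a i - a j) * (2^-1 * cell_kernel i j)%:C) ix jy).
apply: grad_cell => //.
by rewrite -(cell_lab U_adm ld ix vx) -(cell_lab U_adm ld jy wy).
Qed.

Lemma grad_L2 a u : rep l c a u -> L2 (mu2 mu) (OmE e U) (grad alpha u).
Proof.
move=> ru; apply: (L2_step (OmE_measurable e U_adm)
  (P := fun ij : 'I_n * 'I_n => disc l (c ij.1) `*` disc l (c ij.2))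
  (a := fun ij => (a ij.1 - a ij.2) * (2^-1 * cell_kernel ij.1 ij.2)%:C)).
- exact: cell2_measurable.
- by move=> ij; rewrite cell2_mu ltry.
- by move=> [x y] /(grad_sum ru).
Qed.

Lemma grad_ip a u b w : rep l c a u -> rep l c b w ->
  L2ip (mu2 mu) (OmE e U) (grad alpha u) (grad alpha w) =
  (p%:R ^- l)%:C *
  (2^-1 * \sum_i \sum_j (cell_wt i j)%:C * ((a i - a j) * (b i - b j)^*)).
Proof.
move=> ru rw; rewrite /L2ip (cintegral_step (OmE_measurable e U_adm)
  (P := fun ij : 'I_n * 'I_n => disc l (c ij.1) `*` disc l (c ij.2))
  (a := fun ij => ((a ij.1 - a ij.2) * (b ij.1 - b ij.2)^*) *
      ((2^-1 * cell_kernel ij.1 ij.2)^+2)%:C)).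
- rewrite -(pair_bigA _ (fun i j => (a i - a j) * (b i - b j)^* *
      ((2^-1 * cell_kernel i j)^+2)%:C * (fine (mu2 mu (disc l (c i) `*` disc l (c j))))%:C)) /=.
  rewrite !mulr_sumr; apply: eq_bigr => i _; rewrite !mulr_sumr.
  apply: eq_bigr => j _; rewrite (cell2_mu (i, j)) /=.
  have -> : (2^-1 : R[i]) = (2^-1 : R)%:C by rewrite fmorphV rmorph_nat.
  set z := _ * _^*; rewrite -mulrA -rmorphM mulrC.
  rewrite !mulrA -!rmorphM; congr (_ * _ * _); apply: complex_ext => //=; rewrite /cell_wt; ring.
- exact: cell2_measurable.
- by move=> ij; rewrite cell2_mu ltry.
- move=> [i j] /= h; apply/(cell_OmE p_prime e U_adm ld).
  apply: contraNT h => nij; rewrite /cell_kernel (negPf nij) andbF mulr0 expr0n.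
  by rewrite [_%:C]rmorph0 mulr0.
move=> [x y] [v [w' [vw /= vx wy]]].
have [i ix] := ld_cov ld (ex_intro _ v vx); have [j jy] := ld_cov ld (ex_intro _ w' wy).
have eij : e (lab i) (lab j).
  by rewrite -(cell_lab U_adm ld ix vx) -(cell_lab U_adm ld jy wy).
rewrite (cell2_sum (fun i j => (a i - a j) * (b i - b j)^* * ((2^-1 * cell_kernel i j)^+2)%:C) ix jy).
rewrite (grad_cell ru ix jy eij) (grad_cell rw ix jy eij) conjcM conjc_real.
by rewrite mulrACA -rmorphM.
Qed.

Lemma rep_L2 a u : rep l c a u -> L2 mu (OmV U) u.
Proof.
move=> ru; apply: (L2_step (OmV_measurable U_adm) (P := fun j => disc l (c j)) (a := a)).
- exact: cell_measurable.
- exact: cell_fin.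
- exact: (rep_sum p_prime ld).
Qed.

Lemma rep_ip a u b w : rep l c a u -> rep l c b w ->
  L2ip mu (OmV U) u w = (p%:R ^- l)%:C * \sum_i a i * (b i)^*.
Proof.
move=> ru rw; rewrite /L2ip (cintegral_step (OmV_measurable U_adm)
  (P := fun j => disc l (c j)) (a := fun i => a i * (b i)^*)).
- by rewrite mulr_sumr; apply: eq_bigr => j _; rewrite cell_mu mulrC.
- exact: cell_measurable.
- exact: cell_fin.
- by move=> j _ x; exact: (cell_OmV ld).
move=> x /(ld_cov ld)[i ix].
by rewrite (ru _ _ ix) (rw _ _ ix) (sum_cells p_prime ld (fun i => a i * (b i)^*) ix).
Qed.

(** All cells of a level have the same measure, so counting cells measures sets. *)
Lemma mu_cells (A : set (Qp F)) : measurable A ->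
  (forall i, disc l (c i) `<=` A \/ disc l (c i) `&` A = set0) -> A `<=` OmV U ->
  mu A = ((\sum_(i | `[< disc l (c i) `<=` A >]) p%:R ^- l)%:E : \bar R).
Proof.
move=> mA hA AO.
have AE : A = \big[setU/set0]_(i | `[< disc l (c i) `<=` A >]) disc l (c i).
  rewrite -bigcup_seq_cond; apply/seteqP; split => x.
    move=> xA; have [i ix] := ld_cov ld (AO _ xA); exists i => //=.
    rewrite mem_index_enum /=; apply/asboolP; case: (hA i) => // h0.
    by have : (disc l (c i) `&` A) x by []; rewrite h0.
  by move=> [i /= /andP[_ /asboolP iA] ix]; exact: iA.
rewrite {1}AE measure_bigsetU_ord; last 2 first.
- by move=> i; exact: cell_measurable.
- by move=> i j _ _ [x [ix jx]]; exact: (cell_uniq p_prime ld ix jx).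
rewrite (eq_bigr (fun=> (p%:R ^- l)%:E)); last by move=> i _; exact: mu_disc.
by rewrite sumEFin.
Qed.
End level.
End operators_on_cells.

(** * Density in L^2 *)

Section L2_density.
Context {d} {T : measurableType d} {R : realType}.
Variables (mu : {measure set T -> \bar R}) (D : set T).
Hypothesis mD : measurable D.
Hypothesis fD : (mu D < +oo)%E.
Local Notation ph := (L2_pre_hilbert mu mD).
Local Notation q := (sqnorm (L2ip mu D)).
Variable K : set (T -> R[i]).
Hypothesis K0 : K (fun=> 0).
Hypothesis Klin : forall a f g, K f -> K g -> K (fun x => a * f x + g x).
Hypothesis KL2 : K `<=` L2 mu D.

Definition L2_closure : set (T -> R[i]) := [set f | L2 mu D f /\
  forall eps : R, 0 < eps -> exists2 k, K k & q (fun x => f x - k x) < eps].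

Lemma L2_closure_lin a f g : L2_closure f -> L2_closure g ->
  L2_closure (fun x => a * f x + g x).
Proof.
move=> [Lf hf] [Lg hg]; split; first exact: (ph_lin ph).
move=> eps e0; have A0 : 0 < 4 * (nsq a + 1) by rewrite mulr_gt0 // ltr_wpDl // nsq_ge0.
have [k Kk hk] := hf (eps / (4 * (nsq a + 1))) (divr_gt0 e0 A0).
have [k' Kk' hk'] := hg (eps / 4) (divr_gt0 e0 (ltr0n _ 4)).
exists (fun x => a * k x + k' x); first exact: Klin.
have Lk := KL2 Kk; have Lk' := KL2 Kk'.
have L1 := H_sub ph Lf Lk; have L2' := H_sub ph Lg Lk'.
have := q_add_le ph (H_scale ph a L1) L2'; rewrite (q_scale ph) //.
rewrite (_ : (fun x => a * f x + g x - _) = (fun x => a * (f x - k x) + (g x - k' x))); last first.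
  by apply/funext => x; ring.
move=> /le_lt_trans; apply; rewrite mulrDr.
have h1 : 2 * (nsq a * q (fun x => f x - k x)) <= eps / 2.
  have := ltW hk; rewrite ler_pdivlMr // => h; have := q_ge0 ph L1; have := nsq_ge0 a.
  by nra.
by lra.
Qed.

Lemma L2_closure0 : L2_closure (fun=> 0).
Proof.
split; first exact: (ph_zero ph).
move=> eps e0; exists (fun=> 0) => //.
by rewrite (_ : (fun x => _) = fun=> 0) ?(q_zero ph) //; apply/funext => x; rewrite subr0.
Qed.

Lemma L2_closure_limit f : L2 mu D f ->
  (forall eps : R, 0 < eps -> exists2 g, L2_closure g & q (fun x => f x - g x) < eps) ->
  L2_closure f.
Proof.
move=> Lf h; split => // eps e0.
have e4 : 0 < eps / 4 by rewrite divr_gt0.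
have [g [Lg hg] fg] := h _ e4; have [k Kk gk] := hg _ e4.
exists k => //; have Lk := KL2 Kk.
have := q_add_le ph (H_sub ph Lf Lg) (H_sub ph Lg Lk).
rewrite (_ : (fun x => _) = (fun x => f x - k x)); last by apply/funext => x; rewrite subrKA.
by move=> /le_lt_trans; apply; lra.
Qed.

Lemma L2_closure_eq f g : (forall x, D x -> f x = g x) -> L2_closure f -> L2_closure g.
Proof.
move=> fg [Lf hf]; split; first exact: (eq_L2 fg Lf).
move=> eps /hf[k Kk hk]; exists k => //.
by rewrite -(eq_q mu (f := fun x => f x - k x)) // => x /fg ->.
Qed.

Lemma L2_closure_lincomb I (s : seq I) c (F : I -> T -> R[i]) :
  (forall i, L2_closure (F i)) -> L2_closure (lincomb s c F).
Proof.
move=> h; elim: s => [|i s IH].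
  by move: L2_closure0; congr L2_closure; apply/funext => x; rewrite /lincomb big_nil.
have := L2_closure_lin (c i) (h i) IH; congr L2_closure; apply/funext => x.
by rewrite /lincomb big_cons.
Qed.

Let fI A : measurable A -> (mu (A `&` D) < +oo)%E.
Proof.
by move=> mA; apply: le_lt_trans fD; apply: le_measure; rewrite ?inE //; exact: measurableI.
Qed.

(** By continuity of the measure from below, indicators of an increasing sequence
   converge in the square mean. *)
Lemma L2_closure_ndset (A : (set T)^nat) : nondecreasing_seq A ->
  (forall n, measurable (A n)) -> (forall n, L2_closure (cind (A n))) ->
  L2_closure (cind (\bigcup_n A n)).
Proof.
move=> ndA mA hA; have mU : measurable (\bigcup_n A n) by exact: bigcupT_measurable.
apply: L2_closure_limit; first exact: cind_L2 (fI _).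
move=> eps e0.
have cv : mu (A n `&` D) @[n --> \oo] --> mu ((\bigcup_n A n) `&` D).
  rewrite setI_bigcupl; apply: nondecreasing_cvg_mu.
  - by move=> n; exact: measurableI.
  - by apply: bigcupT_measurable => n; exact: measurableI.
  - by move=> m n mn; apply/subsetPset; apply: setSI; apply/subsetPset; exact: ndA.
have fU := fI mU; have finU : mu ((\bigcup_n A n) `&` D) \is a fin_num.
  by rewrite ge0_fin_numE.
have fin n : mu (A n `&` D) \is a fin_num by rewrite ge0_fin_numE // fI.
have cvr : fine (mu (A n `&` D)) @[n --> \oo] --> fine (mu ((\bigcup_n A n) `&` D)).
  by apply: fine_cvg; rewrite fineK.
have /cvgrPdist_lt/(_ _ e0)[N _ hN] := cvr.
exists (cind (A N)) => //; have {hN} := hN N (leqnn N) => /=.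
have LU := cind_L2 mD mU fU; have LN := cind_L2 mD (mA N) (fI (mA N)).
rewrite (q_sub ph) // /sqnorm !ip_cind // ?fI //= !setIid.
have sub : A N `<=` \bigcup_n A n by exact: bigcup_sup.
rewrite (setIidr sub); set x := fine _; set y := fine _.
by move=> /(le_lt_trans (ler_norm _)); lra.
Qed.

Hypothesis all_sets : forall A, measurable A -> L2_closure (cind A).

Import HBNNSimple.

Lemma L2_closure_nnsfun (g : {nnsfun T >-> R}) : L2_closure (fun x => (g x)%:C).
Proof.
have := L2_closure_lincomb (fset_set (range g)) (fun r => r%:C)
  (fun r => all_sets (measurable_funPTI g (measurable_set1 r))).
congr L2_closure; apply/funext => x; rewrite /lincomb fimfunE fsbig_finite //=.
rewrite rmorph_sum; apply: eq_bigr => r _.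
by rewrite /cind -rmorphM.
Qed.

(** Simple functions increase to [u], and [u ^+ 2] dominates the squared errors. *)
Lemma L2_closure_nneg (u : T -> R) : (forall x, D x -> 0 <= u x) ->
  sq_rint mu D u -> L2_closure (fun x => (u x)%:C).
Proof.
move=> u0 [mu_ iu].
have Lr (v : T -> R) : sq_rint mu D v -> L2 mu D (fun x => (v x)%:C).
  move=> hv; apply/(L2P mu mD); split=> //; split; first exact: measurable_cst.
  have := integrable0 mu D; congr (integrable _ _ _); apply/funext => x /=; by rewrite expr0n.
apply: L2_closure_limit; first exact: Lr.
have mEu : measurable_fun D (EFin \o u) by apply/measurable_EFinP.
pose g n := nnsfun_approx mD mEu n.
have nd x m n : (m <= n)%N -> g m x <= g n x.
  by move=> mn; have /lefP := nd_nnsfun_approx mD mEu mn; apply.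
have cvg_g x : D x -> g n x @[n --> \oo] --> u x.
  move=> Dx; have := cvg_nnsfun_approx mD mEu (fun x Dx => u0 x Dx) Dx.
  by move=> /fine_cvg.
have gu n x : D x -> g n x <= u x.
  move=> Dx; have ndg : nondecreasing_seq (g^~ x) by move=> i j; exact: nd.
  rewrite -(cvg_lim _ (cvg_g x Dx)) //; apply: nondecreasing_cvgn_le => //.
  by apply/cvg_ex; exists (u x); exact: cvg_g.
have cv : (\int[mu]_(x in D) ((u x - g n x) ^+ 2)%:E @[n --> \oo] --> \int[mu]_(x in D) 0)%E.
  have m1 n : measurable_fun D (fun x => ((u x - g n x) ^+ 2)%:E).
    apply/measurable_EFinP; apply: measurable_funX; apply: measurable_funB => //.
    by apply: measurable_funTS; exact: measurable_funP.
  have m2 : measurable_fun D (fun=> 0%E : \bar R) by exact: measurable_cst.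
  have c1 : {ae mu, forall x, D x -> ((u x - g n x) ^+ 2)%:E @[n --> \oo] --> 0%E}.
    apply: aeW => x Dx; apply/fine_cvgP; split; first exact: nearW.
    have := cvgM (cvgB (cvg_cst (u x)) (cvg_g x Dx)) (cvgB (cvg_cst (u x)) (cvg_g x Dx)).
    by rewrite subrr mulr0 => h; apply: h.
  have c2 : {ae mu, forall x n, D x -> (`|((u x - g n x) ^+ 2)%:E| <= (u x ^+ 2)%:E)%E}.
    apply: aeW => x n Dx; rewrite gee0_abs ?lee_fin ?sqr_ge0 //.
    by rewrite ler_sqr ?nnegrE ?u0 ?subr_ge0 ?gu // gerBl fun_ge0.
  by have [_ _] := dominated_convergence mD m1 m2 c1 iu c2.
rewrite integral0 in cv.
move=> eps e0; have Lg n : L2 mu D (fun x => (g n x)%:C).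
  by have [] := L2_closure_nnsfun (g n).
have : \forall n \near \oo, (\int[mu]_(x in D) ((u x - g n x) ^+ 2)%:E < eps%:E)%E.
  have nb : nbhs (0%E : \bar R) [set y | (y < eps%:E)%E].
    by apply: open_nbhs_nbhs; split; [exact: open_ereal_lt_ereal|rewrite /= lte_fin].
  exact: cv nb.
case=> N _ /(_ N (leqnn N)) /= hN; exists (fun x => (g N x)%:C).
  exact: L2_closure_nnsfun.
rewrite -lte_fin -L2norm2E //; last first.
  by apply: (H_sub ph) => //; exact: Lr.
apply: le_lt_trans hN; rewrite le_eqVlt; apply/orP; left; apply/eqP.
by apply: eq_integral => x _; rewrite !ReImE /= oppr0 addr0 expr0n addr0.
Qed.

Lemma L2_closure_all f : L2 mu D f -> L2_closure f.
Proof.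
move=> /(L2P mu mD)[h1 h2].
have real (u : T -> R) : sq_rint mu D u -> L2_closure (fun x => (u x)%:C).
  move=> [mu_ iu].
  have part (v : T -> R) : measurable_fun D v -> (forall x, 0 <= v x) ->
      (forall x, v x ^+ 2 <= u x ^+ 2) -> L2_closure (fun x => (v x)%:C).
    move=> mv v0 vu; apply: L2_closure_nneg => [x _|]; first exact: v0.
    split => //; apply: (le_integrable mD _ _ iu).
      by apply/measurable_EFinP; exact: measurable_funX.
    by move=> x _ /=; rewrite lee_fin !ger0_norm ?sqr_ge0.
  have hp : L2_closure (fun x => (Num.max (u x) 0)%:C).
    apply: part.
    - by apply: measurable_maxr => //; exact: measurable_cst.
    - by move=> x; rewrite le_max lexx orbT.
    - by move=> x; case: (leP (u x) 0) => // _; rewrite expr0n sqr_ge0.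
  have hn : L2_closure (fun x => (Num.max (- u x) 0)%:C).
    apply: part.
    - by apply: measurable_maxr; [exact: measurable_funN|exact: measurable_cst].
    - by move=> x; rewrite le_max lexx orbT.
    - by move=> x; case: (leP (- u x) 0) => // _; rewrite ?sqrrN // expr0n sqr_ge0.
  have := L2_closure_lin (-1) hn hp; congr L2_closure; apply/funext => x.
  rewrite mulN1r -rmorphN -rmorphD; congr (_%:C).
  by case: (leP (u x) 0) => ux; case: (leP (- u x) 0); lra.
have := L2_closure_lin (Complex 0 1) (real _ h2) (real _ h1).
congr L2_closure; apply/funext => x; apply: complex_ext; rewrite !ReImE; ring.
Qed.
End L2_density.

(** * The vertex Laplacian *)

Section vertex_laplacian_tower.
Context {R : realType} {p : nat} {F : padicField R p}.
Hypothesis p_prime : prime p.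
Variable mu : {sigma_finite_measure set (Qp F) -> \bar R}.
Hypothesis mu_haar : is_haar mu.
Context {V : finType}.
Variables (e : rel V) (U : V -> set (Qp F)) (alpha : R).
Hypothesis e_sym : symmetric e.
Hypothesis U_adm : admissible_sets U.

Lemma levels : exists (l0 : nat) (n : nat -> nat)
    (c : forall k, 'I_(n k) -> Qp F) (lab : forall k, 'I_(n k) -> V),
  (forall k, level_data U (l0 + k) (@c k) (@lab k)) /\
  (forall l v x, (l0 <= l)%N -> U v x -> disc l x `<=` U v).
Proof.
have [l1 h1] := level_exists p_prime U_adm; have [l2 h2] := uniform_disc p_prime U_adm.
pose l0 := maxn l1 l2.
have ex k : exists s : {m : nat & (('I_m -> Qp F) * ('I_m -> V))%type},
    level_data U (l0 + k) (tagged s).1 (tagged s).2.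
  have [|m [c [lab ld]]] := h1 (l0 + k)%N.
    by rewrite (leq_trans (leq_maxl l1 l2)) // leq_addr.
  by exists (existT _ m (c, lab)).
pose X k := projT1 (cid (ex k)).
exists l0, (fun k => tag (X k)), (fun k => (tagged (X k)).1), (fun k => (tagged (X k)).2).
split=> [k|l v x l0l]; first exact: projT2 (cid (ex k)).
by apply: h2; apply: leq_trans l0l; exact: leq_maxr.
Qed.

Variables (l0 : nat) (n : nat -> nat) (c : forall k, 'I_(n k) -> Qp F)
  (lab : forall k, 'I_(n k) -> V).
Arguments c : clear implicits.
Arguments lab : clear implicits.
Hypothesis ld : forall k, level_data U (l0 + k) (c k) (lab k).

Local Notation mD := (OmV_measurable U_adm).
Local Notation H := (L2 mu (OmV U)).
Local Notation ip := (L2ip mu (OmV U)).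
Local Notation q := (sqnorm ip).
Local Notation ph := (L2_pre_hilbert mu mD).

Lemma locally_constant_rep u : locally_constant U u -> exists K, forall k, (K <= k)%N ->
  rep (l0 + k) (c k) (fun i => u (c k i)) u.
Proof.
move=> /(locally_constant_uniform p_prime U_adm)[l1 hl1]; exists l1 => k l1k i x ix.
apply: (hl1 (l0 + k)%N) => //; first by rewrite (leq_trans l1k) // leq_addl.
  exact: (c_OmV p_prime (ld k)).
exact: (cell_OmV (ld k) ix).
Qed.

Lemma locally_constant_L2 : locally_constant U `<=` H.
Proof.
move=> u /locally_constant_rep[K /(_ K (leqnn K))]; exact: (rep_L2 p_prime mu_haar U_adm (ld K)).
Qed.

Lemma locally_constant_lin a f g : locally_constant U f -> locally_constant U g ->
  locally_constant U (fun x => a * f x + g x).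
Proof.
move=> hf hg x xO; near=> y => yO.
have -> : f y = f x by move: yO; near: y; exact: hf.
by have -> : g y = g x by move: yO; near: y; exact: hg.
Unshelve. all: by end_near. Qed.

Lemma locally_constant0 : locally_constant U (fun=> 0).
Proof. by move=> x _; apply: filterE => y _. Qed.

Lemma mu_OmV_fin : (mu (OmV U) < +oo)%E.
Proof.
rewrite (mu_cells p_prime mu_haar (ld 0%N) mD) ?ltry // => i; left.
exact: (cell_OmV (ld _)).
Qed.

(** An open set is exhausted by the points whose discs of a given radius it contains,
   and such sets have locally constant indicators. Open sets are stable under
   intersection and generate the measurable sets, and the sets whose indicator is
   in the closure form a lambda-system. *)
Lemma indicator_L2_closure A0 : measurable A0 ->
  L2_closure mu (OmV U) (locally_constant U) (cind A0).
Proof.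
pose cs := L2_closure mu (OmV U) (locally_constant U).
have nds := @L2_closure_ndset _ _ _ _ _ mD mu_OmV_fin _ locally_constant_L2.
pose G := [set A : set (Qp F) | measurable A /\ cs (cind A)].
have Gopen O : open O -> G O.
  move=> oO; split; first exact: open_measurable_Qp.
  have nO y : O y -> nbhs y O by move: oO; rewrite openE; apply.
  pose A k := [set x | OmV U x /\ disc (l0 + k) x `<=` O].
  have mA k : measurable (A k).
    apply: open_measurable_Qp; rewrite openE => x [xO xA].
    have [v vx] := xO; have := @U_open _ _ _ _ _ U_adm v; rewrite openE => /(_ x vx) nv.
    near=> y; split; first by exists v; near: y; exact: nv.
    have xy : disc (l0 + k) x y.
      by near: y; apply/(nbhs_disc p_prime); exists (l0 + k)%N.
    by rewrite (disc_eq xy).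
  have csA k : cs (cind (A k)).
    have lcA : locally_constant U (cind (A k)).
      move=> x xO; apply/(nbhs_disc p_prime); exists (l0 + k)%N => y xy yO.
      rewrite /cind; congr (_%:C); rewrite !indicE; congr (_%:R); congr nat_of_bool.
      have xyE := disc_eq xy.
      by apply/idP/idP; rewrite !inE => -[_ h]; split; rewrite // ?xyE // -xyE.
    split; first exact: locally_constant_L2.
    move=> eps e0; exists (cind (A k)) => //.
    by rewrite (_ : (fun x => _) = fun=> 0) ?(q_zero ph) //; apply/funext => x; rewrite subrr.
  have ndA : nondecreasing_seq A.
    move=> i j ij; apply/subsetPset => x [xO xA]; split => //.
    by apply: subset_trans xA; apply: disc_le => //; rewrite leq_add2l.
  have := nds _ ndA mA csA; apply: L2_closure_eq => x xO.
  rewrite /cind; congr (_%:C); rewrite !indicE; congr (_%:R); congr nat_of_bool.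
  apply/idP/idP; rewrite !inE; first by move=> [k _ [_]]; apply; exact: disc_center.
  move=> /nO/(nbhs_disc p_prime)[l hl].
  exists l => //; split => //; apply: subset_trans hl; apply: disc_le => //.
  exact: leq_addl.
have lamG : lambda_system setT G.
  split => //.
  - by apply: Gopen; exact: openT.
  - move=> A B BA [mA csA] [mB csB]; split; first exact: measurableD.
    have := L2_closure_lin mD locally_constant_lin locally_constant_L2 (-1) csB csA.
    congr cs; apply/funext => x; rewrite /cind !indicE in_setD.
    case: (boolP (x \in B)) => xB /=.
      have -> : x \in A by rewrite inE; apply: BA; move: xB; rewrite inE.
      by rewrite mulN1r addNr.
    by rewrite andbT mulr0 add0r.
  - move=> A ndA hA; split; first by apply: bigcupT_measurable => k; have [] := hA k.
    by apply: nds => // k; have [] := hA k.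
have : <<s [set O : set (Qp F) | open O] >> `<=` G.
  apply: (lambda_system_subset _ lamG) => //.
  by move=> O O' oO oO'; exact: openI.
by move=> h mA; have [] := h A0 mA.
Unshelve. all: by end_near. Qed.

Lemma locally_constant_dense g : H g -> forall eps : R, 0 < eps ->
  exists2 u, locally_constant U u & q (fun x => g x - u x) < eps.
Proof.
move=> Hg; have [_ h] := L2_closure_all mD locally_constant0 locally_constant_lin
  locally_constant_L2 indicator_L2_closure Hg.
exact: h.
Qed.

Let s k : R := Num.sqrt (p%:R ^+ (l0 + k)).
Let pX_gt0 k : (0 : R) < p%:R ^+ (l0 + k). Proof. by rewrite exprn_gt0 // p_gt0. Qed.
Let s_gt0 k : 0 < s k. Proof. by rewrite sqrtr_gt0 pX_gt0. Qed.
Let s2 k : s k * s k = p%:R ^+ (l0 + k).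
Proof. by rewrite -expr2 sqr_sqrtr // ltW. Qed.

Let sK k (z : R[i]) : (s k)%:C * ((s k)^-1%:C * z) = z.
Proof. by rewrite mulrA -rmorphM /= mulfV ?gt_eqF //; exact: mul1r. Qed.

(** The constant normalises the indicator of a disc in L^2. *)
Definition cell_fn k i : Qp F -> R[i] := fun x => (s k)%:C * cind (disc (l0 + k) (c k i)) x.
Definition level_wt k := cell_wt e alpha (l0 + k) (c k) (lab k).
Arguments level_wt : clear implicits.
Definition D_mx k := lap (level_wt k).
Definition refine_mx k : 'M[R[i]]_(n k, n k.+1) := \matrix_(i, j)
  ((s k / s k.+1)%:C * (`[< disc (l0 + k) (c k i) (c k.+1 j) >])%:R).

Lemma lc_cell_fn k (a : 'rV[R[i]]_(n k)) x :
  lc a (@cell_fn k) x = \sum_i ((s k)%:C * a 0 i) * cind (disc (l0 + k) (c k i)) x.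
Proof. by rewrite lcE; apply: eq_bigr => i _; rewrite /cell_fn mulrCA mulrA. Qed.

Lemma rep_cell_fn k (a : 'rV[R[i]]_(n k)) :
  rep (l0 + k) (c k) (fun i => (s k)%:C * a 0 i) (lc a (@cell_fn k)).
Proof.
by move=> i x ix; rewrite lc_cell_fn (sum_cells p_prime (ld k) (fun i => (s k)%:C * a 0 i) ix).
Qed.

Lemma lc_cell_fn_out k (a : 'rV[R[i]]_(n k)) x : ~ OmV U x -> lc a (@cell_fn k) x = 0.
Proof.
by move=> xO; rewrite lc_cell_fn (sum_cells_out (ld k) (fun i => (s k)%:C * a 0 i) xO).
Qed.

Lemma rep_lc_cell_fn k (f : 'I_(n k) -> R[i]) u : rep (l0 + k) (c k) f u ->
  forall x, OmV U x -> lc (\row_i ((s k)^-1%:C * f i)) (@cell_fn k) x = u x.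
Proof.
move=> ru x /(ld_cov (ld k))[i ix]; by rewrite (rep_cell_fn _ ix) mxE sK (ru _ _ ix).
Qed.

Lemma level_wt_sym k i j : level_wt k i j = level_wt k j i. Proof. exact: cell_wt_sym. Qed.
Lemma level_wt_ge0 k i j : 0 <= level_wt k i j. Proof. exact: cell_wt_ge0. Qed.

(** On step functions of a fixed level the vertex Laplacian is a finite graph
   Laplacian. In particular it preserves the level, which is what makes the levels
   a tower. *)
Lemma D_cell_fn k (a : 'rV[R[i]]_(n k)) x : OmV U x ->
  div mu e U alpha (grad alpha (lc a (@cell_fn k))) x = lc (a *m D_mx k) (@cell_fn k) x.
Proof.
move=> /(ld_cov (ld k))[i ix].
rewrite (div_cell p_prime mu_haar e alpha U_adm (ld k) (rep_cell_fn a) ix) (rep_cell_fn _ ix).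
rewrite (lapE (level_wt_sym (k := k))) mulr_sumr; apply: eq_bigr => j _.
by rewrite -mulrBr mulrCA.
Qed.

Lemma cell_fn_H k i : H (@cell_fn k i).
Proof. by rewrite -(lc_delta (@cell_fn k)); exact: (rep_L2 p_prime mu_haar U_adm (ld k) (rep_cell_fn _)). Qed.

Lemma cell_fn_on k i j : ip (@cell_fn k i) (@cell_fn k j) = (i == j)%:R.
Proof.
rewrite -!(lc_delta (@cell_fn k)).
rewrite (rep_ip p_prime mu_haar U_adm (ld k) (rep_cell_fn _) (rep_cell_fn _)).
rewrite (bigD1 i) //= big1 ?addr0.
  rewrite !mxE !eqxx mulr1 conjcM conjc_real rmorph_nat mulrA -rmorphM mulrA -rmorphM /=.
  by rewrite -mulrA s2 mulVf; [exact: mul1r|rewrite gt_eqF].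
by move=> k' ne; rewrite !mxE eqxx (negPf ne) mulr0 mul0r.
Qed.

Lemma cell_fn_Q k i : @cell_fn k i = lc (row i (refine_mx k)) (@cell_fn k.+1).
Proof.
apply/funext => x; have [xO|xO] := pselect (OmV U x); last first.
  rewrite lc_cell_fn_out // /cell_fn /cind indicE memNset ?mulr0 // => ix.
  by apply: xO; exact: (cell_OmV (ld k) ix).
have [j jx] := ld_cov (ld k.+1) xO.
rewrite (rep_cell_fn _ jx) !mxE mulrA -rmorphM /= mulrCA mulfV ?gt_eqF // mulr1.
rewrite /cell_fn /cind indicE; congr (_ * _); rewrite rmorph_nat; congr (_%:R); congr nat_of_bool.
have jx' : disc (l0 + k) (c k.+1 j) x.
  by apply: disc_le jx => //; rewrite leq_add2l.
apply/idP/idP; first by rewrite inE => ix; apply/asboolP; rewrite -(disc_eq ix) (disc_eq jx'); exact: disc_center.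
by move=> /asboolP ij; rewrite inE -(disc_eq ij).
Qed.

Lemma D_op_lc k (a : 'rV[R[i]]_(n k)) :
  D_op mu e U alpha (lc a (@cell_fn k), lc (a *m D_mx k) (@cell_fn k)).
Proof.
have L a' : H (lc a' (@cell_fn k)) := rep_L2 p_prime mu_haar U_adm (ld k) (rep_cell_fn a').
split => //=; exists (fun=> lc a (@cell_fn k)); split.
- by move=> _; exact: (rep_locally_constant p_prime (ld k) (rep_cell_fn a)).
- rewrite /L2cvg (_ : (fun _ => _) = fun=> 0%E); first exact: cvg_cst.
  by apply/funext => _; rewrite /L2norm2 integral0_eq // => x _; rewrite subrr /= expr0n addr0.
rewrite /L2cvg (_ : (fun _ => _) = fun=> 0%E); first exact: cvg_cst.
apply/funext => _; rewrite /L2norm2 integral0_eq // => x xO.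
by rewrite D_cell_fn // subrr /= expr0n addr0.
Qed.

Lemma D_tower : tower H ip (D_op mu e U alpha) cell_fn refine_mx D_mx.
Proof.
split.
- exact: cell_fn_H.
- exact: cell_fn_on.
- exact: cell_fn_Q.
- by move=> k; exact: lap_herm (level_wt_sym (k := k)).
- by move=> k a; apply: lap_psd; [exact: level_wt_sym|exact: level_wt_ge0].
- move=> k; apply/row_matrixP => i; rewrite !row_mul.
  have lift (d : 'rV_(n k)) : lc d (@cell_fn k) = lc (d *m refine_mx k) (@cell_fn k.+1).
    by rewrite lc_mul; congr (lc _ _); apply/funext => j; exact: cell_fn_Q.
  apply: (lc_inj ph (@cell_fn_H k.+1) (@cell_fn_on k.+1)).
  rewrite !rowE -[RHS]lift; apply/funext => x.
  have [xO|xO] := pselect (OmV U x); last by rewrite !lc_cell_fn_out.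
  by rewrite -!D_cell_fn // -lift.
- move=> g Hg eps e0; have [u lu hu] := locally_constant_dense Hg e0.
  have [k /(_ k (leqnn k)) ru] := locally_constant_rep lu.
  exists k, (\row_i ((s k)^-1%:C * u (c k i))).
  rewrite (eq_q mu (g := fun x => g x - u x)) // => x xO.
  by rewrite (rep_lc_cell_fn ru).
- by move=> k a; exact: D_op_lc.
move=> f g [/= Lf Lg [u [lu cu cDu]]]; split => // eps e0.
have Lu m : H (u m) by apply: locally_constant_L2; exact: lu.
have DuE m : exists k (a : 'rV_(n k)),
    (forall x, OmV U x -> lc a (@cell_fn k) x = u m x) /\
    (forall x, OmV U x -> lc (a *m D_mx k) (@cell_fn k) x = div mu e U alpha (grad alpha (u m)) x).
  have [k /(_ k (leqnn k)) ru] := locally_constant_rep (lu m).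
  exists k, (\row_i ((s k)^-1%:C * u m (c k i))); split; first exact: rep_lc_cell_fn.
  move=> x xO; rewrite -D_cell_fn //; have [i ix] := ld_cov (ld k) xO.
  rewrite (div_cell p_prime mu_haar e alpha U_adm (ld k) ru ix).
  rewrite (div_cell p_prime mu_haar e alpha U_adm (ld k) (rep_cell_fn _) ix).
  by apply: eq_bigr => j _; rewrite !mxE !sK.
have LDu m : H (div mu e U alpha (grad alpha (u m))).
  have [k [a [_ h]]] := DuE m.
  exact: (eq_L2 h (rep_L2 p_prime mu_haar U_adm (ld k) (rep_cell_fn _))).
have n1 := L2cvg_near mD Lu Lf cu e0; have n2 := L2cvg_near mD LDu Lg cDu e0.
have [N _ hN] : \forall m \near \oo, q (fun x => u m x - f x) < eps /\
    q (fun x => div mu e U alpha (grad alpha (u m)) x - g x) < eps.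
  by near=> m; split; near: m.
have [h1 h2] := hN N (leqnn N); have [k [a [E1 E2]]] := DuE N; exists k, a; split.
  rewrite (eq_q mu (g := fun x => f x - u N x)); last by move=> x xO; rewrite E1.
  by rewrite (q_subC ph).
rewrite (eq_q mu (g := fun x => g x - div mu e U alpha (grad alpha (u N)) x)).
  by rewrite (q_subC ph).
by move=> x xO; rewrite E2.
Unshelve. all: by end_near. Qed.
End vertex_laplacian_tower.

(** * The kernel of the gradient *)

Section vertex_measures.
Context {R : realType} {p : nat} {F : padicField R p}.
Hypothesis p_prime : prime p.
Variable mu : {sigma_finite_measure set (Qp F) -> \bar R}.
Hypothesis mu_haar : is_haar mu.
Context {V : finType} (U : V -> set (Qp F)).
Hypothesis U_adm : admissible_sets U.

Definition muU v : R := fine (mu (U v)).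

Lemma mu_U_fin v : (mu (U v) < +oo)%E.
Proof.
have [l0 [n [c [lab [ld _]]]]] := levels p_prime U_adm.
apply: le_lt_trans (mu_OmV_fin p_prime mu_haar U_adm ld).
apply: le_measure; rewrite ?inE; [exact: U_measurable|exact: OmV_measurable|].
by move=> x vx; exists v.
Qed.

Lemma muUE v : mu (U v) = (muU v)%:E.
Proof. by rewrite /muU fineK // ge0_fin_numE // mu_U_fin. Qed.

Lemma muU_gt0 v : 0 < muU v.
Proof.
have [l0 [n [c [lab [ld _]]]]] := levels p_prime U_adm.
have [i iv] := lab_surj U_adm (ld 0%N) v.
rewrite -lte_fin -muUE; apply: (@lt_le_trans _ _ (mu (disc (l0 + 0) (c 0%N i)))).
  by rewrite mu_disc // lte_fin pXV_gt0.
apply: le_measure; rewrite ?inE; [exact: disc_measurable|exact: U_measurable|].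
by rewrite -iv; exact: (ld_U (ld 0%N)).
Qed.

Definition vind (k : 'I_#|V|) : Qp F -> R[i] := cind (U (enum_val k)).

Lemma vind_L2 k : L2 mu (OmV U) (vind k).
Proof.
apply: cind_L2; [exact: OmV_measurable|exact: U_measurable|].
apply: le_lt_trans (mu_U_fin (enum_val k)); apply: le_measure; rewrite ?inE //.
- by apply: measurableI; [exact: U_measurable|exact: OmV_measurable].
- exact: U_measurable.
Qed.

Lemma vind_ip j k : L2ip mu (OmV U) (vind j) (vind k) =
  (if j == k then muU (enum_val j) else 0)%:C.
Proof.
rewrite ip_cind; [|exact: OmV_measurable|exact: U_measurable|exact: U_measurable|]; last first.
  apply: le_lt_trans (mu_U_fin (enum_val j)); apply: le_measure; rewrite ?inE //.
  - by apply: measurableI; [exact: U_measurable|exact: OmV_measurable].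
  - exact: U_measurable.
have [->|jk] := eqVneq j k.
  by rewrite setIid (setIidl _) //; move=> x h; exists (enum_val k).
rewrite (_ : U _ `&` U _ = set0) ?set0I ?measure0 //.
rewrite -subset0 => x [xj xk]; have := U_disj U_adm xj xk.
by move=> /enum_val_inj /eqP; rewrite (negPf jk).
Qed.

Lemma lc_vind (x : 'rV[R[i]]_#|V|) v y : U v y -> lc x vind y = x 0 (enum_rank v).
Proof.
move=> vy; rewrite lcE (bigD1 (enum_rank v)) //= /vind /cind enum_rankK indicE mem_set // mulr1.
rewrite big1 ?addr0 // => k kv; rewrite indicE memNset ?mulr0 // => ky.
by move: kv; rewrite (U_disj U_adm vy ky) enum_valK eqxx.
Qed.

Lemma vind_indep (x : 'rV[R[i]]_#|V|) : sqnorm (L2ip mu (OmV U)) (lc x vind) = 0 -> x = 0.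
Proof.
have ph := L2_pre_hilbert mu (OmV_measurable U_adm) => x0; apply/rowP => k.
have := q0_ipl ph (vind_L2 k) (H_lc ph x vind_L2) x0.
rewrite (ip_lincombl ph _ _ vind_L2 (vind_L2 k)) (bigD1 k) //= big1 ?addr0; last first.
  by move=> j jk; rewrite vind_ip (negPf jk) mulr0.
rewrite vind_ip eqxx mxE => /eqP; rewrite mulf_eq0 => /orP[/eqP //|/eqP/(congr1 (@complex.Re R)) /= h].
by have := muU_gt0 (enum_val k); rewrite h ltxx.
Qed.

Lemma lc_vind_rep l n (c : 'I_n -> Qp F) lab (x : 'rV[R[i]]_#|V|) :
  level_data U l c lab -> rep l c (fun i => x 0 (enum_rank (lab i))) (lc x vind).
Proof. by move=> ld i y iy; apply: lc_vind; exact: (ld_U ld). Qed.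
End vertex_measures.

Section vertex_laplacian_kernel.
Context {R : realType} {p : nat} {F : padicField R p}.
Hypothesis p_prime : prime p.
Variable mu : {sigma_finite_measure set (Qp F) -> \bar R}.
Hypothesis mu_haar : is_haar mu.
Context {V : finType}.
Variables (e : rel V) (U : V -> set (Qp F)) (alpha : R).
Hypothesis e_sym : symmetric e.
Hypothesis U_adm : admissible_sets U.
Variables (l0 : nat) (n : nat -> nat) (c : forall k, 'I_(n k) -> Qp F)
  (lab : forall k, 'I_(n k) -> V).
Arguments c : clear implicits.
Arguments lab : clear implicits.
Hypothesis ld : forall k, level_data U (l0 + k) (c k) (lab k).

Local Notation mD := (OmV_measurable U_adm).
Local Notation mE := (OmE_measurable e U_adm).
Local Notation H := (L2 mu (OmV U)).
Local Notation ip := (L2ip mu (OmV U)).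
Local Notation q := (sqnorm ip).
Local Notation ph := (L2_pre_hilbert mu mD).
Local Notation ip2 := (L2ip (mu2 mu) (OmE e U)).
Local Notation q2 := (sqnorm ip2).
Local Notation ph2 := (L2_pre_hilbert (mu2 mu) mE).
Local Notation b := (cell_fn l0 c).
Local Notation M := (D_mx e alpha l0 c lab).
Local Notation tw := (D_tower p_prime mu_haar alpha e_sym U_adm ld).
Local Notation D f := (div mu e U alpha (grad alpha f)).

(** Both sides are the Dirichlet form of the weighted graph of cells. *)
Lemma green_level k f u g w : rep (l0 + k) (c k) f u -> rep (l0 + k) (c k) g w ->
  ip (D u) w = ip2 (grad alpha u) (grad alpha w).
Proof.
move=> ru rw.
have rD : rep (l0 + k) (c k) (fun i => \sum_j (level_wt e alpha l0 c lab i j)%:C * (f i - f j)) (D u).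
  by move=> i x ix; rewrite (div_cell p_prime mu_haar e alpha U_adm (ld k) ru ix).
rewrite (rep_ip p_prime mu_haar U_adm (ld k) rD rw).
rewrite (grad_ip p_prime mu_haar e alpha U_adm (ld k) ru rw); congr (_ * _).
have sy : forall i j : 'I_(n k), level_wt e alpha l0 c lab i j = level_wt e alpha l0 c lab j i.
  by move=> i j; exact: level_wt_sym.
have := lap_green (w := level_wt e alpha l0 c lab (k := k)) sy (\row_i f i) (\row_i g i).
rewrite mxE; under eq_bigr do rewrite lapE // !mxE.
under [X in _ = 2^-1 * X]eq_bigr do under eq_bigr do rewrite !mxE.
move=> <-; apply: eq_bigr => i _; congr (_ * _).
by apply: eq_bigr => j _; rewrite !mxE.
Qed.

Lemma common_level u k (a : 'rV[R[i]]_(n k)) : locally_constant U u ->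
  exists k' (a' : 'rV[R[i]]_(n k')), lc a (@b k) = lc a' (@b k') /\
    rep (l0 + k') (c k') (fun i => u (c k' i)) u.
Proof.
move=> /(locally_constant_rep p_prime U_adm ld)[K hK]; pose k' := maxn k K.
have [a' [-> _]] := tower_lift tw a (leq_maxl k K).
by exists k', a'; split => //; apply: hK; exact: leq_maxr.
Qed.

Lemma grad_locally_constant_L2 u : locally_constant U u -> L2 (mu2 mu) (OmE e U) (grad alpha u).
Proof.
move=> /(locally_constant_rep p_prime U_adm ld)[K /(_ K (leqnn K))].
exact: (grad_L2 p_prime mu_haar e alpha U_adm (ld K)).
Qed.

(** The Green identity moves the Laplacian from the eigenfunction to the gradient of
   locally constant approximations of [f], and these gradients tend to zero. *)
Lemma ker_d_perp f k (a : 'rV[R[i]]_(n k)) (nu : R) : ker_d mu e U alpha f ->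
  a *m M k = nu%:C *: a -> nu != 0 -> ip f (lc a (@b k)) = 0.
Proof.
move=> [/= Lf L0 [u [lu cu cg]]] aM nu0; set w := lc a (@b k).
have rw : rep (l0 + k) (c k) _ w := rep_cell_fn p_prime ld a.
have lw : locally_constant U w := rep_locally_constant p_prime (ld k) rw.
have Lw : H w by exact: (locally_constant_L2 p_prime mu_haar U_adm ld lw).
have Lgw := grad_locally_constant_L2 lw.
have Lu m : H (u m) by apply: (locally_constant_L2 p_prime mu_haar U_adm ld); exact: lu.
have Lgu m := grad_locally_constant_L2 (lu m).
have key m : nu%:C * ip (u m) w = ip2 (grad alpha (u m)) (grad alpha w).
  have Dw x : OmV U x -> D w x = nu%:C * w x.
    by move=> xO; rewrite (D_cell_fn p_prime mu_haar alpha e_sym U_adm ld) // aM lcZ.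
  have [k' [a' [wE ru]]] := common_level a (lu m).
  have rw' := rep_cell_fn p_prime ld a'.
  have g2 : ip (D w) (u m) = ip2 (grad alpha w) (grad alpha (u m)).
    by rewrite /w wE; exact: (green_level rw' ru).
  rewrite (ph_ipC ph2 Lgw (Lgu m)) -g2.
  rewrite (eq_L2ip mu (f := D w) (g := fun x => nu%:C * w x) (h := u m) (k := u m)) //.
  by rewrite (ip_scalel ph nu%:C Lw (Lu m)) conjcM conjc_real -(ph_ipC ph Lw (Lu m)).
apply/eqP; have : nu%:C * ip f w = 0.
  apply: nsq_eq0; apply: (@le_eps_eq0 _ _ (2 * (nu ^+ 2 * q w + q2 (grad alpha w)))).
  - exact: nsq_ge0.
  - apply: mulr_ge0 => //; apply: addr_ge0; last exact: (q_ge0 ph2 Lgw).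
    by apply: mulr_ge0; [exact: sqr_ge0|exact: (q_ge0 ph Lw)].
  move=> eps e0.
  have n1 := L2cvg_near mD Lu Lf cu e0; have n2 := L2cvg_near mE Lgu L0 cg e0.
  have [N _ hN] : \forall m \near \oo, q (fun x => u m x - f x) < eps /\
      q2 (fun x => grad alpha (u m) x - 0) < eps.
    by near=> m; split; near: m.
  have [h1 h2] := hN N (leqnn N).
  have -> : nu%:C * ip f w = nu%:C * ip (fun x => f x - u N x) w + nu%:C * ip (u N) w.
    by rewrite -mulrDr (ip_subl ph) // subrK.
  apply: le_trans (nsqD_le _ _) _; rewrite -mulrA ler_pM2l // mulrDl lerD //.
    rewrite nsqM nsqC -mulrA ler_wpM2l ?sqr_ge0 //.
    apply: le_trans (cauchy_schwarz ph (H_sub ph Lf (Lu N)) Lw) _.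
    by rewrite mulrC ler_wpM2l ?(q_ge0 ph Lw) // (q_subC ph) // ltW.
  rewrite key; apply: le_trans (cauchy_schwarz ph2 (Lgu N) Lgw) _.
  rewrite mulrC ler_wpM2l ?(q_ge0 ph2 Lgw) // ltW //.
  by move: h2; rewrite (_ : (fun x => _) = grad alpha (u N)) //; apply/funext => x; rewrite subr0.
move/eqP; rewrite mulf_eq0 => /orP[/eqP [] h|//].
by rewrite h eqxx in nu0.
Unshelve. all: by end_near. Qed.

Lemma ker_d_locally_constant u : locally_constant U u ->
  (forall z, OmE e U z -> u z.1 = u z.2) -> ker_d mu e U alpha u.
Proof.
move=> lu hu; split => /=.
- exact: (locally_constant_L2 p_prime mu_haar U_adm ld lu).
- exact: (ph_zero ph2).
exists (fun=> u); split => //.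
- rewrite /L2cvg (_ : (fun _ => _) = fun=> 0%E); first exact: cvg_cst.
  by apply/funext => _; rewrite /L2norm2 integral0_eq // => x _; rewrite subrr /= expr0n addr0.
rewrite /L2cvg (_ : (fun _ => _) = fun=> 0%E); first exact: cvg_cst.
apply/funext => _; rewrite /L2norm2 integral0_eq // => z zE.
by rewrite /grad (hu z zE) subrr mul0r subr0 /= expr0n addr0.
Qed.

Lemma cells_of_U k v :
  (\sum_(i | lab k i == v) p%:R ^- (l0 + k) : R) = muU mu U v.
Proof.
apply: EFin_inj; rewrite -(muUE p_prime mu_haar U_adm) (mu_cells p_prime mu_haar (ld k)).
- congr (_%:E); apply: eq_bigl => i; apply/eqP/asboolP => [<-|sub].
    exact: (ld_U (ld k)).
  apply: (U_disj U_adm (ld_U (ld k) (disc_center p_prime _ _)) (sub _ _)).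
  exact: disc_center.
- exact: U_measurable.
- move=> i; have [iv|iv] := eqVneq (lab k i) v; [left|right].
    by rewrite -iv; exact: (ld_U (ld k)).
  rewrite -subset0 => x [ix vx]; move: iv.
  by rewrite (U_disj U_adm vx (ld_U (ld k) ix)) eqxx.
- by move=> x vx; exists v.
Qed.

(** Step functions on the set of an isolated vertex lie in the kernel, and there are
   more and more of them at finer levels. *)
Lemma fin_dim_no_isolated : fin_dim (ker_d mu e U alpha) (L2null mu (OmV U)) ->
  forall v, exists w, e v w.
Proof.
move=> [N hN] v; apply: contrapT => iso.
have noE w : ~~ e v w by apply/negP => vw; apply: iso; exists w.
(* radius so small that more than [N] discs are needed to cover [U v] *)
have mv0 : 0 < muU mu U v / N.+1%:R by rewrite divr_gt0 ?muU_gt0.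
have [k hk] := pXV_small p_prime mv0.
pose m := #|[pred i | lab k i == v]|.
have mN : (N < m)%N.
  have := cells_of_U k v; rewrite sumr_const -/m -[_ *+ m]mulr_natl => mE.
  have pk : (p%:R ^- (l0 + k) : R) <= p%:R ^- k by apply: pXV_le => //; exact: leq_addl.
  have pk0 := pXV_gt0 (R := R) p_prime (l0 + k).
  rewrite -(ltr_nat R) ltNge; apply/negP => mleN.
  move: hk; rewrite ltr_pdivlMr // ltNge => /negP; apply.
  have mN1 : (m%:R : R) <= N.+1%:R by apply: le_trans mleN _; rewrite ler_nat.
  by rewrite -mE mulrC ler_pM // ltW.
have := orthonormal_le_dim ph (S := ker_d mu e U alpha) (N := L2null mu (OmV U)) (m := m)
  (f := fun j => @b k (enum_val j)) _ _ hN _ _.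
rewrite leqNgt mN => h; suff : false by []; apply: h.
- by move=> f [].
- by move=> g Ng Hg; apply/(L2nullP mD Hg).
- move=> j; have := enum_valP j; rewrite inE => /eqP jv.
  apply: ker_d_locally_constant.
    rewrite -(lc_delta (@b k)).
    exact: (rep_locally_constant p_prime (ld k) (rep_cell_fn p_prime ld _)).
  have z0 y w : w != v -> U w y -> @b k (enum_val j) y = 0.
    move=> wv wy; rewrite /cell_fn /cind indicE memNset ?mulr0 // => jy.
    by move: wv; rewrite (U_disj U_adm wy (ld_U (ld k) jy)) jv eqxx.
  move=> z [w [w' [ww' zw zw']]]; rewrite (z0 _ w) // ?(z0 _ w') //.
    by apply: contraTneq ww' => ->; rewrite e_sym.
  by apply: contraTneq ww' => ->.
- by move=> i j; rewrite (cell_fn_on p_prime mu_haar U_adm ld) (inj_eq enum_val_inj).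
Qed.

Variables (kk : nat -> nat) (E : forall k, 'M[R[i]]_(kk k, n k))
  (lam : forall k, 'I_(kk k) -> R).
Arguments E : clear implicits.
Arguments lam : clear implicits.
Hypothesis EM : forall k i, row i (E k) *m M k = (lam k i)%:C *: row i (E k).
Hypothesis eb : eigenbasis H ip (D_op mu e U alpha)
  (fun x : {k & 'I_(kk k)} => lam (tag x) (tagged x))
  (fun x : {k & 'I_(kk k)} => lc (row (tagged x) (E (tag x))) (@b (tag x))).
Hypothesis nb : forall v, exists w, e v w.
Variable o : 'I_#|edges (loopless e)| -> V * V.
Hypothesis ho1 : forall i, e (o i).1 (o i).2.
Hypothesis ho2 : forall u v, u != v -> e u v -> exists i, o i = (u, v) \/ o i = (v, u).

(** Functions constant on each [U v] and along edges are the kernel of the transposed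
   incidence matrix. They are annihilated by the gradient, and they contain the
   zero modes because harmonic step functions depend on the vertex only. *)
Lemma D_zero_modes : exists z : seq {k & 'I_(kk k)},
  [/\ uniq z, size z = (#|V| - \rank (incidence (R := R) o)^T)%N,
      (forall x, (x \in z) = (lam (tag x) (tagged x) == 0)) &
      has_dim (ker_d mu e U alpha) (L2null mu (OmV U))
        (#|V| - \rank (incidence (R := R) o)^T)%N].
Proof.
have [||||z [uz sz zE dimE]] := zero_modes ph eb (g := vind U) (B := (incidence (R := R) o)^T)
  (S := ker_d mu e U alpha) (vind_L2 p_prime mu_haar U_adm).
- exact: (vind_indep p_prime mu_haar U_adm).
- move=> x xB.
  have xE : x = \row_k (fun v => x 0 (enum_rank v)) (enum_val k).
    by apply/rowP => k; rewrite mxE enum_valK.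
  move: xB; rewrite {1}xE => /(incidence_ker ho1 ho2 (fun v => x 0 (enum_rank v))) hx.
  apply: ker_d_locally_constant.
    exact: (rep_locally_constant p_prime (ld 0%N) (lc_vind_rep U_adm x (ld 0%N))).
  by move=> [y y'] [v [w [vw /= vy wy]]]; rewrite (lc_vind U_adm x vy) (lc_vind U_adm x wy) (hx v w).
- by move=> f kf; split=> [|[k i] /= n0]; [case: kf|exact: ker_d_perp (EM i) n0].
- move=> [k i] /= l0E; have := EM i; rewrite l0E scale0r => EM0.
  have [||||x [hx xE]] := lap_null_label (w := level_wt e alpha l0 c lab (k := k)) (lab := lab k)
      (e := e) (c := row i (E k)) _ _ e_sym nb _ _ EM0.
  + by move=> i' j'; exact: level_wt_sym.
  + by move=> i' j'; exact: level_wt_ge0.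
  + exact: (lab_surj U_adm (ld k)).
  + move=> i' j'; exact: (cell_wt_gt0 p_prime alpha (ld k)).
  pose s : R[i] := (Num.sqrt (p%:R ^+ (l0 + k)))%:C.
  exists (\row_j (s * x (enum_val j))); split.
    apply/(incidence_ker ho1 ho2 (fun v => s * x v)) => u v uv.
    by rewrite (hx u v uv).
  rewrite (eq_q mu (g := fun=> 0)) ?(q_zero ph) // => y yO.
  have [j jy] := ld_cov (ld k) yO.
  rewrite (rep_cell_fn p_prime ld _ jy) (lc_vind_rep U_adm _ (ld k) jy) xE mxE enum_rankK.
  by rewrite subrr.
exists z; split => //; apply: dimE.
- by apply: aeW => x.
- by move=> f Nf Hf; apply/(L2nullP mD Hf).
- by move=> f Hf f0; apply/(L2nullP mD Hf).
Qed.
End vertex_laplacian_kernel.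

(** * Growth of the eigenvalues *)

Section eigenvalue_growth.
Context {R : realType} {p : nat} {F : padicField R p}.
Hypothesis p_prime : prime p.
Variable mu : {sigma_finite_measure set (Qp F) -> \bar R}.
Hypothesis mu_haar : is_haar mu.
Context {V : finType}.
Variables (e : rel V) (U : V -> set (Qp F)) (alpha : R).
Hypothesis e_sym : symmetric e.
Hypothesis U_adm : admissible_sets U.
Variables (l0 : nat) (n : nat -> nat) (c : forall k, 'I_(n k) -> Qp F)
  (lab : forall k, 'I_(n k) -> V).
Arguments c : clear implicits.
Arguments lab : clear implicits.
Hypothesis ld : forall k, level_data U (l0 + k) (c k) (lab k).
Hypothesis discU : forall l v x, (l0 <= l)%N -> U v x -> disc l x `<=` U v.
Hypothesis loops : forall v, e v v.
Hypothesis alpha_ge : 2^-1 <= alpha.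

Local Notation M := (D_mx e alpha l0 c lab).
Local Notation Q := (refine_mx l0 c).
Local Notation w k := (level_wt e alpha l0 c lab (k := k)).

(** All cells of a level have the same measure. *)
Lemma count_cells k m j : (m <= k)%N ->
  (\sum_(i | `[< disc (l0 + m) (c k j) (c k i) >]) p%:R ^- (l0 + k) : R) = p%:R ^- (l0 + m).
Proof.
move=> mk; apply: EFin_inj; rewrite -(mu_disc p_prime mu_haar _ (c k j)).
have jU : disc (l0 + m) (c k j) `<=` U (lab k j).
  by apply: discU; [exact: leq_addr|exact: (ld_U (ld k) (disc_center p_prime _ _))].
have sub i : disc (l0 + m) (c k j) (c k i) -> disc (l0 + k) (c k i) `<=` disc (l0 + m) (c k j).
  by move=> ji; rewrite -(disc_eq ji); apply: disc_le => //; rewrite leq_add2l.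
rewrite (mu_cells p_prime mu_haar (ld k)).
- congr (_%:E); apply: eq_bigl => i; apply/asboolP/asboolP; first exact: sub.
  by apply; exact: disc_center.
- exact: disc_measurable.
- move=> i; have [ji|ji] := pselect (disc (l0 + m) (c k j) (c k i)); [left|right].
    exact: sub.
  rewrite -subset0 => x [ix jx]; apply: ji.
  rewrite -(disc_eq jx); have : disc (l0 + m) (c k i) x.
    by apply: disc_le ix => //; rewrite leq_add2l.
  by move=> /disc_eq ->; exact: disc_center.
- by move=> x /jU jx; exists (lab k j).
Qed.

(** For such [alpha] the squared kernel is at least the inverse of the distance, which
   is not integrable near the diagonal. *)
Lemma kernel_lower (d : R) a : 0 < d -> d <= p%:R ^- a -> p%:R ^+ a <= (d `^ (- alpha)) ^+ 2.
Proof.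
move=> d0 da; have d1 : d <= 1.
  by apply: le_trans da _; have := pXV_le (R := R) p_prime (leq0n a); rewrite expr0 invr1.
have pa0 : (0 : R) < p%:R ^+ a by rewrite exprn_gt0 // p_gt0.
rewrite -(powR_mulrn 2 (powR_ge0 d _)) -powRrM.
apply: (@le_trans _ _ (d `^ (-1))).
  have -> : d `^ (-1) = d^-1 by rewrite powR_inv1 // ltW.
  by rewrite -(invrK (p%:R ^+ a)) lef_pV2 ?posrE ?invr_gt0.
by apply: ger_powR; [rewrite d0|rewrite mulNr lerN2 -ler_pdivrMr // div1r].
Qed.

(** The points at distance about [p^-m] have total measure about [p^-m], while the
   squared kernel there is at least [p^m]: every scale contributes a definite
   amount. The loop at the vertex of [j] is what couples these cells. *)
Lemma far_weight k m j : (m <= k)%N -> m%:R / 4 <=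
  \sum_(i | `[< disc (l0 + 0) (c k j) (c k i) >] &&
      ~~ `[< disc (l0 + m) (c k j) (c k i) >]) w k j i.
Proof.
pose P a i := `[< disc (l0 + a) (c k j) (c k i) >].
have sub a a' i : (a <= a')%N -> P a' i -> P a i.
  by move=> aa' /asboolP h; apply/asboolP; apply: disc_le h => //; rewrite leq_add2l.
have wpos i : 0 <= w k j i by exact: level_wt_ge0.
elim: m => [|m IH] mk.
  by rewrite mul0r sumr_ge0 // => i _; exact: level_wt_ge0.
rewrite (bigID (P m)) /= -addn1 natrD mulrDl addrC lerD //.
  apply: le_trans (IH (ltnW mk)) _; rewrite le_eqVlt; apply/orP; left; apply/eqP.
  apply: eq_bigl => i; rewrite -/(P 0%N i) -/(P m i) -/(P (m + 1)%N i) -andbA.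
  congr (_ && _); case: (boolP (P m i)) => h; rewrite ?andbF //= andbT.
  by apply/esym/negP => /(sub m _ _ (leq_addr _ _)); apply/negP.
rewrite addn1.
pose pL : R := p%:R ^- (l0 + k).
have pL0 : 0 < pL by exact: pXV_gt0.
pose A : R := p%:R ^+ (l0 + m); have A0 : 0 < A by rewrite exprn_gt0 // p_gt0.
have lower i : P m i -> ~~ P m.+1 i -> 2^-1 * A * pL <= w k j i.
  move=> /asboolP Pm Pm1.
  have ij : j != i.
    by apply: contraNneq Pm1 => <-; apply/asboolP; exact: disc_center.
  have lji : lab k i = lab k j.
    apply: (U_disj U_adm (ld_U (ld k) (disc_center p_prime _ _))).
    apply: (discU (l := (l0 + m)%N) _ _ Pm); first exact: leq_addr.
    exact: (ld_U (ld k) (disc_center p_prime _ _)).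
  rewrite /level_wt /cell_wt /cell_kernel ij lji loops /= ler_wpM2r ?(ltW pL0) // ler_wpM2l ?invr_ge0 //.
  apply: kernel_lower; first exact: (cell_dist_gt0 p_prime (ld k)).
  by rewrite qabsBC.
(* the measure of the annulus between the two discs *)
have T : \sum_(i | P m i && ~~ P m.+1 i) pL = A^-1 - A^-1 / p%:R.
  have cm : \sum_(i | P m i) pL = A^-1 := count_cells j (ltnW mk).
  have cm1 : \sum_(i | P m.+1 i) pL = A^-1 / p%:R.
    by rewrite /pL (count_cells j mk) addnS exprS invfM mulrC.
  rewrite -cm1 -cm (bigID (P m.+1) (P m)) /= addrC.
  rewrite [X in _ = _ + X - _](eq_bigl (P m.+1)) ?addrK // => i.
  by case: (boolP (P m.+1 i)) => [/(sub _ _ _ (leqnSn m)) ->|]; rewrite ?andbF.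
apply: (@le_trans _ _ (\sum_(i | P m i && ~~ P m.+1 i) 2^-1 * A * pL)).
  rewrite -mulr_sumr T.
  have -> : 2^-1 * A * (A^-1 - A^-1 / p%:R) = 2^-1 - 2^-1 * p%:R^-1.
    by rewrite -mulrA mulrBr mulrA mulfV ?gt_eqF // mul1r mulrBr mulr1.
  have : (p%:R^-1 : R) <= 2^-1.
    by rewrite lef_pV2 ?posrE ?p_gt0 // ler_nat prime_gt1.
  by lra.
rewrite [leRHS](eq_bigl (fun i => P m i && ~~ P m.+1 i)).
  by apply: ler_sum => i /andP[]; exact: lower.
move=> i; rewrite -/(P 0%N i) -/(P m i) -/(P m.+1 i).
by case: (boolP (P m i)) => [/(sub _ _ _ (leq0n m)) ->|]; rewrite ?andbF ?andbT.
Qed.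

(** An eigenvector at one level orthogonal to the coarser level has mean zero over
   each coarse cell, and the kernel is constant on a coarse cell not containing the
   base point. Far cells therefore act by multiplication with their total weight.
   At a cell where the modulus of the eigenvector is maximal, the near cells only
   add a nonnegative term. *)
Lemma eigenvalue_lower k (a : 'rV[R[i]]_(n k.+1)) (nu : R) : a != 0 ->
  a *m (Q k)^t* = 0 -> a *m M k.+1 = nu%:C *: a -> k%:R / 4 <= nu.
Proof.
move=> a0 aQ aM.
have [j1 aj1] : exists j, a 0 j != 0.
  apply/existsP; rewrite -negb_forall; apply: contraNN a0 => /forallP h.
  by apply/eqP/rowP => j; rewrite mxE; apply/eqP; have := h j; case: (a 0 j == 0).
case: (Order.TotalTheory.arg_maxP (fun j => nsq (a 0 j)) (isT : xpredT j1)) => j _ jmax.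
set z := a 0 j; have z0 : 0 < nsq z.
  apply: lt_le_trans (jmax j1 isT); rewrite lt_neqAle nsq_ge0 andbT eq_sym.
  by apply: contra aj1 => /eqP/nsq_eq0/eqP.
pose wt i := w k.+1 j i; have wt0 i : 0 <= wt i by exact: level_wt_ge0.
pose near i := `[< disc (l0 + k) (c k.+1 j) (c k.+1 i) >].
have mean I : \sum_(i | `[< disc (l0 + k) (c k I) (c k.+1 i) >]) a 0 i = 0.
  have /rowP/(_ I) := aQ; rewrite !mxE => h.
  have s0 : (Num.sqrt (p%:R ^+ (l0 + k)) / Num.sqrt (p%:R ^+ (l0 + k.+1)))%:C != 0 :> R[i].
    apply/eqP => -[] /eqP; rewrite mulf_eq0 invr_eq0 !sqrtr_eq0.
    by rewrite !leNgt !exprn_gt0 // p_gt0.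
  apply: (mulfI s0); rewrite mulr0 -[RHS]h big_mkcond mulr_sumr.
  apply: eq_bigr => i _; rewrite !mxE conjcM conjc_real rmorph_nat.
  by case: asboolP => _; rewrite ?mulr0 ?mulr1 // mulrC.
(* the weights of far cells factor through the coarse cells, over which [a] has mean zero *)
have far0 : \sum_(i | ~~ near i) (wt i)%:C * a 0 i = 0.
  have [par hpar] : exists par : 'I_(n k.+1) -> 'I_(n k),
      forall i, disc (l0 + k) (c k (par i)) (c k.+1 i).
    have h i : exists I, disc (l0 + k) (c k I) (c k.+1 i).
      exact: (ld_cov (ld k) (c_OmV p_prime (ld k.+1) i)).
    by have [par ?] := choice h; exists par.
  have nearE i : near i = (par i == par j).
    apply/asboolP/eqP => [ji|ij].
      apply: (cell_uniq p_prime (ld k) (hpar i)).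
      by rewrite (disc_eq (hpar j)) in ji.
    by rewrite (disc_eq (hpar j)) -ij; exact: hpar.
  (* the weight of a far cell depends only on the coarse cell that contains it *)
  pose W I : R := if e (lab k.+1 j) (lab k I)
    then 2^-1 * (qabs (c k.+1 j - c k I) `^ (- alpha)) ^+ 2 * p%:R ^- (l0 + k.+1) else 0.
  have wE i : ~~ near i -> wt i = W (par i).
    move=> ni; have ij : j != i.
      by apply: contraNneq ni => <-; apply/asboolP; exact: disc_center.
    have li : lab k (par i) = lab k.+1 i.
      apply: (U_disj U_adm (ld_U (ld k) (hpar i))).
      exact: (ld_U (ld k.+1) (disc_center p_prime _ _)).
    have di : qabs (c k.+1 j - c k.+1 i) = qabs (c k.+1 j - c k (par i)).
      rewrite qabsBC [RHS]qabsBC; apply: disc_out (hpar i) => ji.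
      move: ni; rewrite nearE (cell_uniq p_prime (ld k) ji (hpar j)) eqxx //.
    rewrite /wt /level_wt /cell_wt /cell_kernel ij /= /W li di.
    by case: ifP => // _; rewrite expr0n mulr0 mul0r.
  rewrite (eq_bigr (fun i => (W (par i))%:C * a 0 i)); last by move=> i /wE ->.
  rewrite (eq_bigl (fun i => par i != par j)); last by move=> i; rewrite nearE.
  rewrite (partition_big par (fun I => I != par j)) //= big1 // => I Ij.
  rewrite (eq_bigr (fun i => (W I)%:C * a 0 i)); last by move=> i /andP[_ /eqP ->].
  have I0 : \sum_(i | (par i != par j) && (par i == I)) a 0 i = 0.
    rewrite -[RHS](mean I); apply: eq_bigl => i.
    apply/andP/asboolP => [[_ /eqP <-] //|Ii].
    by have pI := cell_uniq p_prime (ld k) (hpar i) Ii; rewrite pI.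
  by rewrite -mulr_sumr I0 mulr0.
have eqn : nu%:C * z = \sum_i (wt i)%:C * (z - a 0 i).
  have /rowP/(_ j) := aM; rewrite [RHS]mxE -/z => <-.
  have sy : forall i i' : 'I_(n k.+1), w k.+1 i i' = w k.+1 i' i by move=> i i'; exact: level_wt_sym.
  by rewrite (lapE sy).
have main : nu * nsq z = \sum_i wt i * (nsq z - complex.Re (a 0 i * z^*)).
  have := congr1 (fun y => complex.Re (y * z^*)) eqn.
  rewrite -mulrA mulcJ -rmorphM ReC => ->.
  rewrite mulr_suml Re_sum; apply: eq_bigr => i _.
  rewrite -mulrA mulrBl mulcJ; set y := a 0 i * _.
  by rewrite !ReImE mul0r subr0.
rewrite -(ler_pM2r z0) main (bigID near) /=.
have h1 : 0 <= \sum_(i | near i) wt i * (nsq z - complex.Re (a 0 i * z^*)).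
  apply: sumr_ge0 => i _; rewrite mulr_ge0 // subr_ge0.
  have := jmax i isT; rewrite /nsq /= -/z !ReImE => h.
  have := sqr_ge0 (complex.Re (a 0 i) - complex.Re z).
  have := sqr_ge0 (complex.Im (a 0 i) - complex.Im z).
  by move: h; nra.
have h2 : \sum_(i | ~~ near i) wt i * (nsq z - complex.Re (a 0 i * z^*)) =
    (\sum_(i | ~~ near i) wt i) * nsq z.
  under eq_bigr do rewrite mulrBr; rewrite sumrB mulr_suml.
  suff -> : \sum_(i | ~~ near i) wt i * complex.Re (a 0 i * z^*) = 0 by rewrite subr0.
  transitivity (complex.Re ((\sum_(i | ~~ near i) (wt i)%:C * a 0 i) * z^*)).
    rewrite mulr_suml -[X in complex.Re X]big_filter Re_sum big_filter.
    by apply: eq_bigr => i _; rewrite -mulrA [in RHS]ReM ReC ImC mul0r subr0.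
  by rewrite far0 mul0r.
rewrite h2; apply: (@le_trans _ _ ((\sum_(i | ~~ near i) wt i) * nsq z)); last by rewrite lerDr.
rewrite ler_wpM2r ?(ltW z0) //; apply: le_trans (far_weight j (leqnSn k)) _.
rewrite big_mkcond [leRHS]big_mkcond; apply: ler_sum => i _.
by rewrite /near; do 2 case: asboolP => //=.
Qed.

Lemma cells_number k : exists2 K : R, 0 <= K & (n k)%:R = K * p%:R ^+ (l0 + k) /\ mu (OmV U) = K%:E.
Proof.
have p0 : (p%:R ^+ (l0 + k) : R) != 0 by rewrite gt_eqF // exprn_gt0 // p_gt0.
exists ((n k)%:R * p%:R ^- (l0 + k)); first by rewrite mulr_ge0 // invr_ge0 exprn_ge0.
split; first by rewrite mulfVK.
rewrite (mu_cells p_prime mu_haar (ld k)) //; last 2 first.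
- exact: OmV_measurable.
- by move=> i; left; exact: (cell_OmV (ld k)).
rewrite (eq_bigl xpredT) ?sumr_const ?card_ord ?mulr_natl // => i.
by apply/asboolP; exact: (cell_OmV (ld k)).
Qed.

(** The number of cells grows like [p^k], whereas an eigenvalue at level [k + 1]
   contributes at most [exp (- t k / 4)]. For [t] at least [4 ln (2 p)] the level
   sums decay geometrically. *)
Lemma trace_D_finite (kk : nat -> nat) (E : forall l, 'M[R[i]]_(kk l, n l))
    (lam : forall l, 'I_(kk l) -> R) :
  (forall l i, 0 <= lam l i) -> (forall l, E l *m (E l)^t* = 1%:M) ->
  (forall l i, row i (E l) *m M l = (lam l i)%:C *: row i (E l)) ->
  (forall l, E l.+1 *m (Q l)^t* = 0) ->
  \forall t \near +oo,
    (\esum_(x in [set: {l & 'I_(kk l)}]) (expR (- lam (tag x) (tagged x) * t))%:E < +oo)%E.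
Proof.
move=> lam0 EE EM EQ; have [K K0 [_ muK]] := cells_number 0.
have p0 : (0 : R) < p%:R by exact: p_gt0.
have nE k : (n k)%:R = K * p%:R ^+ (l0 + k).
  by have [K' _ [-> hK']] := cells_number k; move: hK'; rewrite muK => -[->].
have kn l : (kk l)%:R <= (n l)%:R :> R by rewrite ler_nat; exact: mulmx1_min (EE l).
near=> t; have t0 : 4 * ln (2 * p%:R) <= t.
  by near: t; apply: nbhs_pinfty_ge; rewrite num_real.
have t1 : 0 <= t by near: t; apply: nbhs_pinfty_ge; rewrite num_real.
apply: (@le_lt_trans _ _ (2 * (2 * K * p%:R ^+ l0.+1))%:E); last exact: ltry.
apply: (esum_levels (a := fun l i => expR (- lam l i * t))) => [l i|[|k]].
- exact: expR_ge0.
- rewrite expr0 mulr1; apply: (@le_trans _ _ (\sum_(i < kk 0%N) 1)).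
    by apply: ler_sum => i _; rewrite -expR0 ler_expR mulNr oppr_le0 mulr_ge0.
  rewrite sumr_const card_ord; apply: (le_trans (kn 0%N)).
  rewrite nE addn0 exprS mulrA; apply: ler_wpM2r; first by rewrite exprn_ge0 ?ltW.
  have p1 : 1 <= p%:R :> R by rewrite ler1n prime_gt0.
  by nra.
apply: (@le_trans _ _ (\sum_(i < kk k.+1) (2 * p%:R) ^- k)).
  apply: ler_sum => i _.
  have p20 : 0 < 2 * p%:R :> R by rewrite mulr_gt0.
  rewrite -(lnK (x := (2 * p%:R) ^- k)) ?posrE ?invr_gt0 ?exprn_gt0 // ler_expR.
  rewrite lnV ?posrE ?exprn_gt0 // lnXn // mulNr lerN2.
  have ki : k%:R / 4 <= lam k.+1 i.
    apply: (@eigenvalue_lower k (row i (E k.+1))); last exact: EM.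
      apply/eqP => r0; have /matrixP/(_ i i) := EE k.+1.
      have /rowP r0' := r0; rewrite !mxE eqxx big1 => [/esym/eqP|j _]; first by rewrite oner_eq0.
      by have := r0' j; rewrite !mxE => ->; rewrite mul0r.
    by rewrite -row_mul EQ row0.
  apply: (@le_trans _ _ (k%:R / 4 * t)); last exact: ler_wpM2r.
  rewrite -[leLHS]mulr_natl -mulrA; apply: ler_wpM2l => //.
  by move: t0; lra.
rewrite sumr_const card_ord -[leLHS]mulr_natl.
apply: (@le_trans _ _ ((n k.+1)%:R * (2 * p%:R) ^- k)).
  by rewrite ler_wpM2r // invr_ge0 exprn_ge0 // mulr_ge0 // ltW.
rewrite nE addnS -addSn exprD exprMn invfM le_eqVlt; apply/orP; left; apply/eqP.
have pk : (p%:R ^+ k : R) != 0 by rewrite expf_neq0 // gt_eqF.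
have k2 : (2 ^+ k : R) != 0 by rewrite expf_neq0.
rewrite exprVn (exprS 2 k) (exprS p%:R l0); move: pk k2; set x := p%:R ^+ k; set y := 2 ^+ k => x0 y0.
by field; rewrite x0 y0.
Unshelve. all: by end_near. Qed.
End eigenvalue_growth.

(** * Finite-dimensional operators *)

Section finite_dimensional_operator.
Context {T : Type} {R : realType}.
Local Notation C := (R[i]).
Local Notation fn := (T -> C).
Variables (H : set fn) (ip : fn -> fn -> C) (A : set (fn * fn)).
Hypothesis ph : pre_hilbert H ip.
Local Notation q := (sqnorm ip).
Variables (n : nat) (b : 'I_n -> fn) (M : 'M[C]_n).
Hypothesis Hb : forall i, H (b i).
Hypothesis onb : forall i j, ip (b i) (b j) = (i == j)%:R.
Hypothesis Mherm : M^t* = M.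
Hypothesis Mpsd : forall c : 'rV_n, 0 <= (c *m M *m c^t*) 0 0.
Hypothesis span : forall g, H g -> exists c : 'rV_n, q (fun x => g x - lc c b x) = 0.
Hypothesis AM : forall c : 'rV_n, A (lc c b, lc (c *m M) b).
Hypothesis A_M : forall f g, A (f, g) -> [/\ H f, H g & exists c : 'rV_n,
  q (fun x => f x - lc c b x) = 0 /\ q (fun x => g x - lc (c *m M) b x) = 0].

Let Hlc (c : 'rV_n) : H (lc c b). Proof. exact: (H_lc ph). Qed.

Lemma q0_ip f f' g g' : H f -> H f' -> H g -> H g' ->
  q (fun x => f x - f' x) = 0 -> q (fun x => g x - g' x) = 0 -> ip f g = ip f' g'.
Proof.
move=> Hf Hf' Hg Hg' f0 g0; transitivity (ip f' g).
  apply/eqP; rewrite -subr_eq0 -(ip_subl ph) //; apply/eqP.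
  by apply: (q0_ipl ph) => //; exact: (H_sub ph).
rewrite (ph_ipC ph Hg Hf') (ph_ipC ph Hg' Hf'); congr (_ ^*).
apply/eqP; rewrite -subr_eq0 -(ip_subl ph) //; apply/eqP.
by apply: (q0_ipl ph) => //; exact: (H_sub ph).
Qed.

Lemma finite_sym : sym_graph ip A.
Proof.
move=> f g f' g' /A_M[Hf Hg [c [fc gc]]] /A_M[Hf' Hg' [d [fd gd]]].
rewrite (q0_ip Hg (Hlc (c *m M)) Hf' (Hlc d)) // (q0_ip Hf (Hlc c) Hg' (Hlc (d *m M))) //.
by rewrite !(ip_lc ph Hb onb) adj_mul Mherm mulmxA.
Qed.

(** The spectral theorem with nothing to split off. *)
Lemma finite_eigen : exists k (E : 'M[C]_(k, n)) (lam : 'I_k -> R),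
  [/\ forall i, 0 <= lam i, forall i, row i E *m M = (lam i)%:C *: row i E &
      eigenbasis H ip A lam (fun i => lc (row i E) b)].
Proof.
have [|||k [E [d [EE _ EM EE' dr]]]] :=
  spectral_complement (M := M) (M' := 0) (Q := (0 : 'M[C]_(0%N, n))).
- exact: Mherm.
- by apply/matrixP => - [].
- by apply/matrixP => - [].
pose lam i : R := complex.Re (d 0 i).
have lamE i : d 0 i = (lam i)%:C by have /complex_realP[r hr] := dr i; rewrite /lam hr.
have rM i : row i E *m M = (lam i)%:C *: row i E.
  by rewrite -row_mul EM -lamE; apply/rowP => j; rewrite mul_diag_mx !mxE.
have EEij i j : (row i E *m (row j E)^t*) 0 0 = (i == j)%:R.
  have /matrixP/(_ i j) := EE; rewrite [RHS]mxE => <-; rewrite !mxE.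
  by apply: eq_bigr => r _; rewrite !mxE.
exists k, E, lam; split => //.
  by move=> i; have := Mpsd (row i E); rewrite rM -scalemxAl mxE EEij eqxx mulr1 ler0c.
split => //.
- move=> i; have := AM (row i E); rewrite rM.
  by congr A; congr pair; apply/funext => x; rewrite lcZ.
- by move=> i j; rewrite (ip_lc ph Hb onb).
move=> g /span[c c0] eps e0.
exists (index_enum 'I_k), (fun i => (c *m E^t*) 0 i) => /=.
rewrite (_ : (fun x => _) = fun x => g x - lc c b x); first by rewrite [ltLHS]c0.
apply/funext => x; rewrite -[in RHS](mulmx1 c) -EE'.
rewrite trmx0 map_mx0 mul0mx addr0.
by rewrite mulmxA lc_mul lcE.
Qed.

End finite_dimensional_operator.

Lemma finite_trace (R : realType) k (lam : 'I_k -> R) t :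
  (\esum_(i in [set: 'I_k]) (expR (- lam i * t))%:E < +oo)%E.
Proof.
have fin : finite_set [set: 'I_k] by exact: finite_finset.
rewrite (esum_fset fin) => [|i _]; last by rewrite lee_fin expR_ge0.
by rewrite fsbig_finite //= sumEFin ltry.
Qed.

(** * The edge Laplacian *)

Section edge_laplacian.
Context {R : realType} {p : nat} {F : padicField R p}.
Hypothesis p_prime : prime p.
Variable mu : {sigma_finite_measure set (Qp F) -> \bar R}.
Hypothesis mu_haar : is_haar mu.
Context {V : finType}.
Variables (e : rel V) (U : V -> set (Qp F)) (alpha : R).
Hypothesis e_sym : symmetric e.
Hypothesis U_adm : admissible_sets U.
Variable o : 'I_#|edges (loopless e)| -> V * V.
Hypothesis o_ne : forall i, (o i).1 != (o i).2.
Hypothesis o_e : forall i, e (o i).1 (o i).2.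
Hypothesis o_set : forall i, enum_val i = [set (o i).1; (o i).2]%SET.
Hypothesis o_surj : forall u v, u != v -> e u v -> exists i, o i = (u, v) \/ o i = (v, u).

Local Notation m := #|edges (loopless e)|.
Local Notation mE := (OmE_measurable e U_adm).
Local Notation muv := (muU mu U).
Local Notation B := (incidence (R := R) o).

Lemma o_inj i j a b : o i = (a, b) \/ o i = (b, a) -> o j = (a, b) \/ o j = (b, a) -> i = j.
Proof.
move=> hi hj; apply: enum_val_inj; rewrite !o_set.
by case: hi => ->; case: hj => -> //=; rewrite finset.setUC.
Qed.

Definition edge_sgn i a b : R := (o i == (a, b))%:R - (o i == (b, a))%:R.
(** The L^2 norm of the difference of the indicators of the two opposite blocks. *)
Definition edge_norm i : R := Num.sqrt (2 * muv (o i).1 * muv (o i).2).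
(** The antisymmetric functions constant on blocks have one such basis vector for
   each edge that is not a loop; on the block of a loop antisymmetry forces a
   constant to vanish. *)
Definition edge_fn i : Qp F * Qp F -> R[i] := fun z =>
  ((edge_norm i)^-1)%:C * (cind (U (o i).1 `*` U (o i).2) z - cind (U (o i).2 `*` U (o i).1) z).

Lemma edge_norm_sqr i : edge_norm i ^+ 2 = 2 * muv (o i).1 * muv (o i).2.
Proof. by rewrite sqr_sqrtr // !mulr_ge0 // ltW // muU_gt0. Qed.
Lemma edge_norm_gt0 i : 0 < edge_norm i.
Proof. by rewrite sqrtr_gt0 !mulr_gt0 // muU_gt0. Qed.

Lemma edge_sgnN i a b : edge_sgn i b a = - edge_sgn i a b. Proof. by rewrite opprB. Qed.

Lemma edge_fn_block i a b x y : U a x -> U b y -> edge_fn i (x, y) = ((edge_norm i)^-1 * edge_sgn i a b)%:C.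
Proof.
move=> ax y_b; rewrite rmorphM /= /edge_fn /edge_sgn rmorphB /= /cind; congr (_ * (_ - _)); congr (_%:C).
  rewrite indicE; congr (_%:R); congr nat_of_bool; apply/idP/eqP.
    by rewrite in_setX => /andP[/set_mem h1 /set_mem h2]; rewrite (U_disj U_adm ax h1) (U_disj U_adm y_b h2); case: (o i).
  by move=> ->; apply/mem_set.
rewrite indicE; congr (_%:R); congr nat_of_bool; apply/idP/eqP.
  by rewrite in_setX => /andP[/set_mem h1 /set_mem h2]; rewrite (U_disj U_adm ax h1) (U_disj U_adm y_b h2); case: (o i).
by move=> ->; apply/mem_set.
Qed.

Definition on_blocks (f : V -> V -> R[i]) (h : Qp F * Qp F -> R[i]) :=
  forall a b x y, e a b -> U a x -> U b y -> h (x, y) = f a b.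

Lemma on_blocks_sum f h z : on_blocks f h -> OmE e U z -> h z =
  \sum_ab (if e ab.1 ab.2 then f ab.1 ab.2 else 0) * cind (U ab.1 `*` U ab.2) z.
Proof.
case: z => x y hf [a [b [ab /= ax y_b]]]; rewrite (hf a b) //.
rewrite (bigD1 (a, b)) //= ab {1}/cind indicE mem_set // mulr1 big1 ?addr0 // => -[a' b'] ne.
rewrite /cind indicE memNset ?mulr0 //= => -[/= a'x b'y]; move: ne.
by rewrite (U_disj U_adm ax a'x) (U_disj U_adm y_b b'y) eqxx.
Qed.

Lemma block_mu ab : mu2 mu (U ab.1 `*` U ab.2) = (muv ab.1 * muv ab.2)%:E.
Proof.
rewrite mu2_prod; [|exact: U_measurable|exact: U_measurable].
by rewrite !(muUE p_prime mu_haar U_adm).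
Qed.

Lemma block_measurable (ab : V * V) : measurable (U ab.1 `*` U ab.2).
Proof. by apply: measurableX; exact: U_measurable. Qed.

Lemma on_blocks_L2 f h : on_blocks f h -> L2 (mu2 mu) (OmE e U) h.
Proof.
move=> hf; apply: (L2_step mE (P := fun ab => U ab.1 `*` U ab.2)
  (a := fun ab => if e ab.1 ab.2 then f ab.1 ab.2 else 0)).
- exact: block_measurable.
- by move=> ab; rewrite block_mu ltry.
- by move=> z; exact: on_blocks_sum.
Qed.

Lemma on_blocks_ip f h g k : on_blocks f h -> on_blocks g k -> L2ip (mu2 mu) (OmE e U) h k =
  \sum_ab (if e ab.1 ab.2 then f ab.1 ab.2 * (g ab.1 ab.2)^* else 0) *
    (muv ab.1 * muv ab.2)%:C.
Proof.
move=> hf kg; rewrite /L2ip (cintegral_step mE (P := fun ab => U ab.1 `*` U ab.2)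
  (a := fun ab => if e ab.1 ab.2 then f ab.1 ab.2 * (g ab.1 ab.2)^* else 0)).
- by apply: eq_bigr => ab _; rewrite block_mu.
- exact: block_measurable.
- by move=> ab; rewrite block_mu ltry.
- move=> [a b] /=; case: ifP => [ab _ z [az bz]|]; last by rewrite eqxx.
  by exists a, b.
move=> z zE; rewrite -(on_blocks_sum (f := fun a b => f a b * (g a b)^*) (h := fun z => h z * (k z)^*)) //.
by move=> a b x y ab ax y_b; rewrite (hf a b) // (kg a b).
Qed.

Lemma edge_fn_on_blocks i : on_blocks (fun a b => ((edge_norm i)^-1 * edge_sgn i a b)%:C) (edge_fn i).
Proof. by move=> a b x y _; exact: edge_fn_block. Qed.

Definition block_val (c : 'rV[R[i]]_m) a b := \sum_i c 0 i * ((edge_norm i)^-1 * edge_sgn i a b)%:C.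

Lemma block_val_block c a b x y : U a x -> U b y -> lc c edge_fn (x, y) = block_val c a b.
Proof. by move=> ax y_b; rewrite lcE; apply: eq_bigr => i _; rewrite (edge_fn_block _ ax y_b). Qed.

Lemma block_valN c a b : block_val c b a = - block_val c a b.
Proof.
by rewrite /block_val -sumrN; apply: eq_bigr => i _; rewrite edge_sgnN mulrN rmorphN mulrN.
Qed.

Lemma block_val_loop c a : block_val c a a = 0.
Proof. by rewrite /block_val big1 // => i _; rewrite /edge_sgn subrr mulr0 [_%:C]rmorph0 mulr0. Qed.

Lemma edge_sgn_other i j a b : o i = (a, b) -> j != i -> edge_sgn j a b = 0.
Proof.
move=> oi ji; rewrite /edge_sgn.
have [oj|_] := eqVneq (o j) (a, b); first by rewrite (o_inj (or_introl oj) (or_introl oi)) eqxx in ji.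
have [oj|_] := eqVneq (o j) (b, a); last by rewrite subrr.
by rewrite (o_inj (or_intror oj) (or_introl oi)) eqxx in ji.
Qed.

Lemma edge_sgn_self i : edge_sgn i (o i).1 (o i).2 = 1.
Proof.
rewrite /edge_sgn -surjective_pairing eqxx; case: eqP => [h|]; last by rewrite subr0.
by have := o_ne i; rewrite [in X in X == _]h eqxx.
Qed.

Lemma block_val_o c i : block_val c (o i).1 (o i).2 = c 0 i * ((edge_norm i)^-1)%:C.
Proof.
rewrite /block_val (bigD1 i) //= edge_sgn_self mulr1 big1 ?addr0 // => j ji.
by rewrite (edge_sgn_other (i := i)) // ?mulr0 ?[_%:C]rmorph0 ?mulr0 //; case: (o i).
Qed.

(** An edge function lives on its block and on the opposite one. *)
Lemma edge_sgn_sum i (f : V * V -> R) : \sum_ab (edge_sgn i ab.1 ab.2) ^+ 2 * f ab =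
  f (o i) + f ((o i).2, (o i).1).
Proof.
have ne : ((o i).2, (o i).1) != o i.
  by rewrite -pair_eqE /= negb_and eq_sym o_ne.
rewrite (bigD1 (o i)) //= edge_sgn_self expr1n mul1r; congr (_ + _).
rewrite (bigD1 ((o i).2, (o i).1)) //= edge_sgnN edge_sgn_self sqrrN expr1n mul1r big1 ?addr0 //.
move=> [a b] /andP[/= h1 h2]; rewrite /edge_sgn eq_sym (negPf h1).
case: eqP => [h|]; last by rewrite subrr expr0n mul0r.
by rewrite h eqxx in h2.
Qed.

Lemma edge_fn_on i j : L2ip (mu2 mu) (OmE e U) (edge_fn i) (edge_fn j) = (i == j)%:R.
Proof.
rewrite (on_blocks_ip (edge_fn_on_blocks i) (edge_fn_on_blocks j)); have [->{i}|ij] := eqVneq i j; last first.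
  have ji : j != i by rewrite eq_sym.
  rewrite big1 // => -[a b] _ /=; case: ifP => _; last by rewrite mul0r.
  rewrite conjc_real -rmorphM /=.
  have [oi|oi] := eqVneq (o i) (a, b).
    by rewrite (edge_sgn_other oi ji) !mulr0 [_%:C]rmorph0 mul0r.
  have [oi'|oi'] := eqVneq (o i) (b, a).
    by rewrite -[edge_sgn j a b]opprK -edge_sgnN (edge_sgn_other oi' ji) oppr0 !mulr0 [_%:C]rmorph0 mul0r.
  by rewrite /edge_sgn (negPf oi) (negPf oi') subrr mulr0 mul0r [_%:C]rmorph0 mul0r.
transitivity (\sum_ab ((edge_norm j)^-1 ^+ 2 * ((edge_sgn j ab.1 ab.2) ^+ 2 * (muv ab.1 * muv ab.2)))%:C).
  apply: eq_bigr => -[a b] _ /=; case: ifP => [_|ab].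
    by rewrite conjc_real -!rmorphM; congr (_%:C); ring.
  rewrite mul0r /edge_sgn.
  have -> : (o j == (a, b)) = false.
    by apply/negP => /eqP h; have := o_e j; rewrite h /= ab.
  have -> : (o j == (b, a)) = false.
    by apply/negP => /eqP h; have := o_e j; rewrite h /= e_sym ab.
  by rewrite subrr expr0n mul0r mulr0 [_%:C]rmorph0.
rewrite -rmorph_sum -mulr_sumr edge_sgn_sum /=.
rewrite (_ : _ * _ = 1) ?[_%:C]rmorph1 //.
have := edge_norm_sqr j; have n0 : edge_norm j != 0 by rewrite gt_eqF // edge_norm_gt0.
set x := muv _; set y := muv _ => h.
have -> : x * y + y * x = edge_norm j ^+ 2 by rewrite h; ring.
by rewrite -exprMn mulVf // expr1n.
Qed.

Lemma lc_L2rho c : L2rho mu e U (lc c edge_fn).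
Proof.
split.
- apply: (on_blocks_L2 (f := block_val c)) => a b x y _; exact: block_val_block.
- move=> x y [a [b [ab /= ax y_b]]].
  by rewrite (block_val_block c ax y_b) (block_val_block c y_b ax) block_valN.
- by move=> a b ab [x y] [x' y'] [/= ax y_b] [/= ax' y_b']; rewrite !(block_val_block c (a := a) (b := b)).
Qed.

(** Antisymmetry determines a block constant on each block from the oriented one,
   and kills it on the blocks of loops. *)
Lemma L2rho_lc h : L2rho mu e U h -> exists c, forall z, OmE e U z -> h z = lc c edge_fn z.
Proof.
move=> [_ anti const]; have [pt hpt] := choice (U_pt U_adm).
exists (\row_i ((edge_norm i)%:C * h (pt (o i).1, pt (o i).2))).
move=> [x y] [a [b [ab /= ax y_b]]]; rewrite (block_val_block _ ax y_b).
have on_blocks_pt a' b' x' y' : e a' b' -> U a' x' -> U b' y' -> h (x', y') = h (pt a', pt b').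
  by move=> ab' ax' y_b'; apply: (const a' b').
have n0 i : (edge_norm i)%:C * ((edge_norm i)^-1)%:C = 1 :> R[i].
  by rewrite -rmorphM mulfV ?rmorph1 // gt_eqF // edge_norm_gt0.
have block_val_pt i : block_val (\row_i ((edge_norm i)%:C * h (pt (o i).1, pt (o i).2))) (o i).1 (o i).2 =
    h (pt (o i).1, pt (o i).2) by rewrite block_val_o mxE mulrAC n0 mul1r.
have [ab'|ne] := eqVneq a b.
  subst b; rewrite block_val_loop; have := anti x y (ex_intro _ a (ex_intro _ a (And3 ab ax y_b))).
  rewrite (on_blocks_pt a a) // [in RHS](on_blocks_pt a a) // => /eqP.
  by rewrite -addr_eq0 -mulr2n mulrn_eq0 => /eqP.
have [i [oi|oi]] := o_surj ne ab.
  by have := block_val_pt i; rewrite oi /= => ->; exact: on_blocks_pt.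
rewrite block_valN; have := block_val_pt i; rewrite oi /= => ->.
rewrite anti; last by exists a, b.
by congr (- _); apply: on_blocks_pt => //; rewrite e_sym.
Qed.

Lemma L2rho_ph : pre_hilbert (L2rho mu e U) (L2ip (mu2 mu) (OmE e U)).
Proof.
apply: (pre_hilbert_sub (L2_pre_hilbert (mu2 mu) mE)).
- by move=> h [].
- by have := lc_L2rho 0; rewrite lc0.
move=> a f g [Lf af cf] [Lg ag cg]; split.
- exact: (ph_lin (L2_pre_hilbert (mu2 mu) mE)).
- by move=> x y xy; rewrite (af x y xy) (ag x y xy); ring.
- by move=> v w vw z z' hz hz'; rewrite (cf v w vw z z') // (cg v w vw z z').
Qed.

(** In the orthonormal basis [edge_fn], the gradient and, up to the measures of the
   vertex sets, the divergence are the incidence matrix and its transpose scaled by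
   this same factor. *)
Definition edge_scale i : R := 2^-1 * edge_norm i * set_dist (U (o i).1) (U (o i).2) `^ (- alpha).
(** The matrix of the divergence, before division by the measures of the vertex
   sets. *)
Definition div_mx : 'M[R[i]]_(m, #|V|) := diag_mx (\row_i (edge_scale i)%:C) *m B.
Definition div_val (c : 'rV[R[i]]_m) u := (c *m div_mx) 0 (enum_rank u) * ((muv u)^-1)%:C.

Lemma edge_scale_gt0 i : 0 < edge_scale i.
Proof. by rewrite /edge_scale mulr_gt0 ?powR_gt0 ?set_dist_gt0 // mulr_gt0 ?edge_norm_gt0 ?invr_gt0. Qed.

Lemma div_mxE i k : div_mx i k = (edge_scale i)%:C * B i k.
Proof. by rewrite /div_mx mul_diag_mx !mxE. Qed.

Lemma set_distC a b : set_dist (U a) (U b) = set_dist (U b) (U a).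
Proof.
rewrite /set_dist; congr inf; apply/seteqP.
by split => r [x [y [h1 h2 ->]]]; exists y, x; rewrite qabsBC.
Qed.

Lemma edge_sgn_pick i u (f : V -> R) :
  \sum_w edge_sgn i u w * f w = (u == (o i).1)%:R * f (o i).2 - (u == (o i).2)%:R * f (o i).1.
Proof.
have pick (v : V) : \sum_w (v == w)%:R * f w = f v.
  rewrite (bigD1 v) //= eqxx mul1r big1 ?addr0 // => w wv.
  by rewrite eq_sym (negPf wv) mul0r.
under eq_bigr do rewrite /edge_sgn mulrBl.
rewrite sumrB; case: (o i) => v w /=; congr (_ - _).
  rewrite -[in RHS](pick w) mulr_sumr; apply: eq_bigr => w' _.
  by rewrite xpair_eqE eq_sym mulrA -natrM mulnb.
rewrite -[in RHS](pick v) mulr_sumr; apply: eq_bigr => w' _.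
by rewrite xpair_eqE [w == u]eq_sym andbC mulrA -natrM mulnb.
Qed.

Lemma div_edge_fn c h u x : (forall z, OmE e U z -> h z = lc c edge_fn z) -> U u x ->
  div mu e U alpha h x = div_val c u.
Proof.
move=> hc ux; rewrite /div (nbrE e U_adm ux).
pose D w := set_dist (U u) (U w) `^ (- alpha).
rewrite (cintegral_step (nbr_measurable e U_adm u) (P := U)
  (a := fun w => if e u w then block_val c u w * (D w)%:C else 0)).
- transitivity (\sum_w \sum_i c 0 i * ((edge_norm i)^-1 * (edge_sgn i u w * (D w * muv w)))%:C).
    apply: eq_bigr => w _; case: ifP => uw.
      rewrite -mulrA -rmorphM /block_val mulr_suml; apply: eq_bigr => i _.
      by rewrite -mulrA -rmorphM /= -/(muv w); congr (_ * _%:C); ring.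
    rewrite mul0r big1 // => i _; rewrite /edge_sgn.
    have -> : (o i == (u, w)) = false.
      by apply/negP => /eqP h'; have := o_e i; rewrite h' /= uw.
    have -> : (o i == (w, u)) = false.
      by apply/negP => /eqP h'; have := o_e i; rewrite h' /= e_sym uw.
    by rewrite subrr mul0r mulr0 [_%:C]rmorph0 mulr0.
  rewrite exchange_big /= /div_val mxE mulr_suml; apply: eq_bigr => i _.
  rewrite -mulr_sumr -rmorph_sum -mulr_sumr edge_sgn_pick div_mxE mxE enum_rankK.
  have -> : ((u == (o i).1)%:R - (u == (o i).2)%:R : R[i]) =
      ((u == (o i).1)%:R - (u == (o i).2)%:R)%:C by rewrite rmorphB !rmorph_nat.
  rewrite -mulrA -!rmorphM /=; congr (_ * _%:C).
  rewrite /edge_scale /D; have := edge_norm_sqr i; have n0 : edge_norm i != 0 by rewrite gt_eqF // edge_norm_gt0.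
  have n1 : muv (o i).1 != 0 by rewrite gt_eqF // muU_gt0.
  have n2 : muv (o i).2 != 0 by rewrite gt_eqF // muU_gt0.
  have [uv|uv] := eqVneq u (o i).1.
    rewrite -uv in n1 *; have /negPf -> : u != (o i).2 by rewrite uv o_ne.
    set d := _ `^ _ => h'; rewrite subr0 mul0r mul1r subr0 mulr1.
    have -> : muv (o i).2 = edge_norm i ^+ 2 / (2 * muv u) by rewrite h'; field.
    by field; rewrite n0 n1.
  have [uw|uw] := eqVneq u (o i).2; last by rewrite !mul0r subrr !mulr0 mul0r.
  rewrite [set_dist (U (o i).1) _]set_distC -uw in n2 *; set d := _ `^ _ => h'.
  rewrite mul0r mul1r !sub0r !mulrN mulr1.
  have -> : muv (o i).1 = edge_norm i ^+ 2 / (2 * muv u) by rewrite h'; field.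
  by field; rewrite n0 n2.
- exact: U_measurable.
- exact: (mu_U_fin p_prime mu_haar U_adm).
- by move=> w; case: ifP => [uw _ y wy|]; [exists w|rewrite eqxx].
move=> y [w uw wy]; rewrite (bigD1 w) //= uw {1}/cind indicE mem_set // mulr1.
rewrite big1 ?addr0; last first.
  move=> w' w'w; rewrite /cind indicE memNset ?mulr0 // => w'y.
  by move: w'w; rewrite (U_disj U_adm wy w'y) eqxx.
rewrite hc; last by exists u, w.
rewrite (block_val_block c ux wy); have [->|ne] := eqVneq u w; first by rewrite block_val_loop !mul0r.
by rewrite (U_dist U_adm ne ux wy).
Qed.

(** Splitting the division by the measure symmetrically exhibits the edge Laplacian
   as [K K^*], so that it is visibly hermitian and nonnegative. *)
Definition Delta_root : 'M[R[i]]_(m, #|V|) :=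
  \matrix_(i, k) (div_mx i k * ((Num.sqrt (muv (enum_val k)))^-1)%:C).
Definition Delta_mx := Delta_root *m Delta_root^t*.

Lemma Delta_rootE i k : Delta_root i k = div_mx i k * ((Num.sqrt (muv (enum_val k)))^-1)%:C.
Proof. by rewrite mxE. Qed.

Lemma mul_Delta_root c k : (c *m Delta_root) 0 k = div_val c (enum_val k) * (Num.sqrt (muv (enum_val k)))%:C.
Proof.
rewrite /div_val enum_valK mxE mulrAC mxE !mulr_suml; apply: eq_bigr => i _.
rewrite mxE; set r := Num.sqrt _.
have r0 : r != 0 by rewrite sqrtr_eq0 -ltNge muU_gt0.
have -> : muv (enum_val k) = r ^+ 2 by rewrite sqr_sqrtr // ltW // muU_gt0.
rewrite !mulrA -!mulrA -!rmorphM /=; congr (_ * (_ * _%:C)).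
by field.
Qed.

Lemma mul_Delta_mx c i : (c *m Delta_mx) 0 i = (edge_scale i)%:C * (div_val c (o i).1 - div_val c (o i).2).
Proof.
rewrite /Delta_mx mulmxA mxE -incidence_sum mulr_sumr; apply: eq_bigr => k _.
rewrite mul_Delta_root; set r := Num.sqrt _.
have r0 : r != 0 by rewrite sqrtr_eq0 -ltNge muU_gt0.
have -> : (Delta_root^t*) k i = div_mx i k * (r^-1)%:C.
  rewrite 2!mxE Delta_rootE div_mxE !conjcM !conjc_real; congr (_ * _ * _).
  by rewrite mxE rmorphB !rmorph_nat.
have h : r%:C * (r^-1)%:C = 1 :> R[i] by rewrite -rmorphM mulfV // rmorph1.
rewrite div_mxE; transitivity ((r%:C * (r^-1)%:C) * ((edge_scale i)%:C * (div_val c (enum_val k) * B i k))).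
  by ring.
by rewrite h mul1r.
Qed.

Lemma grad_div c h z : (forall z, OmE e U z -> h z = lc c edge_fn z) -> OmE e U z ->
  grad alpha (div mu e U alpha h) z = lc (c *m Delta_mx) edge_fn z.
Proof.
move=> hc.
have main i x y : U (o i).1 x -> U (o i).2 y ->
    grad alpha (div mu e U alpha h) (x, y) = lc (c *m Delta_mx) edge_fn (x, y).
  move=> vx wy; rewrite (block_val_block _ vx wy) block_val_o mul_Delta_mx /grad /= !(div_edge_fn hc vx) !(div_edge_fn hc wy).
  rewrite mulrAC mulrC; congr (_ * _); rewrite -rmorphM -fmorphV; congr (_%:C).
  rewrite (U_dist U_adm (o_ne i) vx wy) /edge_scale powRN.
  have n0 : edge_norm i != 0 by rewrite gt_eqF // edge_norm_gt0.
  have d0 : set_dist (U (o i).1) (U (o i).2) `^ alpha != 0.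
    by rewrite gt_eqF // powR_gt0 // set_dist_gt0.
  by field; rewrite n0 d0.
case: z => x y [a [b [ab /= ax y_b]]].
have [ab'|ne] := eqVneq a b.
  subst b; rewrite (block_val_block _ ax y_b) block_val_loop /grad /= (div_edge_fn hc ax) (div_edge_fn hc y_b).
  by rewrite subrr mul0r.
have [i [oi|oi]] := o_surj ne ab; have := main i; rewrite oi /= => mi; first exact: mi.
have -> : grad alpha (div mu e U alpha h) (x, y) = - grad alpha (div mu e U alpha h) (y, x).
  by rewrite /grad /= -mulNr opprB qabsBC.
by rewrite mi // (block_val_block _ y_b ax) (block_val_block _ ax y_b) block_valN opprK.
Qed.

Lemma Delta_mx_herm : Delta_mx^t* = Delta_mx.
Proof.
rewrite /Delta_mx adj_mul; congr (_ *m _).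
by apply/matrixP => i j; rewrite !mxE conjCK.
Qed.

Lemma Delta_mx_quad (c : 'rV[R[i]]_m) : (c *m Delta_mx *m c^t*) 0 0 = (\sum_k nsq ((c *m Delta_root) 0 k))%:C.
Proof.
rewrite /Delta_mx !mulmxA -mulmxA -adj_mul mxE rmorph_sum; apply: eq_bigr => k _.
by rewrite [X in _ * X = _]mxE [X in _ * X^* = _]mxE mulcJ.
Qed.

Lemma Delta_mx_psd (c : 'rV[R[i]]_m) : 0 <= (c *m Delta_mx *m c^t*) 0 0.
Proof. by rewrite Delta_mx_quad ler0c sumr_ge0 // => k _; exact: nsq_ge0. Qed.

Lemma Delta_mx_ker (c : 'rV[R[i]]_m) : c *m Delta_mx = 0 -> c *m div_mx = 0.
Proof.
move=> c0; have := Delta_mx_quad c; rewrite c0 mul0mx mxE => /(congr1 (@complex.Re R)) /= /esym/eqP.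
rewrite psumr_eq0 => [/allP h|k _]; last exact: nsq_ge0.
apply/rowP => k; rewrite [RHS]mxE.
have := h k (mem_index_enum _) => /eqP/nsq_eq0/eqP.
have r0 : ((Num.sqrt (muv (enum_val k)))%:C : R[i]) != 0.
  by rewrite fmorph_eq0 sqrtr_eq0 -ltNge muU_gt0.
rewrite mul_Delta_root mulf_eq0 (negPf r0) orbF /div_val enum_valK mulf_eq0 => /orP[/eqP //|].
by rewrite fmorph_eq0 invr_eq0 gt_eqF // muU_gt0.
Qed.

Lemma div_mx_rank : \rank div_mx = \rank B.
Proof.
rewrite /div_mx; have full : row_full (diag_mx (\row_i (edge_scale i)%:C) : 'M[R[i]]_m).
  rewrite row_full_unit unitmxE det_diag unitfE; apply/prodf_neq0 => i _.
  by rewrite mxE fmorph_eq0 gt_eqF // edge_scale_gt0.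
by rewrite (eqmxMfull B full).
Qed.

Local Notation H := (L2rho mu e U).
Local Notation ip := (L2ip (mu2 mu) (OmE e U)).
Local Notation A := (Delta_op mu e U alpha).

Lemma L2rho_span g : H g -> exists c : 'rV_m, sqnorm ip (fun x => g x - lc c edge_fn x) = 0.
Proof.
move=> /L2rho_lc[c hc]; exists c.
rewrite (eq_q (mu2 mu) (g := fun=> 0)) ?(q_zero L2rho_ph) // => z /hc ->.
by rewrite subrr.
Qed.

Lemma Delta_lc c : A (lc c edge_fn, lc (c *m Delta_mx) edge_fn).
Proof.
split; [exact: lc_L2rho|exact: lc_L2rho|] => z zE /=.
by rewrite (grad_div (c := c)).
Qed.

Lemma Delta_q0 f g : A (f, g) -> [/\ H f, H g & exists c : 'rV_m,
  sqnorm ip (fun x => f x - lc c edge_fn x) = 0 /\ sqnorm ip (fun x => g x - lc (c *m Delta_mx) edge_fn x) = 0].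
Proof.
move=> [/= Hf Hg fg]; split => //; have [c hc] := L2rho_lc Hf; exists c; split.
  rewrite (eq_q (mu2 mu) (g := fun=> 0)) ?(q_zero L2rho_ph) // => z /hc ->.
  by rewrite subrr.
rewrite (eq_q (mu2 mu) (g := fun=> 0)) ?(q_zero L2rho_ph) // => z zE.
by rewrite fg // (grad_div hc zE) subrr.
Qed.

Lemma edge_fn_rho i : H (edge_fn i).
Proof. by rewrite -(lc_delta edge_fn); exact: lc_L2rho. Qed.

Lemma Delta_sym : sym_graph ip A.
Proof. exact: (finite_sym L2rho_ph edge_fn_rho edge_fn_on Delta_mx_herm Delta_q0). Qed.

(** Block constants annihilated by the divergence correspond to the left kernel of
   the incidence matrix, that is, to the cycle space of the graph without loops. A
   divergence that vanishes almost everywhere vanishes on all vertex sets, on which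
   it is constant and which have positive measure. *)
Lemma Delta_modes : exists k (lam : 'I_k -> R) (f : 'I_k -> Qp F * Qp F -> R[i]) (z : seq 'I_k),
  [/\ forall i, 0 <= lam i, eigenbasis H ip A lam f,
      uniq z /\ size z = (m - \rank B)%N, (forall j, (j \in z) = (lam j == 0)) &
      has_dim (ker_div_rho mu e U alpha) (L2null (mu2 mu) (OmE e U)) (m - \rank B)].
Proof.
have [k [E [lam [lam0 EM eb]]]] := finite_eigen L2rho_ph edge_fn_rho edge_fn_on Delta_mx_herm Delta_mx_psd L2rho_span Delta_lc.
have [||||z [uz sz zE dE]] := zero_modes L2rho_ph eb (g := edge_fn) (B := div_mx)
  (S := ker_div_rho mu e U alpha) edge_fn_rho.
- move=> x /eqP; rewrite /sqnorm (ip_lc L2rho_ph edge_fn_rho edge_fn_on) mxE Re_sum psumr_eq0.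
    move=> /allP h; apply/rowP => i; rewrite [RHS]mxE; have := h i (mem_index_enum _).
    by rewrite !mxE mulcJ /= => /eqP/nsq_eq0.
  by move=> i _; rewrite !mxE mulcJ /= nsq_ge0.
- move=> x x0; split; first exact: lc_L2rho.
  apply: aeW => y [u uy]; rewrite (div_edge_fn (c := x) _ uy) // /div_val x0 mxE mul0r.
  by [].
- move=> h [Hh dh]; split => // j lj; have [c hc] := L2rho_lc Hh.
  (* an almost everywhere statement about a constant *)
  have dv u : div_val c u = 0.
    apply: contrapT => du0; have := muU_gt0 p_prime mu_haar U_adm u.
    have [N [mN N0 sub]] := dh.
    suff : mu (U u) = 0%E by rewrite (muUE p_prime mu_haar U_adm) => -[->]; rewrite ltxx.
    apply: (subset_measure0 _ mN _ N0); first exact: U_measurable.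
    move=> x ux; apply: sub => /= /(_ (ex_intro _ u ux)).
    by rewrite (div_edge_fn hc ux).
  have cM : c *m Delta_mx = 0.
    by apply/rowP => i; rewrite mul_Delta_mx !dv subrr mulr0 mxE.
  have l0 : ((lam j)%:C : R[i]) != 0 by rewrite fmorph_eq0.
  rewrite (eq_L2ip (mu2 mu) (g := lc c edge_fn) (k := lc (row j E) edge_fn)) //.
  rewrite (ip_lc L2rho_ph edge_fn_rho edge_fn_on); apply: (mulIf l0); rewrite mul0r.
  have -> : (c *m (row j E)^t*) 0 0 * (lam j)%:C = (c *m ((lam j)%:C *: row j E)^t*) 0 0.
    rewrite !mxE mulr_suml; apply: eq_bigr => i _; rewrite !mxE conjcM conjc_real.
    by rewrite -mulrA [_^* * _]mulrC.
  by rewrite -EM adj_mul Delta_mx_herm mulmxA cM mul0mx mxE.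
- move=> j lj; exists (row j E); split.
    by apply: Delta_mx_ker; rewrite EM lj scale0r.
  rewrite (eq_q (mu2 mu) (g := fun=> 0)) ?(q_zero L2rho_ph) // => y _.
  by rewrite subrr.
exists k, lam, (fun i => lc (row i E) edge_fn), z; rewrite -div_mx_rank; split => //.
apply: dE.
- by apply: aeW => x.
- by move=> f Nf [Lf _ _]; apply/(L2nullP mE Lf).
- by move=> f [Lf _ _] f0; apply/(L2nullP mE Lf).
Qed.
End edge_laplacian.

(** * The finite approximations *)

Section finite_approximation.
Context {R : realType} {p : nat} {F : padicField R p}.
Hypothesis p_prime : prime p.
Context {V : finType}.
Variables (e : rel V) (U : V -> set (Qp F)) (alpha : R).
Hypothesis e_sym : symmetric e.
Hypothesis U_adm : admissible_sets U.
Variables (l n : nat) (c : 'I_n -> Qp F) (lab : 'I_n -> V).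
Hypothesis ld : level_data U l c lab.

Local Notation D i := (disc l (c i)).
Local Notation ip := (@discs_ip R p F V U l).
Local Notation A := (Dl_op e U alpha l).

Lemma fsum_discs (S : set (set (Qp F))) (P : pred 'I_n) (G : set (Qp F) -> R[i]) :
  (forall y, S y <-> exists2 j, P j & y = D j) ->
  \sum_(y \in S) G y = \sum_(j | P j) G (D j).
Proof.
move=> SP; pose r := [seq D j | j <- index_enum 'I_n & P j].
have -> : S = [set` r].
  apply/seteqP; split => y /=.
    by move=> /SP[j Pj ->]; apply: map_f; rewrite mem_filter Pj mem_index_enum.
  by move=> /mapP[j]; rewrite mem_filter => /andP[Pj _] ->; apply/SP; exists j.
rewrite -fsbig_seq ?big_map ?big_filter // map_inj_uniq ?filter_uniq ?index_enum_uniq //.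
by move=> i j; exact: (cell_inj p_prime ld).
Qed.

(** Turns the sums over a set of sets into sums over the indices of the cells. *)
Lemma discs_ipE f g : ip f g = \sum_i f (D i) * (g (D i))^*.
Proof.
rewrite /discs_ip (fsum_discs (P := xpredT)) // => y.
split=> [/(discsP p_prime ld)[j ->]|[j _ ->]]; first by exists j.
by apply/(discsP p_prime ld); exists j.
Qed.

Definition disc_wt i j : R := if (i != j) && e (lab i) (lab j)
  then (set_dist (D i) (D j) `^ (2 * alpha))^-1 else 0.

Lemma disc_wt_sym i j : disc_wt i j = disc_wt j i.
Proof.
rewrite /disc_wt eq_sym e_sym; case: ifP => // /andP[ji _].
have ij : i != j by rewrite eq_sym.
by rewrite (cell_set_dist p_prime ld ij) (cell_set_dist p_prime ld ji) qabsBC.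
Qed.

Lemma disc_wt_gt0 i j : i != j -> e (lab i) (lab j) -> 0 < disc_wt i j.
Proof.
move=> ij eij; rewrite /disc_wt ij eij invr_gt0 powR_gt0 // (cell_set_dist p_prime ld) //.
exact: (cell_dist_gt0 p_prime ld).
Qed.

Lemma disc_wt_ge0 i j : 0 <= disc_wt i j.
Proof. by rewrite /disc_wt; case: ifP => // _; rewrite invr_ge0 powR_ge0. Qed.

Lemma Dl_opE f g : A (f, g) <->
  forall i, g (D i) = \sum_j (disc_wt i j)%:C * (f (D i) - f (D j)).
Proof.
have h i : \sum_(y \in [set y | [/\ discs U l y, y <> D i & D i `*` y `<=` OmE e U]])
    (f (D i) - f y) / (set_dist (D i) y `^ (2 * alpha))%:C =
    \sum_j (disc_wt i j)%:C * (f (D i) - f (D j)).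
  rewrite (fsum_discs (P := fun j => (i != j) && e (lab i) (lab j))).
    rewrite big_mkcond; apply: eq_bigr => j _; rewrite /disc_wt.
    by case: ifP => _; rewrite ?[0%:C]rmorph0 ?mul0r // mulrC fmorphV.
  move=> y; split=> [[/(discsP p_prime ld)[j ->] ne /(cell_OmE p_prime e U_adm ld) eij]|].
    by exists j => //; rewrite eij andbT; apply/eqP => ij; apply: ne; rewrite ij.
  move=> [j /andP[ij eij] ->]; split.
  - by apply/(discsP p_prime ld); exists j.
  - by move=> /(cell_inj p_prime ld) ji; rewrite ji eqxx in ij.
  - exact/(cell_OmE p_prime e U_adm ld).
split=> [hA i|hA x /(discsP p_prime ld)[i ->]] /=.
  by rewrite -h; apply: hA; apply/(discsP p_prime ld); exists i.
by rewrite hA h.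
Qed.

Lemma discs_ph : pre_hilbert [set: set (Qp F) -> R[i]] ip.
Proof.
split => //.
- move=> a f g h _ _ _; rewrite !discs_ipE mulr_sumr -big_split.
  by apply: eq_bigr => i _; rewrite mulrDl mulrA.
- move=> f g _ _; rewrite !discs_ipE conjc_sum; apply: eq_bigr => i _.
  by rewrite conjcM conjCK mulrC.
- move=> f _; rewrite discs_ipE sumr_ge0 // => i _.
  by rewrite mulcJ ler0c nsq_ge0.
Qed.

Definition disc_fn i : set (Qp F) -> R[i] := fun B => (`[< B = D i >])%:R.

Lemma lc_disc_fn (x : 'rV[R[i]]_n) i : lc x disc_fn (D i) = x 0 i.
Proof.
rewrite lcE (bigD1 i) //= /disc_fn asboolT // mulr1 big1 ?addr0 // => j ji.
rewrite asboolF ?mulr0 // => /(cell_inj p_prime ld) ij.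
by rewrite ij eqxx in ji.
Qed.

Lemma disc_fn_on i j : ip (disc_fn i) (disc_fn j) = (i == j)%:R.
Proof.
have bLE i' k : disc_fn i' (D k) = (i' == k)%:R.
  by rewrite -(lc_delta disc_fn) lc_disc_fn mxE eqxx eq_sym.
rewrite discs_ipE (bigD1 i) //= !bLE eqxx mul1r big1 ?addr0 => [|k ki].
  by rewrite rmorph_nat eq_sym.
by rewrite bLE eq_sym (negPf ki) mul0r.
Qed.

Lemma q_discs0 f : (forall i, f (D i) = 0) -> sqnorm ip f = 0.
Proof.
by move=> f0; rewrite /sqnorm discs_ipE big1 // => i _; rewrite f0 mul0r.
Qed.

Local Notation M := (lap disc_wt).

Lemma discs_span g : [set: set (Qp F) -> R[i]] g ->
  exists x : 'rV_n, sqnorm ip (fun y => g y - lc x disc_fn y) = 0.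
Proof.
move=> _; exists (\row_i g (D i)); apply: q_discs0 => i.
by rewrite lc_disc_fn mxE subrr.
Qed.

Lemma Dl_lc (x : 'rV_n) : A (lc x disc_fn, lc (x *m M) disc_fn).
Proof.
apply/Dl_opE => i; rewrite lc_disc_fn (lapE disc_wt_sym).
by apply: eq_bigr => j _; rewrite !lc_disc_fn.
Qed.

Lemma Dl_q0 f g : A (f, g) -> [/\ setT f, setT g & exists x : 'rV_n,
  sqnorm ip (fun y => f y - lc x disc_fn y) = 0 /\ sqnorm ip (fun y => g y - lc (x *m M) disc_fn y) = 0].
Proof.
move=> /Dl_opE fg; split => //; exists (\row_i f (D i)).
split; apply: q_discs0 => i; first by rewrite lc_disc_fn mxE subrr.
rewrite fg lc_disc_fn (lapE disc_wt_sym) -sumrB big1 // => j _.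
by rewrite !mxE subrr.
Qed.

Lemma Dl_sym : sym_graph ip A.
Proof. exact: (finite_sym discs_ph _ disc_fn_on (lap_herm disc_wt_sym) Dl_q0). Qed.

Hypothesis nb : forall v, exists w, e v w.
Variable o : 'I_#|edges (loopless e)| -> V * V.
Hypothesis o_e : forall i, e (o i).1 (o i).2.
Hypothesis o_surj : forall u v, u != v -> e u v -> exists i, o i = (u, v) \/ o i = (v, u).
Local Notation B := (incidence (R := R) o)^T.

(** The finite approximation is again a graph Laplacian on the cells, with other
   weights but with the same pairs of coupled cells as the vertex Laplacian, and so
   has the same zero modes. *)
Lemma Dl_modes : exists k (lam : 'I_k -> R) (f : 'I_k -> set (Qp F) -> R[i]) (z : seq 'I_k),
  [/\ forall i, 0 <= lam i, eigenbasis setT ip A lam f,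
      uniq z, size z = (#|V| - \rank B)%N & (forall j, (j \in z) = (lam j == 0))].
Proof.
have Hb i : [set: set (Qp F) -> R[i]] (disc_fn i) by [].
have [k [E [lam [lam0 EM eb]]]] := finite_eigen discs_ph Hb disc_fn_on
  (lap_herm disc_wt_sym) (lap_psd disc_wt_sym disc_wt_ge0) discs_span Dl_lc.
pose g (j : 'I_#|V|) := lc (\row_i (lab i == enum_val j)%:R : 'rV[R[i]]_n) disc_fn.
have lcg (x : 'rV_#|V|) i : lc x g (D i) = x 0 (enum_rank (lab i)).
  rewrite lcE (bigD1 (enum_rank (lab i))) //= /g lc_disc_fn mxE enum_rankK eqxx mulr1.
  rewrite big1 ?addr0 // => j ji; rewrite lc_disc_fn mxE; case: eqP => [h|]; last by rewrite mulr0.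
  by rewrite h enum_valK eqxx in ji.
have [|||||z [uz sz zE _]] := zero_modes discs_ph eb (g := g) (B := B)
  (S := [set f | A (f, fun=> 0)]).
- by [].
- move=> x; rewrite /sqnorm discs_ipE Re_sum => /eqP; rewrite psumr_eq0 => [/allP h|i _]; last first.
    by rewrite mulcJ nsq_ge0.
  apply/rowP => j; have [i ij] := lab_surj U_adm ld (enum_val j).
  have := h i (mem_index_enum _); rewrite mulcJ lcg ij enum_valK mxE.
  by move=> /eqP/nsq_eq0.
- move=> x xB; apply/Dl_opE => i; rewrite big1 // => j _; rewrite !lcg /disc_wt.
  case: ifP => [/andP[_ eij]|]; last by rewrite [0%:C]rmorph0 mul0r.
  have xE : x = \row_k (fun v => x 0 (enum_rank v)) (enum_val k).
    by apply/rowP => k'; rewrite mxE enum_valK.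
  move: xB; rewrite {1}xE => /(incidence_ker o_e o_surj (fun v => x 0 (enum_rank v))) hx.
  by rewrite (hx _ _ eij) subrr mulr0.
- move=> f Sf; split => // j lj.
  have [_ Ae _ _] := eb; have := Dl_sym Sf (Ae j).
  rewrite (ip0l discs_ph) // (ip_scaler discs_ph) // conjc_real => /esym/eqP.
  by rewrite mulf_eq0 fmorph_eq0 (negPf lj) => /eqP.
- move=> j l0E; have := EM j; rewrite l0E scale0r => EM0.
  have [x [hx xE]] := lap_null_label disc_wt_sym disc_wt_ge0 e_sym nb (lab_surj U_adm ld) disc_wt_gt0 EM0.
  exists (\row_j x (enum_val j)); split.
    by apply/(incidence_ker o_e o_surj x) => u v uv; rewrite (hx u v uv).
  by apply: q_discs0 => i; rewrite lc_disc_fn lcg xE mxE enum_rankK subrr.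
by exists k, lam, (fun i => lc (row i E) disc_fn), z.
Qed.
End finite_approximation.

(** * The index formula *)

Lemma L2null0 d (T : measurableType d) (R : realType) (mu : {measure set T -> \bar R}) D :
  L2null mu D (fun=> 0 : R[i]).
Proof. exact: aeW. Qed.

Lemma L2null_lin d (T : measurableType d) (R : realType) (mu : {measure set T -> \bar R}) D
    a (f g : T -> R[i]) : L2null mu D f -> L2null mu D g ->
  L2null mu D (fun x => a * f x + g x).
Proof. by apply: filterS2 => x hf hg Dx; rewrite hf // hg // mulr0 addr0. Qed.

Section traces.
Context {T : Type} {R : realType} (H : set (T -> R[i])).
Variables (ip : (T -> R[i]) -> (T -> R[i]) -> R[i]) (A : set ((T -> R[i]) * (T -> R[i]))).
Hypothesis ph : pre_hilbert H ip.
Hypothesis Asym : sym_graph ip A.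
Variables (J : choiceType) (nu : J -> R) (f : J -> T -> R[i]).
Hypothesis eb : eigenbasis H ip A nu f.

Lemma heat_trace_ex : exists tr, heat_trace H ip A tr.
Proof.
by exists (fun t => \esum_(i in [set: J]) (expR (- nu i * t))%:E)%E, J, nu, f.
Qed.

Lemma heat_trace_limit (z : seq J) tr : (forall j, 0 <= nu j) -> uniq z ->
  (forall j, (j \in z) = (nu j == 0)) -> heat_trace H ip A tr ->
  (\forall t \near +oo, (tr t < +oo)%E) ->
  tr t @[t --> +oo] --> ((size z)%:R : R)%:E.
Proof.
move=> nu0 uz zE htr; apply: (trace_limit nu0 uz zE) => t.
exact: (heat_trace_unique ph Asym t eb htr).
Qed.
End traces.

Lemma heat_trace_finite_limit T (R : realType) (H : set (T -> R[i])) ip A k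
    (nu : 'I_k -> R) f (z : seq 'I_k) tr :
  pre_hilbert H ip -> sym_graph ip A -> eigenbasis H ip A nu f ->
  (forall j, 0 <= nu j) -> uniq z -> (forall j, (j \in z) = (nu j == 0)) ->
  heat_trace H ip A tr -> tr t @[t --> +oo] --> ((size z)%:R : R)%:E.
Proof.
move=> ph sA eb nu0 uz zE htr; apply: (heat_trace_limit ph sA eb) => //.
apply: nearW => t; rewrite (heat_trace_unique ph sA t eb htr).
exact: finite_trace.
Qed.

(** The rank of the incidence matrix cancels in the difference of the dimensions of
   its two kernels. *)
Lemma euler_char_rank (V : finType) (e : rel V) r : (r <= #|V|)%N ->
  (r <= #|edges (loopless e)|)%N ->
  euler_char (loopless e) = (#|V| - r)%:Z - (#|edges (loopless e)| - r)%:Z.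
Proof. by move=> r1 r2; rewrite /euler_char -!subzn // opprB addrA subrK. Qed.

Theorem theorem4p5 (R : realType) (p : nat) (p_prime : prime p)
    (F : padicField R p) (mu : {sigma_finite_measure set (Qp F) -> \bar R})
    (mu_haar : is_haar mu) (V : finType) (e : rel V) (e_sym : symmetric e)
    (U : V -> set (Qp F)) (U_adm : admissible_sets U)
    (alpha : R) (alpha_gt0 : 0 < alpha) :
  ((forall v, e v v) ->
    [/\ ind_defined mu e U alpha,
        euler_char (loopless e) = ind mu e U alpha,
        (exists trD, heat_trace_D mu e U alpha trD),
        (exists trDelta, heat_trace_Delta mu e U alpha trDelta) &
        forall trD trDelta : R -> \bar R,
          heat_trace_D mu e U alpha trD ->
          heat_trace_Delta mu e U alpha trDelta ->
          (2^-1 <= alpha -> \forall t \near +oo, (trD t < +oo)%E) /\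
          ((\forall t \near +oo, (trD t < +oo)%E) ->
            (trD t - trDelta t)%E @[t --> +oo] -->
              ((euler_char (loopless e))%:~R : R)%:E)]) /\
  (~ (forall v, e v v) ->
    ((forall v, exists w, e v w) -> ind_defined mu e U alpha) /\
    (ind_defined mu e U alpha ->
      [/\ euler_char (loopless e) = ind mu e U alpha,
          (\forall l \near \oo, exists trDl, heat_trace_Dl e U alpha l trDl),
          (exists trDelta, heat_trace_Delta mu e U alpha trDelta) &
          forall (trDl : nat -> R -> \bar R) (trDelta : R -> \bar R),
            (\forall l \near \oo, heat_trace_Dl e U alpha l (trDl l)) ->
            heat_trace_Delta mu e U alpha trDelta ->
            exists L : nat -> \bar R,
              (\forall l \near \oo,
                (trDl l t - trDelta t)%E @[t --> +oo] --> L l) /\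
              L l @[l --> \oo] --> ((euler_char (loopless e))%:~R : R)%:E])).
Proof.
have [l0 [n [c [lab [ld discU]]]]] := levels p_prime U_adm.
have [ori [hne o_e o_set o_surj]] := orientation e.
pose B := incidence (R := R) ori.
have rB : \rank B^T = \rank B by exact: mxrank_tr.
have chi : euler_char (loopless e) =
    (#|V| - \rank B)%:Z - (#|edges (loopless e)| - \rank B)%:Z.
  by apply: euler_char_rank; [exact: rank_leq_col|exact: rank_leq_row].
have chiR : ((euler_char (loopless e))%:~R : R) =
    (#|V| - \rank B)%:R - (#|edges (loopless e)| - \rank B)%:R.
  by rewrite chi intrB.
have phD := L2_pre_hilbert mu (OmV_measurable U_adm).
have tw := D_tower p_prime mu_haar alpha e_sym U_adm ld.
have [kk [E [lam [lam0 EE EM EQ eb]]]] := tower_eigen phD tw.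
have symD := tower_sym phD tw.
have phE := L2rho_ph p_prime mu_haar U_adm ori.
have symE : sym_graph (L2ip (mu2 mu) (OmE e U)) (Delta_op mu e U alpha).
  exact: (Delta_sym p_prime mu_haar e_sym U_adm hne o_e o_set o_surj).
have [k2 [nu2 [f2 [z2 [nu20 eb2 [uz2 sz2] z2E dim2]]]]] :=
  Delta_modes p_prime mu_haar alpha e_sym U_adm hne o_e o_set o_surj.
have limDelta trDelta : heat_trace_Delta mu e U alpha trDelta ->
    trDelta t @[t --> +oo] --> ((#|edges (loopless e)| - \rank B)%:R : R)%:E.
  by rewrite -sz2 => h; exact: (heat_trace_finite_limit phE symE eb2).
have modesD nb := D_zero_modes p_prime mu_haar e_sym U_adm ld EM eb nb o_e o_surj.
have dimD : (forall v, exists w, e v w) ->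
    has_dim (ker_d mu e U alpha) (L2null mu (OmV U)) (#|V| - \rank B).
  by move=> nb; have [z [_ _ _]] := modesD nb; rewrite rB.
have indE : (forall v, exists w, e v w) -> euler_char (loopless e) = ind mu e U alpha.
  move=> nb; rewrite chi /ind; congr (_%:Z - _%:Z); apply/esym.
    by apply: (dimE _ _ (dimD nb)); [exact: L2null0|exact: L2null_lin].
  by apply: (dimE _ _ dim2); [exact: L2null0|exact: L2null_lin].
have indD : (forall v, exists w, e v w) -> ind_defined mu e U alpha.
  by move=> nb; split; eexists; [exact: dimD|exact: dim2].
have exDelta : exists trDelta, heat_trace_Delta mu e U alpha trDelta.
  exact: heat_trace_ex eb2.
split=> [loops|_].
  have nb v : exists w, e v w by exists v.
  split; [exact: indD|exact: indE|exact: heat_trace_ex eb|exact: exDelta|].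
  move=> trD trDelta htD htDelta; split=> [alpha_ge|finD].
    have := trace_D_finite p_prime mu_haar e_sym U_adm ld discU loops alpha_ge lam0 EE EM EQ.
    by apply: filterS => t; rewrite (heat_trace_unique phD symD t eb htD).
  have [z [uz sz zE _]] := modesD nb.
  rewrite chiR EFinB; apply: cvgeB => //; last exact: limDelta.
  rewrite -rB -sz; apply: (heat_trace_limit phD symD eb) => //.
split; first exact: indD.
move=> ind_def.
have nb := fin_dim_no_isolated p_prime mu_haar e_sym U_adm ld ind_def.1.
have [l1 hl1] := level_exists p_prime U_adm.
split; [exact: indE| |exact: exDelta|].
  exists l1 => // l /= /hl1[nl [cl [labl ldl]]].
  have [k [nu [f [z [_ ebl _ _ _]]]]] := Dl_modes p_prime alpha e_sym U_adm ldl nb o_e o_surj.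
  exact: heat_trace_ex ebl.
move=> trDl trDelta htDl htDelta.
exists (fun=> ((euler_char (loopless e))%:~R : R)%:E); split; last exact: cvg_cst.
near=> l.
have [|nl [cl [labl ldl]]] := hl1 l; first by near: l; exact: nbhs_infty_ge.
have [k [nu [f [z [nu0 ebl uz sz zE]]]]] := Dl_modes p_prime alpha e_sym U_adm ldl nb o_e o_surj.
have h : trDl l t @[t --> +oo] --> ((size z)%:R : R)%:E.
  apply: (heat_trace_finite_limit (discs_ph p_prime ldl) (Dl_sym p_prime e_sym U_adm ldl) ebl) => //.
  by near: l.
rewrite chiR EFinB; apply: cvgeB => //; last exact: limDelta.
by rewrite -rB -sz.
Unshelve. all: by end_near. Qed.
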